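(* In the setting described in the context, let $b\colon\mathbb{N}\to\mathbb{H}$ be a bijective function (write $b_n=b(n)$), let $I\in\mathcal{P}(\mathbb{H})$, $N\in\mathbb{N}$, $\delta\in(-\infty,\frac14)$ satisfy that for all $n\in\mathbb{N}$ it holds that $\lambda_{b_n}=-\pi^2n^2$ and $\mu_{b_n}=|\lambda_{b_n}|^\delta$, and let $\varphi\colon H\to\mathbb{R}$ satisfy for all $v\in H$ that $\varphi(v)=\exp(-\|v\|_H^2)$. Then $\varphi\in C^4_b(H,\mathbb{R})$, $B\in\bigcap_{r\in(-\infty,-\frac12[\frac12+2\delta])}HS(H,H_r)$, and $$\mathbb{E}\big[\varphi(X^{\{b_1,\dots,b_N\}}_T)\big]-\mathbb{E}\big[\varphi(X^{\mathbb{H}}_T)\big]\ge\left[\frac{\mathbb{E}[\varphi(X^{\mathbb{H}}_T)]\,2^{(4\delta-5)}\,(1-e^{-T})}{\big(2-4\delta+2^{(7\delta-7)}(1-4\delta)^{-1/3}\big)^{3/2}}\right]|\lambda_{b_N}|^{-(1-[\frac12+2\delta])}.$$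
   Context: Setting. Let $(H,\langle\cdot,\cdot\rangle_H,\|\cdot\|_H)$ be a separable $\mathbb{R}$-Hilbert space, let $T\in(0,\infty)$, let $(\Omega,\mathcal{F},\mathbb{P},(\mathcal{F}_t)_{t\in[0,T]})$ be a stochastic basis, let $(W_t)_{t\in[0,T]}$ be an $\operatorname{Id}_H$-cylindrical $(\mathcal{F}_t)_{t\in[0,T]}$-Wiener process, let $\mathbb{H}\subseteq H$ be a nonempty orthonormal basis of $H$, let $\lambda\colon\mathbb{H}\to\mathbb{R}$ satisfy $\sup_{b\in\mathbb{H}}\lambda_b<0$, let $A\colon D(A)\subseteq H\to H$ be the linear operator with $D(A)=\{v\in H\colon\sum_{b\in\mathbb{H}}|\lambda_b\langle b,v\rangle_H|^2<\infty\}$ and $Av=\sum_{b\in\mathbb{H}}\lambda_b\langle b,v\rangle_Hb$ for $v\in D(A)$, let $(H_r,\langle\cdot,\cdot\rangle_{H_r},\|\cdot\|_{H_r})$, $r\in\mathbb{R}$, be a family of interpolation spaces associated to $-A$ (for $r\ge0$: $H_r=D((-A)^r)$ with norm $\|(-A)^r\cdot\|_H$; for $r<0$: the completion of $H$ under $\|(-A)^r\cdot\|_H$), and let $(P_I)_{I\in\mathcal{P}(\mathbb{H})}\subseteq L(H_{-1})$ satisfy $P_I(v)=\sum_{b\in I}\langle b,v\rangle_Hb$ for all $v\in H$, $I\subseteq\mathbb{H}$. Here $\mathcal{P}(\mathbb{H})$ is the power set of $\mathbb{H}$. Let $\beta\in[0,\frac12)$, let $\mu\colon\mathbb{H}\to\mathbb{R}$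 satisfy $\sum_{b\in\mathbb{H}}|\mu_b|^2|\lambda_b|^{-2\beta}<\infty$, and let $B\in HS(H,H_{-\beta})$ satisfy $Bv=\sum_{b\in\mathbb{H}}\mu_b\langle b,v\rangle_Hb$ for all $v\in H$. For $I\in\mathcal{P}(\mathbb{H})$ let $X^I\colon[0,T]\times\Omega\to H$ be the up-to-modifications unique $(\mathcal{F}_t)_{t\in[0,T]}$-predictable process with $\sup_{t\in[0,T]}\mathbb{E}[\|X^I_t\|_H^p]<\infty$ for all $p\in(0,\infty)$ and such that for all $t\in[0,T]$ it holds $\mathbb{P}$-a.s. that $X^I_t=\int_0^te^{A(t-s)}P_IB\,dW_s$. $C^4_b(H,\mathbb{R})$ denotes the four times continuously Fréchet differentiable functions with globally bounded derivatives of orders $1,\dots,4$; $HS(H,H_r)$ denotes the Hilbert-Schmidt operators from $H$ to $H_r$ (and $B\in HS(H,H_r)$ means that $B$, viewed as a map into $H_r$, is Hilbert-Schmidt). *)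

(* Defs.v *)
From HB Require Import structures.
From mathcomp Require Import all_boot all_order all_algebra.
From mathcomp Require Import sesquilinear.
From mathcomp Require Import all_classical all_reals all_analysis.

Set Implicit Arguments.
Unset Strict Implicit.
Unset Printing Implicit Defensive.

Import Order.TTheory GRing.Theory Num.Theory.
Import numFieldNormedType.Exports.

Local Open Scope classical_set_scope.
Local Open Scope ring_scope.

HB.mixin Record CompleteNormedModule_isHilbert (R : realType) V
    & CompleteNormedModule R V := {
  inner : {dot V for @idfun R};
  inner_normE : forall v : V, inner v v = `|v| ^+ 2 }.

#[short(type="hilbertType")]
HB.structure Definition Hilbert (R : realType) :=
  { V of CompleteNormedModule R V & CompleteNormedModule_isHilbert R V }.

Definition separable (T : topologicalType) :=
  exists D : set T, countable D /\ dense D.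

Section Sums.
Context {R : realType} {V : normedModType R} {I : choiceType}.

(* [v] is the limit of the net of finite partial sums of [f] over [S]
   (unconditional convergence). *)
Definition usums_to (S : set I) (f : I -> V) (v : V) : Prop :=
  forall e : R, 0 < e -> exists2 A, fsets S A &
    forall B, fsets S B -> A `<=` B -> `|v - \sum_(i \in B) f i| < e.

Definition usum (S : set I) (f : I -> V) : V := xget 0 (usums_to S f).

End Sums.

Definition orthonormal_basis {R : realType} {H : hilbertType R} (HB : set H) :=
  {in HB &, forall u v : H, inner u v = (u == v)%:R} /\
  (forall v : H, usums_to HB (fun b : H => inner b v *: b) v).

Section Operators.
Context {R : realType} {H : hilbertType R}.

Definition diag_dom (HB : set H) (c : H -> R) : set H :=
  [set v | (\esum_(b in HB) ((`|c b * inner b v| ^+ 2)%:E) < +oo)%E].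

Definition diag_op (HB : set H) (c : H -> R) (v : H) : H :=
  usum HB (fun b : H => (c b * inner b v) *: b).

(* For the operator [A = diag_op HB lam] with domain [diag_dom HB lam], all
   [lam b] being negative, the powers of [- A] and the semigroup generated by
   [A] are diagonal too: (-A)^r v = \sum_b |lam b|^r <b, v> b and
   e^(tA) v = \sum_b e^(t lam b) <b, v> b. *)
Definition frac_dom (HB : set H) (lam : H -> R) (r : R) : set H :=
  diag_dom HB (fun b => `|lam b| `^ r).

Definition frac_pow (HB : set H) (lam : H -> R) (r : R) : H -> H :=
  diag_op HB (fun b => `|lam b| `^ r).

Definition semigroup (HB : set H) (lam : H -> R) (t : R) : H -> H :=
  diag_op HB (fun b => expR (t * lam b)).

Definition bounded_op {U V : normedModType R} (C : U -> V) : Prop :=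
  linear C /\ continuous C.

(* The value does not depend on the orthonormal basis [HB]. *)
Definition hs_sqnorm (HB : set H) {V : normedModType R} (C : H -> V) : \bar R :=
  (\esum_(b in HB) ((`|C b| ^+ 2)%:E))%E.

Definition hilbert_schmidt (HB : set H) {V : hilbertType R} (C : H -> V) :=
  bounded_op C /\ (hs_sqnorm HB C < +oo)%E.

End Operators.

(* The interpolation spaces associated to [- A], with [A] as above.  All the spaces [Hr r], as well as [H], are realised inside one vector space
   [E] through the linear injections [emb r] and [iota]; an element of [Hr r]
   and an element of [Hr s] are identified when they have the same image. *)

Section Interpolation.
Context {R : realType} {H : hilbertType R}.
Variables (HB : set H) (lam : H -> R).
Variables (E : lmodType R) (iota : H -> E).
Variables (Hr : R -> hilbertType R) (emb : forall r, Hr r -> E).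

Record interpolation_family : Prop := InterpolationFamily {
  iota_linear : linear iota;
  iota_inj : injective iota;
  emb_linear : forall r, linear (@emb r);
  emb_inj : forall r, injective (@emb r);
  interp_ge0 : forall r, 0 <= r ->
    range (@emb r) = iota @` frac_dom HB lam r;
  (* for [r < 0], [Hr r] is complete and contains [H] as a dense subspace *)
  interp_lt0 : forall r, r < 0 -> range iota `<=` range (@emb r);
  interp_dense : forall r, r < 0 ->
    dense [set x : Hr r | range iota (emb x)];
  interp_norm : forall r (x : Hr r) (v : H),
    emb x = iota v -> `|x| = `|frac_pow HB lam r v|;
  (* continuity of the inclusions [Hr s] in [Hr r] *)
  interp_incl : forall r s, r <= s -> exists C : R, forall y : Hr s,
    exists2 x : Hr r, emb x = emb y & `|x| <= C * `|y| }.

(* The element [x] of [E] viewed as an element of [Hr r]. *)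
Definition view (r : R) (x : E) : Hr r :=
  xget 0 [set y : Hr r | emb y = x].

(* [B] is in HS(H, Hr s), where [B] takes its values in [Hr r]. *)
Definition in_HS (r s : R) (B : H -> Hr r) : Prop :=
  exists C : H -> Hr s,
    hilbert_schmidt HB C /\ forall v, emb (C v) = emb (B v).

(* The family [P], indexed by the subsets [I] of [HB], consists of bounded
   operators on [Hr (- 1)] with P_I v = \sum_(b in I) <b, v> b on [H]. *)
Definition spectral_projections (P : set H -> Hr (- 1) -> Hr (- 1)) : Prop :=
  forall I, I `<=` HB -> bounded_op (P I) /\
    forall v : H, emb (P I (view (- 1) (iota v))) =
                  iota (usum I (fun b : H => inner b v *: b)).

(* [S t] is, for [0 < t], the bounded extension of e^(tA) to an operator
   from [Hr (- 1)] to [H]. *)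
Definition smoothing_semigroup (S : R -> Hr (- 1) -> H) : Prop :=
  forall t, 0 < t -> bounded_op (S t) /\
    forall v : H, S t (view (- 1) (iota v)) = semigroup HB lam t v.

End Interpolation.

Section Stochastic.
Context {d : measure_display} {Omega : measurableType d} {R : realType}.
Variables (Pr : probability Omega R) (T : R).

(* Filtration on [0, T] satisfying the usual conditions. *)
Record stochastic_basis (F : R -> set (set Omega)) : Prop := StochasticBasis {
  filtration_sigma : forall (t : R), 0 <= t <= T -> sigma_algebra setT (F t);
  filtration_sub : forall (t : R), 0 <= t <= T -> F t `<=` measurable;
  filtration_nondecr : forall (s t : R), 0 <= s -> s <= t -> t <= T -> F s `<=` F t;
  filtration_right_cont : forall (t : R), 0 <= t < T ->
    \bigcap_(s in [set s | t < s <= T]) F s = F t;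
  filtration_null : forall A, measurable A -> Pr A = 0%E -> F 0 A }.

Variable F : R -> set (set Omega).

Definition predictable_rects : set (set (R * Omega)) :=
  [set D | (exists (s t : R) (A : set Omega), [/\ 0 <= s, s <= t, t <= T, F s A &
              D = [set` `]s, t]] `*` A]) \/
           (exists2 A, F 0 A & D = [set 0] `*` A)].

(* Measurability is with respect to the Borel sigma-algebra of [H]. *)
Definition predictable {H : topologicalType} (X : R -> Omega -> H) : Prop :=
  let D := [set` `[0, T]] `*` [set: Omega] in
  forall U : set H, open U ->
    <<s D, predictable_rects >> (D `&` [set p | U (X p.1 p.2)]).

Context {H : hilbertType R}.

(* Id_H-cylindrical (F_t)-Wiener process; [W t u] stands for <u, W_t>. *)
Record cylindrical_wiener (W : R -> H -> Omega -> R) : Prop :=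
  CylindricalWiener {
  wiener_adapted : forall (t : R) (u : H), 0 <= t <= T ->
    forall C, measurable C -> F t (W t u @^-1` C);
  wiener_linear : forall (t a : R) (u v : H), 0 <= t <= T ->
    {ae Pr, forall w, W t (a *: u + v) w = a * W t u w + W t v w};
  wiener_0 : forall u, {ae Pr, forall w, W 0 u w = 0};
  wiener_incr_law : forall (s t : R) (u : H), 0 <= s -> s < t -> t <= T -> u != 0 ->
    forall C, measurable C ->
      Pr ((W t u \- W s u) @^-1` C) =
      normal_prob 0 (Num.sqrt (t - s) * `|u|) C;
  wiener_incr_indep : forall (s t : R) (u : H), 0 <= s -> s < t -> t <= T ->
    forall A C, F s A -> measurable C ->
      Pr (A `&` (W t u \- W s u) @^-1` C) =
      (Pr A * Pr ((W t u \- W s u)%R @^-1` C))%E;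
  wiener_continuous : forall u,
    {ae Pr, forall w, {within [set` `[0, T]], continuous (fun t => W t u w)}} }.

(* The elementary operator-valued integrand
   1_(]lo, hi])(s) 1_ev(w) <vin, .> vout. *)
Record rank_one_step := RankOneStep {
  lo : R; hi : R; ev : set Omega; vin : H; vout : H }.

Definition admissible_step (t : R) (e : rank_one_step) : Prop :=
  [/\ 0 <= lo e, lo e <= hi e, hi e <= t & F (lo e) (ev e)].

Definition elementary_val (L : seq rank_one_step) (s : R) (w : Omega) (v : H)
    : H :=
  \sum_(e <- L) (\1_([set` `]lo e, hi e]] : set R) s * \1_(ev e) w
                   * inner (vin e) v) *: vout e.

Definition elementary_int (W : R -> H -> Omega -> R) (L : seq rank_one_step)
    (w : Omega) : H :=
  \sum_(e <- L) (\1_(ev e) w * (W (hi e) (vin e) w - W (lo e) (vin e) w))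
                   *: vout e.

(* [Y] is (a version of) the Ito integral \int_0^t Phi_s dW_s of the
   HS(H, H)-valued process [Phi]: elementary integrands converge to [Phi] in
   L^2([0, t] x Omega; HS(H, H)) and their integrals converge to [Y] in
   L^2(Omega; H). *)
Definition is_ito_integral (HB : set H) (W : R -> H -> Omega -> R) (t : R)
    (Phi : R -> Omega -> H -> H) (Y : Omega -> H) : Prop :=
  exists L : nat -> seq rank_one_step,
  [/\ forall n i e, onth (L n) i = Some e -> admissible_step t e,
      (fun n => \int[Pr]_w \int[lebesgue_measure]_(s in [set` `[0%R, t]])
         hs_sqnorm HB (fun v => elementary_val (L n) s w v - Phi s w v)%R)%E
        @ \oo --> 0%E &
      (fun n => \int[Pr]_w (`|Y w - elementary_int W (L n) w| ^+ 2)%:E)%E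
        @ \oo --> 0%E].

End Stochastic.

Section Cnb.
Context {R : realType} {H : normedModType R}.

(* A [k]-linear form is given by its values on sequences of length [k]. *)
Definition multilinear (k : nat) (M : seq H -> R) : Prop :=
  forall s1 s2 : seq H, (size s1 + size s2).+1 = k ->
    linear (fun v : H => M (s1 ++ v :: s2) : R^o).

(* The operator norm of the [k]-linear form [M] is at most [c]. *)
Definition form_bound (k : nat) (M : seq H -> R) (c : R) : Prop :=
  forall s, size s = k -> `|M s| <= c * \prod_(v <- s) `|v|.

(* [f] is [n] times continuously Frechet differentiable and its derivatives of
   orders 1, ..., n are globally bounded; [D k x] is the [k]-th derivative of
   [f] at [x], as a [k]-linear form, the first argument of [D k.+1 x] being the
   direction in which [D k] is differentiated. *)
Definition Cnb (n : nat) (f : H -> R) : Prop :=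
  exists D : nat -> H -> seq H -> R,
  [/\ forall x, D 0%N x [::] = f x,
      forall k x, (k <= n)%N -> multilinear k (D k x),
      forall k x, (k < n)%N -> forall e : R, 0 < e -> \forall h \near (0 : H),
        form_bound k (fun s => D k (x + h) s - D k x s - D k.+1 x (h :: s))
          (e * `|h|),
      forall x (e : R), 0 < e -> \forall y \near x,
        form_bound n (fun s => D n y s - D n x s) e &
      forall k, (1 <= k <= n)%N ->
        exists c : R, forall x, form_bound k (D k x) c].

End Cnb.

(* Main.v *)
(* The coordinates <b_n, X_T^I>, b_n in I, are independent centred normal variables
   with variances q_n = mu_n^2 (1 - e^(2 lam_n T)) / (2 |lam_n|), hence
   E exp(-|X_T^I|^2) is the product of the (1 + 2 q_n)^(-1/2), b_n in I.  The ratio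
   of the two expectations is therefore at least
   (1 + sum_(n > N) 2 q_n)^(1/2), and the sum, being bounded below by a multiple
   of sum_(n > N) n^(4 delta - 2), is compared with a telescoping sum of
   differences of n^(4 delta - 1).

   For the law of X_T^I: tested against a finite combination u of basis vectors,
   the integrand is deterministic and Lipschitz in time, so by the Ito isometry
   <u, X_T^I> is an L^2 limit of sums of independent Wiener increments, which
   gives E cos <u, X_T^I>.  Writing exp(-x^2) as the average of cos(sqrt 2 g x)
   over a standard normal g, one coordinate at a time, turns this into
   E exp(-sum_(n <= M) <b_n, X_T^I>^2), and M tends to infinity.

   The directional derivatives of exp(-|x|^2) are polynomials in inner products
   times exp(-|x|^2); they are bounded, and the mean value theorem makes them
   Frechet derivatives.  For the Hilbert-Schmidt property, the series
   sum_n mu_n <b_n, v> b_n converges absolutely in H_r, as the sum of the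
   mu_n^2 |lam_n|^(2 r) is finite. *)
Require Import Defs.
From mathcomp Require Import all_boot all_order all_algebra.
From mathcomp Require Import sesquilinear.
From mathcomp Require Import all_classical all_reals all_analysis.
From mathcomp Require Import measurable_realfun ring lra.

Set Implicit Arguments.
Unset Strict Implicit.
Unset Printing Implicit Defensive.

Import Order.TTheory GRing.Theory Num.Theory.
Import numFieldNormedType.Exports.
Local Open Scope classical_set_scope.
Local Open Scope ring_scope.


(** * Inner products *)

(** Little about [X] is directly usable: [is_ito_integral] only asserts that some random elementary
    integrands approximate the given one, and names no law. These unknown integrands are compared
    with an explicit deterministic step function. The difference of the two is again elementary, so
    the isometry for elementary integrands suffices and no general Ito integral has to be
    constructed. As the integrand is operator-valued, it is replaced by its adjoint applied to a
    test vector [u], which is a field with values in H. Cosines can stand for complex exponentials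
    because centred normal laws are symmetric and all sine terms have mean 0. The condition delta <
    1/4 enters as k = 1 - 4 delta > 0, which makes the variances summable. The tail of the product
    yields a factor 1 / (pi k) under a square root; the stated bracket lies below what this gives,
    because the 3/2 power in its denominator is at least 1 + k, while pi k <= 4 (1 + k). *)

Section InnerProduct.
Context {R : realType} {H : hilbertType R}.
Implicit Types u v w : H.

Lemma innerC u v : inner u v = inner v u.
Proof. by rewrite hermC expr0 mul1r. Qed.

Lemma innerDr u v w : inner u (v + w) = inner u v + inner u w.
Proof. exact: linearDr. Qed.

Lemma innerZr a u v : inner u (a *: v) = a * inner u v.
Proof. exact: linearZr_LR. Qed.

Lemma innerDl u v w : inner (u + v) w = inner u w + inner v w.
Proof. exact: linearDl. Qed.

Lemma innerZl a u v : inner (a *: u) v = a * inner u v.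
Proof. exact: linearZl_LR. Qed.

Lemma inner0r u : inner u 0 = 0.
Proof. by rewrite -(scale0r u) innerZr mul0r. Qed.

Lemma innerNr u v : inner u (- v) = - inner u v.
Proof. by rewrite -scaleN1r innerZr mulN1r. Qed.

Lemma innerBr u v w : inner u (v - w) = inner u v - inner u w.
Proof. by rewrite innerDr innerNr. Qed.

Lemma inner_sumr (J : Type) (r : seq J) (Q : pred J) (f : J -> H) u :
  inner u (\sum_(j <- r | Q j) f j) = \sum_(j <- r | Q j) inner u (f j).
Proof.
apply: (big_morph (fun v => inner u v)); last exact: inner0r.
by move=> v w; exact: innerDr.
Qed.

Lemma inner_suml (J : Type) (r : seq J) (Q : pred J) (f : J -> H) u :
  inner (\sum_(j <- r | Q j) f j) u = \sum_(j <- r | Q j) inner (f j) u.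
Proof. by rewrite innerC inner_sumr; apply: eq_bigr => j _; rewrite innerC. Qed.

Lemma norm_sqrD u v : `|u + v| ^+ 2 = `|u| ^+ 2 + 2 * inner u v + `|v| ^+ 2.
Proof.
by rewrite -!inner_normE innerDl !innerDr (innerC v u); ring.
Qed.

Lemma norm_sqrB u v : `|u - v| ^+ 2 = `|u| ^+ 2 - 2 * inner u v + `|v| ^+ 2.
Proof. by rewrite norm_sqrD normrN innerNr; ring. Qed.

Lemma CauchySchwarz_inner u v : `|inner u v| <= `|u| * `|v|.
Proof.
have [->|v0] := eqVneq v 0; first by rewrite inner0r !normr0 mulr0.
have v2 : 0 < `|v| ^+ 2 by rewrite exprn_gt0// normr_gt0.
have : 0 <= `| `|v| ^+ 2 *: u - inner u v *: v| ^+ 2 by rewrite sqr_ge0.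
rewrite norm_sqrB !normrZ innerZl innerZr !exprMn real_normK ?num_real//.
rewrite real_normK ?num_real// => h.
rewrite -(@ler_pXn2r _ 2) ?nnegrE// ?mulr_ge0//.
rewrite exprMn real_normK ?num_real//.
have {}h : 0 <= `|v| ^+ 2 * (`|u| ^+ 2 * `|v| ^+ 2 - inner u v ^+ 2).
  by move: h; congr (0 <= _); ring.
by rewrite -subr_ge0 -(pmulr_rge0 _ v2).
Qed.

Lemma inner_continuous u : continuous (fun v : H => inner u v : R).
Proof.
move=> v; apply/cvgrPdist_le => e e0.
near=> w; rewrite -innerBr (le_trans (CauchySchwarz_inner _ _))//.
have c0 : (0 : R) < `|u| + 1 by rewrite ltr_wpDl.
rewrite (@le_trans _ _ ((`|u| + 1) * `|v - w|))//.
  by rewrite ler_wpM2r// lerDl.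
rewrite -ler_pdivlMl//.
near: w; apply: cvgr_dist_le; first exact: cvg_id.
by rewrite (@pmulr_lgt0 R)// invr_gt0.
Unshelve. all: end_near. Qed.

End InnerProduct.

(** * Derivatives of the Gaussian functional *)

Section GaussianDerivatives.
Context {R : realType} {H : hilbertType R}.
Implicit Types (x h v : H) (a s : seq H) (e : seq (R * seq H)).

Definition ip a x : R := \prod_(v <- a) inner x v.

(* A list of pairs (c, a) stands for the function
   x |-> (sum of the c <x, a_1> ... <x, a_j>) exp(-|x|^2); [ddir h] computes its
   derivative in the direction [h]. *)
Definition gauss_poly e x : R :=
  (\sum_(m <- e) m.1 * ip m.2 x) * expR (- `|x| ^+ 2).

(** Leibniz rule for <x, a_1> ... <x, a_j>: differentiating the factor of v along h leaves the
    number <h, v>, so the degree drops by one. *)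
Fixpoint dprod h a : seq (R * seq H) :=
  if a is v :: a' then
    (inner h v, a') :: [seq (p.1, v :: p.2) | p <- dprod h a']
  else [::].

Definition dmono h (m : R * seq H) : seq (R * seq H) :=
  (- 2 * m.1, h :: m.2) :: [seq (m.1 * p.1, p.2) | p <- dprod h m.2].

Definition ddir h e := flatten [seq dmono h m | m <- e].

Let scaleE (c y : R) : c *: (y : R^o) = c * y. Proof. by []. Qed.

Let is_derive_ip h x a (t : R) :
  is_derive t 1 (fun t => ip a (x + t *: h))
    (\sum_(p <- dprod h a) p.1 * ip p.2 (x + t *: h)).
Proof.
elim: a => [|v a IHa] /=.
  rewrite big_nil (_ : (fun t => _) = cst 1); first exact: is_derive_cst.
  by apply/funext => y; rewrite /ip big_nil.
rewrite (_ : (fun t => _) =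
    (fun t => inner x v + t * inner h v) * (fun t => ip a (x + t *: h))); last first.
  by apply/funext => y; rewrite /ip big_cons innerDl innerZl.
apply: is_derive_eq.
rewrite big_cons big_map /= !scaleE.
rewrite addrC -innerZl -innerDl; congr (_ + _).
  by ring.
rewrite mulr_sumr; apply: eq_bigr => p _; rewrite /ip big_cons; ring.
Qed.


Let is_derive_gauss h x (t : R) :
  is_derive t 1 (fun t => expR (- `|x + t *: h| ^+ 2) : R)
    (- 2 * inner (x + t *: h) h * expR (- `|x + t *: h| ^+ 2)).
Proof.
rewrite (_ : (fun t => _) = expR \o
    (fun t => - (`|x| ^+ 2 + t * (2 * inner x h) + t * t * `|h| ^+ 2))).
  apply: is_derive_eq.
  rewrite !scaleE norm_sqrD normrZ exprMn real_normK ?num_real//.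
  rewrite innerDl !innerZl innerZr inner_normE expr2.
  rewrite -[X in X * _ = _]/(expR _) mulrC; congr (_ * expR _); ring.
apply/funext => y /=; rewrite norm_sqrD normrZ exprMn real_normK ?num_real//.
rewrite innerZr; congr expR; ring.
Qed.

Lemma is_derive_gauss_poly h x e (t : R) :
  is_derive t 1 (fun t => gauss_poly e (x + t *: h))
    (gauss_poly (ddir h e) (x + t *: h)).
Proof.
rewrite /gauss_poly.
have D : is_derive t 1 (fun t => \sum_(m <- e) m.1 * ip m.2 (x + t *: h))
    (\sum_(m <- e) m.1 * \sum_(p <- dprod h m.2) p.1 * ip p.2 (x + t *: h)).
  elim: e => [|m e IHe].
    rewrite big_nil (_ : (fun t => _) = cst 0); first exact: is_derive_cst.
    by apply/funext => y; rewrite big_nil.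
  rewrite big_cons (_ : (fun t => _) = (fun t => m.1 * ip m.2 (x + t *: h)) +
      (fun t => \sum_(m <- e) m.1 * ip m.2 (x + t *: h))); last first.
    by apply/funext => y; rewrite big_cons.
  have D1 := is_derive_ip h x m.2 t.
  by apply: is_derive_eq; congr (_ + _).
have G := is_derive_gauss h x t.
apply: is_derive_eq.
rewrite !scaleE.

have -> : \sum_(m <- ddir h e) m.1 * ip m.2 (x + t *: h) =
   - 2 * inner (x + t *: h) h * (\sum_(m <- e) m.1 * ip m.2 (x + t *: h)) +
   \sum_(m <- e) m.1 * \sum_(p <- dprod h m.2) p.1 * ip p.2 (x + t *: h).
  rewrite big_flatten big_map mulr_sumr -big_split /=; apply: eq_bigr => m _.
  rewrite big_cons big_map /=; congr (_ + _).
    by rewrite [in LHS]/ip big_cons -/(ip _ _); ring.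
  by rewrite mulr_sumr; apply: eq_bigr => p _; rewrite mulrA.
ring.
Qed.


(** Size of the coefficients: a monomial is at most its weight times a power of |x|. The weight
    contains the norms of all directions, so that bounds come out in the shape of [form_bound]. *)
Definition wnorm e : R := \sum_(m <- e) `|m.1| * \prod_(v <- m.2) `|v|.

Let wnorm_dprod h a :
  wnorm (dprod h a) <= (size a)%:R * `|h| * \prod_(v <- a) `|v|.
Proof.
elim: a => [|v a IHa] /=; first by rewrite /wnorm !big_nil !mul0r.
rewrite /wnorm !big_cons big_map /=.
have -> : \sum_(p <- dprod h a) `|p.1| * \prod_(w <- v :: p.2) `|w| =
    `|v| * wnorm (dprod h a).
  rewrite /wnorm mulr_sumr; apply: eq_bigr => p _.
  by rewrite big_cons; ring.
have a0 : 0 <= \prod_(w <- a) `|w| by apply: prodr_ge0.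
apply: (@le_trans _ _ (`|h| * `|v| * \prod_(w <- a) `|w| +
    `|v| * ((size a)%:R * `|h| * \prod_(w <- a) `|w|))).
  by rewrite lerD ?ler_wpM2l// ler_wpM2r// CauchySchwarz_inner.
by rewrite -natr1 le_eqVlt; apply/orP; left; apply/eqP; ring.
Qed.

Let size_dprod h a k : (size a <= k.+1)%N ->
  all (fun p : R * seq H => (size p.2 <= k)%N) (dprod h a).
Proof.
elim: a k => [|v a IHa] k //= ak; apply/andP; split; first exact: ak.
rewrite all_map; case: k ak => [|k] ak; first by case: a ak {IHa}.
exact: IHa.
Qed.

Definition sizes k e := all (fun m : R * seq H => (size m.2 <= k)%N) e.

Let sizes_ddir h e k : sizes k e -> sizes k.+1 (ddir h e).
Proof.
elim: e => // m e IHe /= /andP[mk /IHe ek].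
rewrite /sizes /ddir /= all_cat all_map -/(ddir h e) ltnS mk /=.
apply/andP; split; last exact: ek.
apply: sub_all (@size_dprod h m.2 k (leqW mk)) => p /= pk.
exact: leqW.
Qed.

(** The exponential contributes the factor 2, the product rule at most k, the number of factors of a
    monomial. *)
Let wnorm_ddir h e k : sizes k e ->
  wnorm (ddir h e) <= (k + 2)%:R * `|h| * wnorm e.
Proof.
elim: e => [|m e IHe] /=; first by rewrite /wnorm !big_nil mulr0.
move=> /andP[mk /IHe ek]; rewrite /wnorm /ddir /= big_cons big_cat /=.
rewrite -/(wnorm _) -/(wnorm _) -/(ddir h e) big_cons -/(wnorm e) big_cons.
rewrite mulrDr addrA lerD//.
have -> : wnorm [seq (m.1 * p.1, p.2) | p <- dprod h m.2] =
    `|m.1| * wnorm (dprod h m.2).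
  rewrite /wnorm big_map mulr_sumr; apply: eq_bigr => p _ /=.
  by rewrite normrM mulrA.
have a0 : 0 <= \prod_(w <- m.2) `|w| by apply: prodr_ge0.
rewrite (@le_trans _ _ (2 * `|m.1| * (`|h| * \prod_(w <- m.2) `|w|) +
    `|m.1| * ((size m.2)%:R * `|h| * \prod_(w <- m.2) `|w|)))//.
  rewrite lerD//; last by rewrite ler_wpM2l.
  by rewrite normrM normrN (ger0_norm (ler0n _ 2)).
rewrite (@le_trans _ _ (2 * `|m.1| * (`|h| * \prod_(w <- m.2) `|w|) +
    `|m.1| * (k%:R * `|h| * \prod_(w <- m.2) `|w|)))//.
  by rewrite lerD2l ler_wpM2l// ler_wpM2r// ler_wpM2r// ler_nat.
by rewrite natrD le_eqVlt; apply/orP; left; apply/eqP; ring.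
Qed.

(** With z = y^2, one has y <= 1 + z and 1 + z <= (k + 1) exp (z / (k + 1)); the k-th power of the
    last bound is at most (k + 1)^k exp z. *)
Let pow_gauss_le (y : R) (j k : nat) : (j <= k)%N -> 0 <= y ->
  y ^+ j * expR (- y ^+ 2) <= k.+1%:R ^+ k.
Proof.
move=> jk y0; set z := y ^+ 2.
have z0 : 0 <= z by exact: sqr_ge0.
rewrite expRN ler_pdivrMr ?expR_gt0//.
have y1 : y <= 1 + z.
  by have := sqr_ge0 (y - 1); rewrite /z; nra.
apply: (@le_trans _ _ ((1 + z) ^+ k)).
  apply: (@le_trans _ _ ((1 + z) ^+ j)); first by rewrite lerXn2r ?nnegrE// addr_ge0.
  by rewrite ler_weXn2l// lerDl.
have k0 : (0 : R) < k.+1%:R by rewrite ltr0n.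
apply: (@le_trans _ _ ((k.+1%:R * expR (z / k.+1%:R)) ^+ k)).
  rewrite lerXn2r ?nnegrE ?addr_ge0 ?mulr_ge0 ?expR_ge0//.
  rewrite (@le_trans _ _ (k.+1%:R * (1 + z / k.+1%:R)))//; last first.
    by rewrite ler_wpM2l// expR_ge1Dx.
  rewrite mulrDr mulr1 (mulrC _ (z / _)) divfK ?gt_eqF// lerD2r.
  by rewrite ler1n.
rewrite exprMn ler_wpM2l ?exprn_ge0// -expRM_natl ler_expR.
rewrite mulrCA -[leRHS]mulr1 ler_wpM2l// ler_pdivrMr// mul1r ler_nat.
exact: leqnSn.
Qed.

Let gauss_poly_le e k x : sizes k e ->
  `|gauss_poly e x| <= wnorm e * k.+1%:R ^+ k.
Proof.
move=> ek; rewrite /gauss_poly normrM (ger0_norm (expR_ge0 _)).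
rewrite (@le_trans _ _ ((\sum_(m <- e) `|m.1 * ip m.2 x|) * expR (- `|x| ^+ 2)))//.
  by rewrite ler_wpM2r ?expR_ge0// ler_norm_sum.
rewrite !mulr_suml !big_seq; apply: ler_sum => m /(allP ek) mk.
rewrite normrM -!mulrA ler_wpM2l//.
have ipx : `|ip m.2 x| <= (\prod_(v <- m.2) `|v|) * `|x| ^+ size m.2.
  elim: (m.2) => [|v a IHa] /=; first by rewrite /ip !big_nil mul1r normr1.
  rewrite /ip !big_cons normrM exprS.
  rewrite (@le_trans _ _ ((`|x| * `|v|) * `|ip a x|))//.
    by rewrite ler_wpM2r// CauchySchwarz_inner.
  rewrite (@le_trans _ _ ((`|x| * `|v|) * (\prod_(v <- a) `|v| * `|x| ^+ size a)))//.
    by rewrite ler_wpM2l// mulr_ge0.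
  by rewrite le_eqVlt; apply/orP; left; apply/eqP; ring.
rewrite (@le_trans _ _ ((\prod_(v <- m.2) `|v| * `|x| ^+ size m.2) *
   expR (- `|x| ^+ 2)))//.
  by rewrite ler_wpM2r ?expR_ge0.
rewrite -mulrA ler_wpM2l// ?prodr_ge0// pow_gauss_le//.
Qed.

(** The list [[:: (1, [::])]] is the constant polynomial 1. As [foldr] applies the head of [s] last,
    the head is the direction of the outermost derivative, as in [Cnb]. *)
Definition gauss_deriv x s : R := gauss_poly (foldr ddir [:: (1, [::])] s) x.

Let sizes_fold s : sizes (size s) (foldr ddir [:: (1, [::])] s).
Proof. by elim: s => //= v s IHs; exact: sizes_ddir. Qed.

Let wnorm_fold s : wnorm (foldr ddir [:: (1, [::])] s) <=
  (\prod_(i < size s) (i + 2)%:R) * \prod_(v <- s) `|v|.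
Proof.
elim: s => [|v s IHs] /=.
  by rewrite /wnorm big_cons !big_nil big_ord0 !mulr1 normr1 addr0.
rewrite (le_trans (wnorm_ddir _ (sizes_fold s)))// big_ord_recr big_cons /=.
apply: (@le_trans _ _ ((size s + 2)%:R * `|v| *
   ((\prod_(i < size s) (i + 2)%:R) * \prod_(v <- s) `|v|))).
  by rewrite ler_wpM2l// mulr_ge0.
by rewrite le_eqVlt; apply/orP; left; apply/eqP; ring.
Qed.

Lemma gauss_deriv_bound k :
  exists2 c : R, 0 <= c & forall x, form_bound k (gauss_deriv x) c.
Proof.
(* The product, (k + 1)!, bounds the growth of the coefficients under k derivatives; the other
   factor bounds the powers of |x| against exp (- |x|^2). *)
exists ((\prod_(i < k) (i + 2)%:R) * k.+1%:R ^+ k).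
  by rewrite mulr_ge0 ?exprn_ge0// prodr_ge0// => i _; rewrite ler0n.
move=> x s sk; rewrite (le_trans (gauss_poly_le _ (sizes_fold s)))// sk mulrAC.
by rewrite ler_wpM2r ?exprn_ge0// -sk wnorm_fold.
Qed.

Lemma is_derive_gauss_deriv h x s (t : R) :
  is_derive t 1 (fun t => gauss_deriv (x + t *: h) s)
    (gauss_deriv (x + t *: h) (h :: s)).
Proof. exact: is_derive_gauss_poly. Qed.

(** Linearity in the head direction is read off [dmono] and [dprod]. For a deeper position, the
    identity for the shorter list is differentiated along the outer direction [h]. *)
Lemma multilinear_gauss_deriv k x : multilinear k (gauss_deriv x).
Proof.
move=> s1 s2 _ c u v; elim: s1 x => [|h s1 IHs] x.
  rewrite scaleE /gauss_deriv /= /gauss_poly /= mulrA -mulrDl.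
  congr (_ * _).
  rewrite /ddir !big_flatten !big_map mulr_sumr -big_split /=.
  apply: eq_bigr => m _; rewrite !big_cons !big_map /=.
  have ipd : \sum_(p <- dprod (c *: u + v) m.2) p.1 * ip p.2 x =
      c * (\sum_(p <- dprod u m.2) p.1 * ip p.2 x) +
      \sum_(p <- dprod v m.2) p.1 * ip p.2 x.
    elim: (m.2) => [|w a IHa] /=; first by rewrite !big_nil mulr0 addr0.
    have ipw h' : \sum_(p <- [seq (p.1, w :: p.2) | p <- dprod h' a]) p.1 * ip p.2 x =
        inner x w * \sum_(p <- dprod h' a) p.1 * ip p.2 x.
      rewrite big_map mulr_sumr; apply: eq_bigr => p _ /=.
      by rewrite /ip big_cons; ring.
    rewrite !big_cons /= !ipw IHa innerDl innerZl; ring.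
  have mp h' : \sum_(p <- dprod h' m.2) m.1 * p.1 * ip p.2 x =
      m.1 * \sum_(p <- dprod h' m.2) p.1 * ip p.2 x.
    by rewrite mulr_sumr; apply: eq_bigr => p _; rewrite mulrA.
  by rewrite !mp ipd /ip !big_cons innerDr innerZr; ring.
have D w := is_derive_gauss_deriv h x (s1 ++ w :: s2) 0.
have E w : gauss_deriv x ((h :: s1) ++ w :: s2) =
    'D_1 (fun t : R => gauss_deriv (x + t *: h) (s1 ++ w :: s2)) 0.
  by have := D w => -[_ ->]; rewrite scale0r addr0.
rewrite !E.
rewrite (_ : (fun t => gauss_deriv _ (s1 ++ (_ + _) :: _)) =
    c *: (fun t : R => gauss_deriv (x + t *: h) (s1 ++ u :: s2)) +
    (fun t : R => gauss_deriv (x + t *: h) (s1 ++ v :: s2))).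
  by have [du Du] := D u; have [dv Dv] := D v; rewrite deriveD ?deriveZ//; exact: derivableZ.
by apply/funext => t; exact: IHs.
Qed.

Let gauss_deriv_MVT x h s : exists2 t : R, t \in `]0, 1[ &
  gauss_deriv (x + h) s - gauss_deriv x s = gauss_deriv (x + t *: h) (h :: s).
Proof.
have D (t : R) := is_derive_gauss_deriv h x s t.
have [|t t01] := MVT (@ltr01 R) (fun t _ => D t).
  apply: continuous_subspaceT => t.
  by apply/differentiable_continuous/derivable1_diffP; have [] := D t.
by rewrite scale0r scale1r addr0 subr0 mulr1 => ->; exists t.
Qed.

Lemma Cnb_gauss n : Cnb n (fun x : H => expR (- `|x| ^+ 2)).
Proof.
exists (fun _ x s => gauss_deriv x s); split.
- by move=> x; rewrite /gauss_deriv /= /gauss_poly big_seq1 /ip big_nil !mul1r.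
- by move=> k x _; exact: multilinear_gauss_deriv.
- move=> k x _ e e0; have [c c0 cP] := gauss_deriv_bound k.+2.
  have ec : 0 < e / (c + 1) by rewrite divr_gt0// ltr_wpDl.
  near=> h.
  have he : `|h| <= e / (c + 1).
    by rewrite -normrN -sub0r; near: h; apply: cvgr_dist_le; first exact: cvg_id.
  (* Two uses of the mean value theorem turn the remainder into a derivative of order k + 2 in the
     directions t h and h, hence of size at most c |h|^2 times the norms of [s]. *)
  move=> s sk; have [t t01 ->] := gauss_deriv_MVT x h s.
  have [r r01] := gauss_deriv_MVT x (t *: h) (h :: s).
  rewrite [X in `|X|](_ : _ = gauss_deriv (x + t *: h) (h :: s) - gauss_deriv x (h :: s))//.
  move=> ->; rewrite (le_trans (cP _ _ _)) /= ?sk// !big_cons normrZ.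
  move: t01; rewrite in_itv /= => /andP[t0 t1].
  rewrite (ger0_norm (ltW t0)) !mulrA ler_wpM2r ?prodr_ge0//.
  rewrite ler_wpM2r// mulrAC -[leRHS]mulr1.
  apply: ler_pM; [by rewrite mulr_ge0|exact: ltW| |exact: ltW].
  rewrite (@le_trans _ _ ((c + 1) * `|h|))//; first by rewrite ler_wpM2r// lerDl.
  by rewrite mulrC -ler_pdivlMr// ltr_wpDl.
- move=> x e e0; have [c c0 cP] := gauss_deriv_bound n.+1.
  have ec : 0 < e / (c + 1) by rewrite divr_gt0// ltr_wpDl.
  near=> y.
  have he : `|y - x| <= e / (c + 1).
    by rewrite distrC; near: y; apply: cvgr_dist_le; first exact: cvg_id.
  move=> s sn; have [t t01] := gauss_deriv_MVT x (y - x) s.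
  rewrite (addrC x) subrK => ->; rewrite (le_trans (cP _ _ _)) /= ?sn// big_cons.
  rewrite mulrA ler_wpM2r ?prodr_ge0//.
  rewrite (@le_trans _ _ ((c + 1) * `|y - x|))//; first by rewrite ler_wpM2r// lerDl.
  by rewrite mulrC -ler_pdivlMr// ltr_wpDl.
- by move=> k _; have [c _ cP] := gauss_deriv_bound k; exists c.
Unshelve. all: end_near. Qed.

End GaussianDerivatives.

(** * Power estimates *)

Section PowerEstimates.
Context {R : realType}.
Implicit Types a b k : R.

Lemma powR_expR_ln k a : 0 < a -> a `^ k = expR (k * ln a).
Proof. by move=> a0; rewrite /powR gt_eqF. Qed.

Lemma ln_diff_le a b : 0 < a -> 0 < b -> ln b - ln a <= (b - a) / a.
Proof.
move=> a0 b0; rewrite -ln_div ?posrE//.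
have -> : b / a = 1 + (b - a) / a.
  by rewrite mulrBl divff ?gt_eqF// addrC subrK.
by rewrite le_ln1Dx// mulrBl divff ?gt_eqF// ltrBrDr addNr divr_gt0.
Qed.

(** The convex function x^(-k) lies above its tangent at [b]. The two points may come in either
    order, so exchanging them gives the opposite estimate. *)
Lemma powR_diff_ge k a b : 0 < k -> 0 < a -> 0 < b ->
  k * b `^ (- (k + 1)) * (b - a) <= a `^ (- k) - b `^ (- k).
Proof.
move=> k0 a0 b0.
have -> : a `^ (- k) = b `^ (- k) * expR (k * (ln b - ln a)).
  by rewrite !powR_expR_ln// -expRD; congr expR; ring.
have -> : b `^ (- (k + 1)) = b `^ (- k) * b^-1.
  rewrite opprD powRD; last by rewrite (gt_eqF b0) implybT.
  by rewrite powR_inv1// ltW.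
rewrite -[X in _ <= _ - X]mulr1 -mulrBr.
have -> : k * (b `^ (- k) * b^-1) * (b - a) = b `^ (- k) * (k * ((b - a) / b)) by ring.
rewrite ler_wpM2l ?powR_ge0// lerBrDl (le_trans _ (expR_ge1Dx _))//.
rewrite lerD2l ler_wpM2l ?(ltW k0)//.
by rewrite -lerN2 opprB -mulNr opprB ln_diff_le.
Qed.

Lemma powR_diff_le k a b : 0 < k -> 0 < a -> 0 < b ->
  a `^ (- k) - b `^ (- k) <= k * a `^ (- (k + 1)) * (b - a).
Proof.
move=> k0 a0 b0; have := powR_diff_ge k0 b0 a0.
by rewrite -[a - b]opprB mulrN -[b `^ _ - _]opprB lerN2.
Qed.

(* [k] plays the role of 1 - 4 delta, and [y] that of 1 - exp (- T). *)
Lemma final_estimate (k y : R) (N : nat) : 0 < k -> 0 <= y <= 1 -> (0 < N)%N ->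
  1 + 2 `^ (- k - 4) * y /
        (1 + k + 2 `^ (- 21 / 4 - 7 / 4 * k) * k `^ (- (1 / 3))) `^ (3 / 2) *
        (pi * N%:R) `^ (- k)
  <= Num.sqrt (1 + y / (pi * k) * (pi * N.+1%:R) `^ (- k)).
Proof.
move=> k0 /andP[y0 y1] N0.
set D := 1 + k + _.
have D1 : 1 + k <= D by rewrite lerDl mulr_ge0 ?powR_ge0.
(* The denominator enters through this bound: its base is at least 1 + k >= 1, so the power 3/2 does
   not decrease it. *)
have DD : 1 + k <= D `^ (3 / 2).
  rewrite (le_trans D1)// -[leLHS]powRr1; last first.
    by rewrite (le_trans _ D1)// addr_ge0// ltW.
  rewrite ler_powR//; last by lra.
  by rewrite (le_trans _ D1)// lerDl ltW.
have p0 := pi_gt0 R.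
have N0' : (1 : R) <= N%:R by rewrite ler1n.
have pN : 1 <= pi * N%:R :> R by have := pi_ge2 R; nra.
set z := y * (pi * N%:R) `^ (- k).
have z0 : 0 <= z by rewrite mulr_ge0 ?powR_ge0.
have z1 : z <= 1.
  rewrite /z -[leRHS]mulr1 ler_pM ?powR_ge0// powRN invf_le1 ?powR_gt0 ?(lt_le_trans _ pN)//.
  by rewrite -[leLHS](powRr0 (pi * N%:R)) ler_powR// ltW.
have k2 : 0 < 2 `^ (- k) :> R by rewrite powR_gt0.
have k21 : 2 `^ (- k) <= 1 :> R.
  by rewrite powRN invf_le1 ?powR_gt0// -[leLHS](powRr0 2) ler_powR ?(ltW k0)// ler1n.
set w := 2 `^ (- k) : R in k2 k21 *.
(* The stated coefficient with the denominator replaced by 1 + k; the 16 comes from 2^(-k-4) = w /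
   16. *)
set r := w / (16 * (1 + k)).
have r0 : 0 <= r by rewrite divr_ge0 ?mulr_ge0 ?addr_ge0 ?ltW.
have r1 : r <= 1.
  rewrite ler_pdivrMr ?mulr_gt0 ?ltr_wpDl// ?ltr_pwDl// mul1r; nra.
(* N + 1 <= 2 N costs the factor w = 2^(-k). *)
have S1 : z * (w / (pi * k)) <= y / (pi * k) * (pi * N.+1%:R) `^ (- k).
  rewrite [leLHS](_ : _ = y / (pi * k) * ((pi * N%:R) `^ (- k) * w)); last by rewrite /z; ring.
  rewrite ler_wpM2l ?(divr_ge0 y0) ?mulr_ge0 ?(ltW p0) ?(ltW k0)//.
  rewrite /w -powRM ?mulr_ge0 ?(ltW p0)// !powRN lef_pV2 ?posrE ?powR_gt0 ?mulr_gt0 ?ltr0n//.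
  rewrite ge0_ler_powR ?nnegrE ?mulr_ge0 ?(ltW p0) ?(ltW k0)//.
  rewrite -mulrA ler_wpM2l ?(ltW p0)// -natrM ler_nat muln2 -addnn -addn1 leq_add2l N0 //.
apply: (@le_trans _ _ (1 + z * r)).
  rewrite lerD2l /z /r.
  have -> : 2 `^ (- k - 4) = w / 16 :> R.
    rewrite powRD ?pnatr_eq0 ?implybT// -/w powRN; congr (_ / _).
    by rewrite (powR_mulrn 4)//; lra.
  rewrite [leLHS](_ : _ = y * (pi * N%:R) `^ (- k) * (w / 16 * (D `^ (3 / 2))^-1)); last by ring.
  rewrite ler_wpM2l// ?mulr_ge0 ?powR_ge0// invfM mulrA ler_wpM2l ?divr_ge0 ?(ltW k2)//.
  by rewrite lef_pV2 ?posrE// ?(lt_le_trans _ DD) ?mulr_gt0 ?ltr_pwDl ?(ltW k0).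
rewrite -[leLHS]ger0_norm; last by rewrite addr_ge0// mulr_ge0.
rewrite -sqrtr_sqr ler_sqrt; last first.
  by rewrite addr_ge0// mulr_ge0 ?powR_ge0// divr_ge0// mulr_ge0// ltW.
have zr1 : z * r <= 1 by rewrite mulr_ile1.
have zr0 : 0 <= z * r by rewrite mulr_ge0.
(* (1 + z r)^2 <= 1 + 3 z r because z r <= 1. What remains is 3 pi k <= 16 (1 + k), which follows
   from pi <= 4. *)
rewrite (@le_trans _ _ (1 + z * (3 * r)))//; first by nra.
rewrite lerD2l (le_trans _ S1)// ler_wpM2l// /r.
rewrite ler_pdivlMr ?mulr_gt0// mulrA mulrAC ler_pdivrMr ?mulr_gt0 ?ltr_pwDl ?(ltW k0)//.
have := pihalf_lt2 R => p4.
have : pi <= 4 :> R by lra.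
move=> p4'; have : 0 <= w * (16 * (1 + k) - 3 * (pi * k)) by rewrite mulr_ge0 ?ltW//; nra.
lra.
Qed.

End PowerEstimates.

(** * Normal distributions *)

Lemma expRN_bounds {R : realType} (z : R) : 0 <= z ->
  z / (1 + z) <= 1 - expR (- z) <= z.
Proof.
move=> z0; have z1 : 0 < 1 + z by rewrite ltr_pwDl.
apply/andP; split; last first.
  by rewrite lerBlDr -lerBlDl (le_trans _ (expR_ge1Dx _)).
rewrite lerBrDl addrC -lerBrDl expRN.
have -> : 1 - z / (1 + z) = (1 + z)^-1 by field; rewrite gt_eqF.
by rewrite lef_pV2 ?posrE ?expR_gt0 ?expR_ge1Dx.
Qed.

(** Dominated convergence; it carries integration by parts from bounded intervals to the whole
    line. *)
Lemma cvg_Rintegral_itv {R : realType} (h : R -> R) :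
  (@lebesgue_measure R).-integrable setT (EFin \o h) ->
  \int[lebesgue_measure]_(x in `[- n.+1%:R, n.+1%:R]) h x @[n --> \oo] -->
  \int[lebesgue_measure]_x h x.
Proof.
move=> hi; rewrite /Rintegral; apply: fine_cvg; rewrite fineK; last first.
  exact: integrable_fin_num.
under eq_fun do rewrite integral_mkcond.
have mh := measurable_int _ hi.
apply: (@dominated_cvg _ _ _ (@lebesgue_measure R) setT measurableT
  (fun n => (EFin \o h) \_ `[- n.+1%:R, n.+1%:R]) (EFin \o h)
  (fun x : R => (`|h x|)%:E)) => //.
- move=> n; apply: (iffLR (measurable_restrictT (EFin \o h) _)) => //.
  exact: measurable_funTS.
- move=> x _; apply: cvg_near_cst.
  exists `|Num.ceil `|x| |%N => // n /= hn; rewrite patchE mem_set//= in_itv/=.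
  rewrite -ler_norml (le_trans (Num.Theory.ceil_ge _))//.
  rewrite (le_trans (y := `|Num.ceil `|x| |%N%:R))// ?ler_nat ?(leq_trans hn)//.
  by rewrite natr_absz ler_int ler_norm.
- exact: integrable_norm.
- move=> n x _; rewrite patchE; case: ifPn => _ //.
  by rewrite abse0 lee_fin.
Qed.

Section NormalLaw.
Context {R : realType}.
Variable s : R.
Hypothesis s_gt0 : 0 < s.
Local Notation leb := (@lebesgue_measure R).
Local Notation gauss := (normal_prob 0 s).
Local Notation pdf := (normal_pdf 0 s).

Let s0 : s != 0. Proof. by rewrite gt_eqF. Qed.

Let pdfE x : pdf x = normal_peak s * expR (- x ^+ 2 / (s ^+ 2 *+ 2)).
Proof. by rewrite normal_pdfE// /normal_fun subr0. Qed.

(** The Radon-Nikodym derivative of the normal law agrees almost everywhere with [normal_pdf], since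
    both have the same integral over every measurable set. *)
Lemma ge0_integral_normal (f : R -> \bar R) :
  measurable_fun setT f -> (forall x, (0 <= f x)%E) ->
  (\int[gauss]_x f x = \int[leb]_x (f x * (pdf x)%:E))%E.
Proof.
move=> mf f0; have dom : gauss `<< leb by exact: normal_prob_dominates.
rewrite -(Radon_Nikodym_SigmaFinite.change_of_variables dom f0)//.
have iRN := Radon_Nikodym_SigmaFinite.f_integrable dom.
apply: ae_eq_integral => //.
- by apply: emeasurable_funM => //; exact: measurable_int iRN.
- apply: emeasurable_funM => //; apply/measurableT_comp => //.
  exact: measurable_normal_pdf.
- apply: ae_eqe_mul2l; apply: integral_ae_eq => //.
    by apply/measurableT_comp => //; exact: measurable_normal_pdf.
  by move=> A _ mA; rewrite -Radon_Nikodym_SigmaFinite.f_integral.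
Qed.

Lemma integrable_normalP (f : R -> R) : measurable_fun setT f ->
  gauss.-integrable setT (EFin \o f) <->
  leb.-integrable setT (fun x => (f x * pdf x)%:E).
Proof.
move=> mf; have mp := measurable_normal_pdf 0 s.
have E : (\int[gauss]_x `|(f x)%:E| = \int[leb]_x `|(f x * pdf x)%:E|)%E.
  rewrite ge0_integral_normal//; last by do 2 apply: measurableT_comp => //.
  apply: eq_integral => x _; rewrite -EFinM /= normrM; congr (_ * _)%:E.
  by rewrite ger0_norm// normal_pdf_ge0.
split=> /integrableP[_ h]; apply/integrableP; split.
- by apply/measurable_EFinP/measurable_funM.
- by rewrite -E.
- exact/measurable_EFinP.
- by rewrite E.
Qed.

Let Rintegral_normal_ge0 (f : R -> R) : measurable_fun setT f ->
  (forall x, 0 <= f x) -> \int[gauss]_x f x = \int[leb]_x (f x * pdf x).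
Proof.
move=> mf f0; rewrite /Rintegral; congr fine.
rewrite ge0_integral_normal//; exact/measurable_EFinP.
Qed.

(** Writing f = (f + |f|) - |f| reduces to nonnegative functions. *)
Lemma Rintegral_normal (f : R -> R) : gauss.-integrable setT (EFin \o f) ->
  \int[gauss]_x f x = \int[leb]_x (f x * pdf x).
Proof.
move=> fi.
have mf : measurable_fun setT f by apply/measurable_EFinP; exact: measurable_int fi.
have fi' : leb.-integrable setT (EFin \o (fun x => f x * pdf x)).
  exact/integrable_normalP.
have ni : gauss.-integrable setT (EFin \o (fun x => `|f x|)) by exact: integrable_norm.
have ni' : leb.-integrable setT (EFin \o (fun x => `|f x| * pdf x)).
  by apply/integrable_normalP => //; exact: measurableT_comp.
have -> : \int[gauss]_x f x = \int[gauss]_x (f x + `|f x|) - \int[gauss]_x `|f x|.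
  by rewrite RintegralD// addrK.
rewrite !Rintegral_normal_ge0//.
- under [X in X - _]eq_Rintegral do rewrite mulrDl.
  by rewrite RintegralD// addrK.
- exact: measurableT_comp.
- by apply: measurable_funD => //; exact: measurableT_comp.
- by move=> x; rewrite addrC -lerBlDr sub0r -normrN ler_norm.
Qed.

Lemma integral_normal_expR_sqr (q : R) : 0 <= q ->
  (\int[gauss]_x (expR (- q * x ^+ 2))%:E = ((Num.sqrt (1 + 2 * q * s ^+ 2))^-1)%:E)%E.
Proof.
move=> q0; set w := 1 + 2 * q * s ^+ 2.
have w0 : 0 < w by rewrite ltr_pwDl// mulr_ge0 ?sqr_ge0// mulr_ge0.
have sw0 : 0 < Num.sqrt w by rewrite sqrtr_gt0.
rewrite ge0_integral_normal//; last first.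
  apply/measurable_EFinP; apply: measurableT_comp => //.
  by apply: measurable_funM => //; exact: measurable_funX.
(* The exponents combine: exp (- q x^2) times the density of variance s^2 is 1 / sqrt w times the
   density of variance t^2. *)
set t := s / Num.sqrt w.
have t0 : 0 < t by rewrite divr_gt0.
have Ht x : expR (- q * x ^+ 2) * pdf x = (Num.sqrt w)^-1 * normal_pdf 0 t x.
  rewrite pdfE normal_pdfE ?gt_eqF// /normal_fun subr0 mulrCA -expRD mulrA.
  have -> : normal_peak s = (Num.sqrt w)^-1 * normal_peak t.
    rewrite /normal_peak /t exprMn exprVn sqr_sqrtr ?(ltW w0)// -invfM -sqrtrM ?(ltW w0)//.
    by congr (Num.sqrt _)^-1; field; rewrite gt_eqF.
  congr (_ * expR _); rewrite /t exprMn exprVn sqr_sqrtr ?(ltW w0)// /w.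
  by field; rewrite s0 -/w gt_eqF.
under eq_integral do rewrite -EFinM Ht EFinM.
rewrite ge0_integralZl//.
- by rewrite integral_normal_pdf mule1.
- by apply/measurable_EFinP; exact: measurable_normal_pdf.
by move=> x _; rewrite lee_fin normal_pdf_ge0.
Qed.

(* With y = x^2 and a = 1 / 2^n, (1 - exp (- a y)) / a increases to y as a
   decreases to 0, and its mean is given by the previous lemma. *)
Lemma integral_normal_sqr : (\int[gauss]_x (x ^+ 2)%:E = (s ^+ 2)%:E)%E.
Proof.
pose a n : R := (2 ^+ n)^-1.
have a0 n : 0 < a n by rewrite invr_gt0 exprn_gt0.
pose g n (x : R) : R := (1 - expR (- a n * x ^+ 2)) / a n.
have g0 n x : 0 <= g n x.
  rewrite divr_ge0 ?(ltW (a0 n))// subr_ge0 -[leRHS]expR0 ler_expR mulNr oppr_le0.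
  by rewrite mulr_ge0 ?sqr_ge0 ?(ltW (a0 n)).
have mg n : measurable_fun setT (g n).
  apply: measurable_funM => //; apply: measurable_funB => //.
  by apply: measurableT_comp => //; apply: measurable_funM => //; exact: measurable_funX.
have acvg : a n @[n --> \oo] --> (0 : R).
  rewrite /a (_ : (fun n => _) = (fun n => (2^-1 : R) ^+ n)); last first.
    by apply/funext => n; rewrite exprVn.
  by apply: cvg_expr; rewrite ger0_norm// invf_lt1// ltr1n.
have gcvg x : (g n x)%:E @[n --> \oo] --> (x ^+ 2)%:E.
  apply: cvg_EFin; first exact: nearW.
  apply: (@squeeze_cvgr _ _ _ _ (fun n => x ^+ 2 / (1 + a n * x ^+ 2)) (fun=> x ^+ 2)).
  - apply: nearW => n /=.
    have z0 : 0 <= a n * x ^+ 2 by rewrite mulr_ge0 ?sqr_ge0 ?(ltW (a0 n)).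
    have /andP[lb ub] := expRN_bounds z0.
    apply/andP; split; last by rewrite /g mulNr ler_pdivrMr// [x ^+ 2 * a n]mulrC.
    by rewrite /g mulNr ler_pdivlMr// mulrC mulrA.
  - rewrite -[X in _ --> X]divr1; apply: cvgM; first exact: cvg_cst.
    apply: cvgV => //; rewrite -[X in _ --> X]addr0; apply: cvgD; first exact: cvg_cst.
    by rewrite -(mul0r (x ^+ 2)); apply: cvgM => //; exact: cvg_cst.
  - exact: cvg_cst.
pose S n : R := Num.sqrt (1 + 2 * a n * s ^+ 2).
have s2 : 0 < s ^+ 2 by rewrite exprn_gt0.
have S1 n : 1 < S n.
  rewrite /S -[ltLHS]sqrtr1 ltr_sqrt; first by rewrite ltrDl !mulr_gt0.
  by rewrite ltr_pwDl// mulr_ge0 ?(ltW s2)// mulr_ge0// ltW.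
have S2 n : S n ^+ 2 = 1 + 2 * a n * s ^+ 2.
  by rewrite sqr_sqrtr// addr_ge0// mulr_ge0 ?(ltW s2)// mulr_ge0// ltW.
(* The mean is (1 - 1 / S n) / a n with a n = (S n ^ 2 - 1) / (2 s^2). Cancelling S n - 1 removes
   the indeterminate form at S n = 1. *)
have gint n : (\int[gauss]_x (g n x)%:E = (2 * s ^+ 2 / (S n * (1 + S n)))%:E)%E.
  have : (\int[gauss]_x (g n x)%:E + ((a n)^-1 * (S n)^-1)%:E = ((a n)^-1)%:E)%E.
    rewrite EFinM -(integral_normal_expR_sqr (ltW (a0 n))) -ge0_integralZl_EFin//.
    - rewrite -ge0_integralD//.
      + rewrite (eq_integral (cst ((a n)^-1)%:E)).
          by rewrite integral_cst// [X in (_ * X)%E]probability_setT mule1.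
        by move=> x _; rewrite /= -EFinM -EFinD; congr EFin; rewrite /g; ring.
      + by move=> x _; rewrite lee_fin.
      + by apply/measurable_EFinP; exact: mg.
      + by move=> x _; rewrite -EFinM lee_fin mulr_ge0 ?expR_ge0 ?invr_ge0 ?(ltW (a0 n)).
      + apply/measurable_EFinP; apply: measurable_funM => //.
        by apply: measurableT_comp => //; apply: measurable_funM => //; exact: measurable_funX.
    - apply/measurable_EFinP.
      by apply: measurableT_comp => //; apply: measurable_funM => //; exact: measurable_funX.
    - by rewrite invr_ge0 (ltW (a0 n)).
  move/(congr1 (fun y => (y - ((a n)^-1 * (S n)^-1)%:E)%E)); rewrite addeK// => ->.
  rewrite -EFinB; congr EFin.
  have -> : a n = (S n ^+ 2 - 1) / (2 * s ^+ 2).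
    by rewrite S2; field; rewrite gt_eqF.
  have := S1 n; move: (S n) => t t1.
  field; rewrite s0 !gt_eqF//=; nra.
(* As a n = 2 a (n + 1), with e = exp (- a (n + 1) x^2) this is 1 - e^2 <= 2 (1 - e). *)
have mono : forall x, {homo (fun n => (g n x)%:E) : n m / (n <= m)%N >-> (n <= m)%E}.
  move=> x; apply/nondecreasing_seqP => n; rewrite lee_fin /g.
  have -> : a n = 2 * a n.+1 by rewrite /a exprS; field; rewrite expf_neq0.
  have := a0 n.+1; move: (a n.+1) => c c0.
  have -> : - (2 * c) * x ^+ 2 = - c * x ^+ 2 + - c * x ^+ 2 by ring.
  rewrite expRD; move: (expR _) => e.
  rewrite ler_pdivrMr ?mulr_gt0//.
  have -> : (1 - e) / c * (2 * c) = 2 * (1 - e) by field; rewrite gt_eqF.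
  by have := sqr_ge0 (1 - e); nra.
have /cvg_lim <- // : (\int[gauss]_x (g n x)%:E)%E @[n --> \oo] --> (s ^+ 2)%:E.
  rewrite (_ : (fun n => _) = (fun n => (2 * s ^+ 2 / (S n * (1 + S n)))%:E)); last exact/funext.
  apply: cvg_EFin; first exact: nearW.
  rewrite [X in _ --> X](_ : _ = 2 * s ^+ 2 / (1 * (1 + 1))); last by field.
  have Sc : S n @[n --> \oo] --> (1 : R).
    rewrite -[X in _ --> X]sqrtr1; apply: continuous_cvg; first exact: sqrt_continuous.
    rewrite -[X in _ --> X]addr0; apply: cvgD; first exact: cvg_cst.
    rewrite -[X in _ --> X](mul0r (s ^+ 2)); apply: cvgM; last exact: cvg_cst.
    by rewrite -[X in _ --> X](mulr0 2); apply: cvgM => //; exact: cvg_cst.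
  apply: cvgM; first exact: cvg_cst.
  apply: cvgV => //; apply: cvgM => //; apply: cvgD => //; exact: cvg_cst.
rewrite -monotone_convergence//.
- by apply: eq_integral => x _; apply/esym/cvg_lim.
- by move=> n; apply/measurable_EFinP; exact: mg.
- by move=> n x _; rewrite lee_fin.
Qed.

Lemma integrable_normal_sqr : gauss.-integrable setT (EFin \o (fun x => x ^+ 2)).
Proof.
have mX : measurable_fun setT (fun x : R => x ^+ 2) by exact: measurable_funX.
apply/integrableP; split; first exact/measurable_EFinP.
under eq_integral do rewrite /= ger0_norm ?sqr_ge0//.
by rewrite integral_normal_sqr ltry.
Qed.

Lemma integrable_normal_id : gauss.-integrable setT (EFin \o (fun x => x)).
Proof.
have i1 : gauss.-integrable setT (EFin \o (fun x => 1 + x ^+ 2)).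
  have c1 : gauss.-integrable setT (EFin \o cst 1) by exact: finite_measure_integrable_cst.
  exact: (integrableD measurableT c1 integrable_normal_sqr).
apply: le_integrable i1 => //.
  by apply/measurable_EFinP.
move=> x _; rewrite lee_fin [leRHS]ger0_norm ?addr_ge0 ?sqr_ge0//.
by have := sqr_ge0 (`|x| - 1); rewrite -[X in _ <= _ + X]real_normK ?num_real//; nra.
Qed.

Lemma bounded_integrable_normal (f : R -> R) (c : R) : measurable_fun setT f ->
  (forall x, `|f x| <= c) -> gauss.-integrable setT (EFin \o f).
Proof.
move=> mf fc; apply: measurable_bounded_integrable => //.
  by rewrite [X in (X < _)%E]probability_setT ltry.
by exists c; split; rewrite ?num_real// => e ce x _; exact: le_trans (fc x) (ltW ce).
Qed.


End NormalLaw.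

(** * Characteristic function of the centred normal law *)

Section NormalCharacteristic.
Context {R : realType}.
Variable s : R.
Hypothesis s_gt0 : 0 < s.
Local Notation leb := (@lebesgue_measure R).
Local Notation gauss := (normal_prob 0 s).
Local Notation pdf := (normal_pdf 0 s).

Let s0 : s != 0. Proof. by rewrite gt_eqF. Qed.

Let pdfE x : pdf x = normal_peak s * expR (- x ^+ 2 / (s ^+ 2 *+ 2)).
Proof. by rewrite normal_pdfE// /normal_fun subr0. Qed.

Let integrable_pdf_bounded (f : R -> R) (c : R) : measurable_fun setT f ->
  (forall x, `|f x| <= c) -> leb.-integrable setT (EFin \o (fun x => f x * pdf x)).
Proof.
move=> mf fc; apply: (iffLR (integrable_normalP s mf)).
exact: (bounded_integrable_normal _ mf fc).
Qed.

Let is_derive_pdf (x : R) : is_derive x 1 pdf (- x / s ^+ 2 * pdf x).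
Proof.
have -> : pdf = (fun y => normal_peak s * expR (- y ^+ 2 / (s ^+ 2 *+ 2))).
  exact/funext.
apply: is_derive_eq; rewrite /GRing.scale /=.
by field.
Qed.

Let measurable_cosM (t : R) : measurable_fun setT (fun x : R => cos (t * x)).
Proof.
apply: measurableT_comp; last exact: measurable_funM.
apply: continuous_measurable_fun; exact: continuous_cos.
Qed.

Let measurable_sinM (t : R) : measurable_fun setT (fun x : R => sin (t * x)).
Proof.
apply: measurableT_comp; last exact: measurable_funM.
apply: continuous_measurable_fun; exact: continuous_sin.
Qed.

Let abs_cos_le1 (x : R) : `|cos x| <= 1.
Proof. by rewrite ler_norml cos_geN1 cos_le1. Qed.

Let abs_sin_le1 (x : R) : `|sin x| <= 1.
Proof. by rewrite ler_norml sin_geN1 sin_le1. Qed.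

Let integrable_sin_pdf (t : R) :
  leb.-integrable setT (EFin \o (fun x => x * sin (t * x) * pdf x)).
Proof.
have mf : measurable_fun setT (fun x : R => x * sin (t * x)) by exact: measurable_funM.
apply: (iffLR (integrable_normalP s mf)); apply: le_integrable (integrable_normal_id s_gt0) => //.
  exact/measurable_EFinP.
by move=> x _; rewrite lee_fin /= normrM ler_piMr.
Qed.

Let pdf_cvg0 : pdf n.+1%:R @[n --> \oo] --> (0 : R).
Proof.
pose c : R := normal_peak s * (s ^+ 2 *+ 2).
have s2 : 0 < s ^+ 2 *+ 2 by rewrite mulrn_wgt0// exprn_gt0.
apply: (@squeeze_cvgr _ _ _ _ (fun=> 0) (fun n => c * harmonic n)).
- apply: nearW => n; rewrite normal_pdf_ge0/= pdfE /c -mulrA ler_wpM2l ?normal_peak_ge0//.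
  set z := n.+1%:R ^+ 2 / (s ^+ 2 *+ 2).
  have z0 : 0 < z by rewrite divr_gt0// exprn_gt0.
  rewrite mulNr -/z expRN (@le_trans _ _ z^-1)//.
    rewrite lef_pV2 ?posrE ?expR_gt0// (le_trans _ (expR_ge1Dx _))//.
    by rewrite lerDr.
  rewrite /z invf_div ler_wpM2l ?(ltW s2)// /harmonic lef_pV2 ?posrE ?exprn_gt0//.
  by rewrite -[leLHS]expr1 ler_weXn2l// ler1n.
- exact: cvg_cst.
- by rewrite -(mulr0 c); apply: cvgM; [exact: cvg_cst|exact: cvg_harmonic].
Qed.

(** Stein's identity E [X f (X)] = s^2 E [f' (X)] for f (x) = sin (t x): integration by parts, the
    density having derivative - x / s^2 times itself, with boundary terms that vanish in the
    limit. *)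
Let stein_sin (t : R) :
  \int[leb]_x (x * sin (t * x) * pdf x) =
  s ^+ 2 * t * \int[leb]_x (cos (t * x) * pdf x).
Proof.
have pc : continuous pdf by exact: continuous_normal_pdf.
have dsin (x : R) : is_derive x 1 (fun x => sin (t * x)) (t * cos (t * x)).
  by apply: is_derive_eq; rewrite /GRing.scale /=; ring.
have ccos : continuous (fun x : R => t * cos (t * x)).
  move=> x; apply: cvgM; first exact: cvg_cst.
  apply: continuous_cvg; first exact: continuous_cos.
  by apply: cvgM; [exact: cvg_cst|exact: cvg_id].
have csin : continuous (fun x : R => sin (t * x)).
  move=> x; apply: (@continuous_comp R R R (fun x => t * x) sin).
    by apply: cvgM; [exact: cvg_cst|exact: cvg_id].
  exact: continuous_sin.
have icos r : leb.-integrable setT (EFin \o (fun x => cos (r * x) * pdf x)).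
  exact: (@integrable_pdf_bounded _ 1).
have parts n : s ^- 2 * \int[leb]_(x in `[- n.+1%:R, n.+1%:R]) (x * sin (t * x) * pdf x) =
   t * (\int[leb]_(x in `[- n.+1%:R, n.+1%:R]) (cos (t * x) * pdf x))
   - (sin (t * n.+1%:R) * pdf n.+1%:R - sin (t * - n.+1%:R) * pdf (- n.+1%:R)).
  have Nn : (- n.+1%:R : R) < n.+1%:R by rewrite gtrN.
  have LR (h : R -> R) : continuous h -> (forall x, derivable h x 1) ->
      derivable_oo_LRcontinuous h (- n.+1%:R) n.+1%:R.
    move=> ch dh; split; first by move=> x _; exact: dh.
      exact: cvg_at_right_filter (ch _).
    exact: cvg_at_left_filter (ch _).
  have := @Rintegration_by_parts R (fun x => sin (t * x)) pdf
     (fun x => t * cos (t * x)) (fun x => - x / s ^+ 2 * pdf x) _ _ Nn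
     (continuous_subspaceT ccos) (LR _ csin _) _ _ (LR _ pc _) _.
  have -> : \int[leb]_(x in `[- n.+1%:R, n.+1%:R]) (sin (t * x) * (- x / s ^+ 2 * pdf x)) =
      - s ^- 2 * \int[leb]_(x in `[- n.+1%:R, n.+1%:R]) (x * sin (t * x) * pdf x).
    rewrite -RintegralZl//; last exact: (integrableS measurableT _ _ (integrable_sin_pdf t)).
    by apply: eq_Rintegral => x _; ring.
  have -> : \int[leb]_(x in `[- n.+1%:R, n.+1%:R]) (t * cos (t * x) * pdf x) =
      t * \int[leb]_(x in `[- n.+1%:R, n.+1%:R]) (cos (t * x) * pdf x).
    rewrite -RintegralZl//; last exact: (integrableS measurableT _ _ (icos t)).
    by apply: eq_Rintegral => x _; ring.
  move=> P; rewrite -[LHS]opprK -mulNr P.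
  - by rewrite opprB.
  - by move=> x; have [] := dsin x.
  - by move=> x _; rewrite derive1E; have [_ ->] := dsin x.
  - apply: continuous_subspaceT => x; apply: cvgM; last exact: pc.
    by apply: cvgM; [apply: cvgN; exact: cvg_id|exact: cvg_cst].
  - by move=> x; have [] := is_derive_pdf x.
  - by move=> x _; rewrite derive1E; have [_ ->] := is_derive_pdf x.
have pdfN n : pdf (- n.+1%:R) = pdf n.+1%:R by rewrite !pdfE sqrrN.
have bd : sin (t * n.+1%:R) * pdf n.+1%:R - sin (t * - n.+1%:R) * pdf (- n.+1%:R)
    @[n --> \oo] --> (0 : R).
  apply/norm_cvg0P.
  apply: (@squeeze_cvgr _ _ _ _ (fun=> 0) (fun n => 2 * pdf n.+1%:R)).
  - apply: nearW => n; rewrite normr_ge0/= pdfN.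
    have -> : sin (t * - n.+1%:R) = - sin (t * n.+1%:R) by rewrite mulrN sinN.
    rewrite -mulrBl opprK normrM (ger0_norm (normal_pdf_ge0 _ _ _)).
    rewrite ler_wpM2r ?normal_pdf_ge0// (le_trans (ler_normD _ _))//.
    by rewrite -[2]/(1 + 1) lerD.
  - exact: cvg_cst.
  - by rewrite -[X in _ --> X](mulr0 2); apply: cvgM; [exact: cvg_cst|exact: pdf_cvg0].
have lim1 := cvg_Rintegral_itv (integrable_sin_pdf t).
have lim2 := cvg_Rintegral_itv (icos t).
have : s ^- 2 * \int[leb]_x (x * sin (t * x) * pdf x) = t * \int[leb]_x (cos (t * x) * pdf x).
  apply: (@cvg_unique _ _ (s ^- 2 * \int[leb]_(x in `[- n.+1%:R, n.+1%:R]) (x * sin (t * x) * pdf x) @[n --> \oo])) => //.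
    by apply: cvgM => //; exact: cvg_cst.
  rewrite /=; under eq_fun do rewrite parts.
  have L : t * \int[leb]_(x in `[- n.+1%:R, n.+1%:R]) (cos (t * x) * pdf x) -
     (sin (t * n.+1%:R) * pdf n.+1%:R - sin (t * - n.+1%:R) * pdf (- n.+1%:R))
     @[n --> \oo] --> t * \int[leb]_x (cos (t * x) * pdf x).
    rewrite -[X in _ --> X]subr0; apply: cvgB; last exact: bd.
    by apply: cvgM; [exact: cvg_cst|exact: lim2].
  exact: L.
move=> h; rewrite -mulrA -h mulrA divff ?mul1r//.
by rewrite expf_neq0.
Qed.

(** Differentiation under the integral, dominated by |x|, and Stein's identity give phi' (r) = - s^2
    r phi (r). Hence phi (r) exp (s^2 r^2 / 2) is constant, equal to phi (0) = 1. *)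
Lemma integral_normal_cos (t : R) :
  \int[gauss]_x cos (t * x) = expR (- (s ^+ 2 * t ^+ 2 / 2)).
Proof.
pose phi (t : R) := \int[gauss]_x cos (t * x).
have icos r : gauss.-integrable setT (EFin \o (fun x : R => cos (r * x))).
  exact: (@bounded_integrable_normal R s _ 1).
have dphi (r : R) : is_derive r 1 phi (- (s ^+ 2 * r) * phi r).
  have I0 : (`]r - 1, r + 1[%classic : set R) r by rewrite /= in_itv/=; lra.
  have dcos (q x : R) : is_derive q 1 (fun q => cos (q * x)) (- (x * sin (q * x))).
    by apply: is_derive_eq; rewrite /GRing.scale /=; ring.
  have p1 q x : partial1of2 (fun q x : R => cos (q * x)) q x = - (x * sin (q * x)).
    by rewrite partial1of2E; have [_ ->] := dcos q x.
  have G x : forall q : R, `|partial1of2 (fun q x : R => cos (q * x)) q x| <= `|x|.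
    by move=> q; rewrite p1 normrN normrM ler_piMr.
  have Gi : gauss.-integrable setT (EFin \o (fun x : R => `|x|)).
    exact: (integrable_norm (integrable_normal_id s_gt0)).
  split.
    by apply: (derivable_under_integral measurableT I0 _ _ _ Gi).
  rewrite -derive1E.
  rewrite (differentiation_under_integral measurableT I0 _ _ _ Gi)//.
  under eq_Rintegral do rewrite p1.
  rewrite Rintegral_normal//.
    have eN (x : R) : - (x * sin (r * x)) * pdf x = (- 1) * (x * sin (r * x) * pdf x) by ring.
    under eq_Rintegral do rewrite eN.
    rewrite (RintegralZl (mu := leb) (-1) measurableT (integrable_sin_pdf r)).
    by rewrite stein_sin /phi Rintegral_normal//; ring.
  rewrite (_ : EFin \o _ = (fun x => - (x * sin (r * x))%:E)%E)//.
  apply: integrableN; apply: (iffRL (integrable_normalP s _)); last exact: integrable_sin_pdf.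
  exact: measurable_funM.
have cstF : forall r : R, is_derive r 1 (fun r => phi r * expR (s ^+ 2 * r ^+ 2 / 2) : R) 0.
  move=> r; have D := dphi r; apply: is_derive_eq.
  by rewrite /GRing.scale /=; field.
have := is_derive_0_is_cst t 0 cstF.
have phi0 : phi 0 = 1.
  rewrite /phi; under eq_Rintegral do rewrite mul0r cos0.
  by rewrite Rintegral_cst// [X in fine X]probability_setT mul1r.
rewrite phi0 mul1r expr0n/= mulr0 mul0r expR0 => h.
have e0 : expR (s ^+ 2 * t ^+ 2 / 2) != 0 by rewrite gt_eqF ?expR_gt0.
by apply: (mulIf e0); rewrite expRN mulVf.
Qed.

End NormalCharacteristic.

(** * Independence and expectations *)

Section Independence.
Context {d d1 d2} {T : measurableType d} {T1 : measurableType d1}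
  {T2 : measurableType d2} {R : realType} (P : probability T R).

(** With arbitrary target spaces, [X] may be the identity onto the same set with a smaller
    sigma-algebra; independence from a whole sigma-algebra then takes this form. *)
Definition independent (X : T -> T1) (Y : T -> T2) :=
  forall A B, measurable A -> measurable B ->
  P (X @^-1` A `&` Y @^-1` B) = (P (X @^-1` A) * P (Y @^-1` B))%E.

Variables (X : T -> T1) (Y : T -> T2).
Hypotheses (mX : measurable_fun setT X) (mY : measurable_fun setT Y).
Hypothesis XY : independent X Y.

Let X' : {mfun T >-> T1} := mfun_Sub (mem_set mX).
Let Y' : {mfun T >-> T2} := mfun_Sub (mem_set mY).

Let mXY : measurable_fun setT (fun w => (X w, Y w)).
Proof. exact/measurable_fun_pair. Qed.

Let XY' : {mfun T >-> (T1 * T2)%type} := mfun_Sub (mem_set mXY).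

Let dist_prod (Z : set (T1 * T2)) : measurable Z ->
  (distribution P X' \x distribution P Y')%E Z = distribution P XY' Z.
Proof.
move=> mZ; apply: (product_measure_unique (m' := distribution P XY')) => //.
Qed.

Let integral_indep_prod (h : T1 * T2 -> \bar R) :
  measurable_fun setT h -> (forall z, (0 <= h z)%E) ->
  (\int[P]_w h (X w, Y w) = \int[distribution P X' \x distribution P Y']_z h z)%E.
Proof.
move=> mh h0; rewrite (eq_measure_integral (distribution P XY')); last first.
  by move=> A mA _; exact: dist_prod.
by rewrite ge0_integral_distribution.
Qed.

Variables (f : T1 -> R) (g : T2 -> R).
Hypotheses (mf : measurable_fun setT f) (mg : measurable_fun setT g).

Let mfg : measurable_fun setT (fun z : T1 * T2 => f z.1 * g z.2).
Proof.
apply: measurable_funM; first exact: measurableT_comp.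
exact: measurableT_comp.
Qed.

Let ge0_integralM_indep (f' : T1 -> R) (g' : T2 -> R) :
  measurable_fun setT f' -> measurable_fun setT g' ->
  (forall x, 0 <= f' x) -> (forall y, 0 <= g' y) ->
  (\int[P]_w (f' (X w) * g' (Y w))%:E =
   (\int[P]_w (f' (X w))%:E) * \int[P]_w (g' (Y w))%:E)%E.
Proof.
move=> mf' mg' f0 g0.
rewrite (integral_indep_prod (h := fun z => (f' z.1 * g' z.2)%:E)); last 2 first.
- apply/measurable_EFinP; apply: measurable_funM; exact: measurableT_comp.
- by move=> z; rewrite lee_fin mulr_ge0.
rewrite fubini_tonelli1; last 2 first.
- apply/measurable_EFinP; apply: measurable_funM; exact: measurableT_comp.
- by move=> z; rewrite lee_fin mulr_ge0.
rewrite /fubini_F /=.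
under eq_integral.
  move=> x _; under eq_integral do rewrite EFinM.
  rewrite ge0_integralZl ?lee_fin//; last 2 first.
  - exact/measurable_EFinP.
  - by move=> y _; rewrite lee_fin.
  over.
rewrite ge0_integralZr//; last 3 first.
- exact/measurable_EFinP.
- by move=> y _; rewrite lee_fin.
- by apply: integral_ge0 => y _; rewrite lee_fin.
by rewrite !ge0_integral_distribution//; exact/measurable_EFinP.
Qed.

Hypotheses (fi : P.-integrable setT (EFin \o (f \o X)))
           (gi : P.-integrable setT (EFin \o (g \o Y))).

Lemma integrableM_indep : P.-integrable setT (EFin \o (fun w => f (X w) * g (Y w))).
Proof.
apply/integrableP; split.
  apply/measurable_EFinP; apply: measurable_funM; exact: measurableT_comp.
under eq_integral do rewrite /= normrM.
rewrite (ge0_integralM_indep (f' := fun x => `|f x|) (g' := fun y => `|g y|))//.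
- move: fi gi => /integrableP[_ f1] /integrableP[_ g1].
  rewrite lte_mul_pinfty ?ge0_fin_numE//; first by apply: integral_ge0 => x _; rewrite lee_fin.
  by apply: integral_ge0 => x _; rewrite lee_fin.
- exact: measurableT_comp.
- exact: measurableT_comp.
Qed.

(** The joint law of X and Y is the product of their laws, so Fubini applies; integrability has been
    obtained from the nonnegative case. *)
Lemma RintegralM_indep : \int[P]_w (f (X w) * g (Y w)) =
  (\int[P]_w f (X w)) * (\int[P]_w g (Y w)).
Proof.
rewrite /Rintegral -fineM ?integrable_fin_num//; congr fine.
pose h (z : T1 * T2) := (f z.1 * g z.2)%:E.
have mh : measurable_fun setT h by exact/measurable_EFinP.
have hi : (distribution P X' \x distribution P Y')%E.-integrable setT h.
  apply/integrableP; split=> //.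
  rewrite -integral_indep_prod; last 2 first.
  - exact: measurableT_comp.
  - by move=> z.
  by have /integrableP[] := integrableM_indep.
transitivity (\int[distribution P XY']_z h z)%E.
  by rewrite integral_distribution//; exact: integrableM_indep.
rewrite (eq_measure_integral (distribution P X' \x distribution P Y')%E); last first.
  by move=> A mA _; apply/esym/dist_prod.
rewrite -integral12_prod_meas1// /fubini_F /h /=.
have dX : (distribution P X').-integrable setT (EFin \o f).
  by apply: integrable_pushforward => //; exact/measurable_EFinP.
have dY : (distribution P Y').-integrable setT (EFin \o g).
  by apply: integrable_pushforward => //; exact/measurable_EFinP.
under eq_integral.
  move=> x _; under eq_integral do rewrite EFinM.
  rewrite integralZl//; over.
rewrite -(fineK (integrable_fin_num _ dY))// integralZr//.
rewrite fineK ?integrable_fin_num//.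
by rewrite !integral_distribution//; exact/measurable_EFinP.
Qed.

End Independence.

Lemma Rintegral_sum {d} {T : measurableType d} {R : realType}
    (mu : {measure set T -> \bar R}) (D : set T) (I : Type) (s : seq I) (f : I -> T -> R) :
  measurable D -> (forall i, mu.-integrable D (EFin \o f i)) ->
  mu.-integrable D (EFin \o (fun w => \sum_(i <- s) f i w)) /\
  \int[mu]_(w in D) (\sum_(i <- s) f i w) = \sum_(i <- s) \int[mu]_(w in D) f i w.
Proof.
move=> mD fi; elim: s => [|i s [IHi IHe]].
  rewrite big_nil; under eq_Rintegral do rewrite big_nil.
  split; last by rewrite Rintegral_cst// mul0r.
  rewrite (_ : EFin \o _ = cst 0%E); first exact: integrable0.
  by apply/funext => w /=; rewrite big_nil.
have E : (fun w => \sum_(j <- i :: s) f j w) = (fun w => f i w + \sum_(j <- s) f j w).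
  by apply/funext => w; rewrite big_cons.
rewrite E big_cons RintegralD// IHe; split=> //.
exact: (integrableD mD (fi i) IHi).
Qed.

Section RealExpectation.
Context {d} {T : measurableType d} {R : realType} (P : probability T R).
Implicit Types X Y : T -> R.

Lemma bounded_integrable X (c : R) : measurable_fun setT X ->
  (forall w, `|X w| <= c) -> P.-integrable setT (EFin \o X).
Proof.
move=> mX Xc; apply: measurable_bounded_integrable => //.
  by rewrite [X in (X < _)%E]probability_setT ltry.
by exists c; split; rewrite ?num_real// => e ce x _; exact: le_trans (Xc x) (ltW ce).
Qed.

Lemma integrable_sqr X : measurable_fun setT X ->
  P.-integrable setT (EFin \o (fun w => X w ^+ 2)) -> P.-integrable setT (EFin \o X).
Proof.
move=> mX iX; have i1 : P.-integrable setT (EFin \o cst 1).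
  exact: finite_measure_integrable_cst.
apply: le_integrable (integrableD measurableT i1 iX) => //.
  exact/measurable_EFinP.
move=> w _; rewrite lee_fin /= [leRHS]ger0_norm ?addr_ge0 ?sqr_ge0//.
by have := sqr_ge0 (`|X w| - 1); rewrite -[X w ^+ 2]real_normK ?num_real//; nra.
Qed.

Lemma integrableM_sqr X Y : measurable_fun setT X -> measurable_fun setT Y ->
  P.-integrable setT (EFin \o (fun w => X w ^+ 2)) ->
  P.-integrable setT (EFin \o (fun w => Y w ^+ 2)) ->
  P.-integrable setT (EFin \o (fun w => X w * Y w)).
Proof.
move=> mX mY iX iY; apply: le_integrable (integrableD measurableT iX iY) => //.
  by apply/measurable_EFinP; exact: measurable_funM.
move=> w _; rewrite lee_fin /= [leRHS]ger0_norm ?addr_ge0 ?sqr_ge0// normrM.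
have := sqr_ge0 (`|X w| - `|Y w|).
by rewrite -[X w ^+ 2]real_normK ?num_real// -[Y w ^+ 2]real_normK ?num_real//; nra.
Qed.

Lemma ae_eq_Rintegral X Y : measurable_fun setT X -> measurable_fun setT Y ->
  {ae P, forall w, X w = Y w} -> \int[P]_w X w = \int[P]_w Y w.
Proof.
move=> mX mY XY; rewrite /Rintegral; congr fine; apply: ae_eq_integral => //.
- exact/measurable_EFinP.
- exact/measurable_EFinP.
- by apply: filterS XY => w /= -> _.
Qed.

Lemma ae_eq_integrable X Y : measurable_fun setT X -> measurable_fun setT Y ->
  {ae P, forall w, X w = Y w} -> P.-integrable setT (EFin \o X) ->
  P.-integrable setT (EFin \o Y).
Proof.
move=> mX mY XY /integrableP[_ iX]; apply/integrableP; split; first exact/measurable_EFinP.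
rewrite (_ : (\int[P]_x _)%E = (\int[P]_x `|(EFin \o X) x|)%E)//.
apply: ae_eq_integral => //.
- by apply: measurableT_comp => //; exact/measurable_EFinP.
- by apply: measurableT_comp => //; exact/measurable_EFinP.
- by apply: filterS XY => w /= -> _.
Qed.

End RealExpectation.

(** * Increments of the Wiener process *)

Section WienerIncrements.
Context {d} {Omega : measurableType d} {R : realType} (Pr : probability Omega R).
Variables (T : R) (F : R -> set (set Omega)).
Hypothesis F_basis : stochastic_basis Pr T F.
Context {H : hilbertType R}.
Variable W : R -> H -> Omega -> R.
Hypothesis W_wiener : cylindrical_wiener Pr T F W.
Implicit Types (s t : R) (u v : H) (X : Omega -> R).

Local Notation FT s := (g_sigma_algebraType (F s)).

Definition incr s t u w := W t u w - W s u w.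

Lemma FT_measurable s (A : set Omega) : 0 <= s <= T ->
  measurable (A : set (FT s)) <-> F s A.
Proof.
move=> sT; rewrite [X in X <-> _](_ : _ = <<s F s>> A)//.
by rewrite sigma_algebra_id//; exact: (filtration_sigma F_basis).
Qed.

Lemma FT_measurable_fun s X : 0 <= s <= T ->
  measurable_fun [set: FT s] X -> measurable_fun setT X.
Proof.
move=> sT mX _ B mB; rewrite setTI; apply: (filtration_sub F_basis sT).
by apply/(FT_measurable _ sT); rewrite -[X in measurable X]setTI; exact: mX.
Qed.

Lemma FT_measurable_W s t u : 0 <= s -> s <= t -> t <= T ->
  measurable_fun [set: FT t] (W s u).
Proof.
move=> s0 st tT _ B mB; rewrite setTI.
have tT' : 0 <= t <= T by rewrite (le_trans s0 st).
apply/(FT_measurable _ tT').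
apply: (filtration_nondecr F_basis s0 st tT).
by apply: (wiener_adapted W_wiener) => //; rewrite s0 (le_trans st).
Qed.

Lemma FT_measurable_incr s t r u : 0 <= s -> s <= t -> t <= r -> r <= T ->
  measurable_fun [set: FT r] (incr s t u).
Proof.
move=> s0 st tr rT; apply: measurable_funB; apply: FT_measurable_W => //.
  exact: le_trans s0 st.
exact: le_trans st tr.
Qed.

Lemma FT_measurable_indic s r (A : set Omega) : 0 <= s -> s <= r -> r <= T ->
  F s A -> measurable_fun [set: FT r] (\1_A : Omega -> R).
Proof.
move=> s0 sr rT FA; apply: (@measurable_indic _ (FT r) R setT A).
apply/FT_measurable; first by rewrite (le_trans s0 sr).
exact: (filtration_nondecr F_basis s0 sr rT).
Qed.

Lemma measurable_incr s t u : 0 <= s -> s <= t -> t <= T ->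
  measurable_fun setT (incr s t u).
Proof.
move=> s0 st tT; apply: (@FT_measurable_fun t); first by rewrite (le_trans s0 st).
exact: FT_measurable_incr.
Qed.

Lemma incr0 s t : 0 <= s -> s <= t -> t <= T -> {ae Pr, forall w, incr s t 0 w = 0}.
Proof.
move=> s0 st tT.
have W0 r : 0 <= r <= T -> {ae Pr, forall w, W r 0 w = 0}.
  move=> rT; have := wiener_linear W_wiener 1 0 0 rT.
  rewrite scaler0 addr0; apply: filterS => w; rewrite mul1r => /eqP.
  by rewrite -subr_eq0 opprD addrA subrr sub0r oppr_eq0 => /eqP.
have := W0 s; have := W0 t.
rewrite s0 (le_trans s0 st) (le_trans st tT) tT => /(_ erefl) h1 /(_ erefl) h2.
by apply: filterS2 h1 h2 => w; rewrite /incr => -> ->; rewrite subr0.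
Qed.

Lemma incrD s t u v : 0 <= s -> s <= t -> t <= T ->
  {ae Pr, forall w, incr s t (u + v) w = incr s t u w + incr s t v w}.
Proof.
move=> s0 st tT.
have h r : 0 <= r <= T -> {ae Pr, forall w, W r (u + v) w = W r u w + W r v w}.
  move=> rT; have := wiener_linear W_wiener 1 u v rT.
  by rewrite scale1r; apply: filterS => w; rewrite mul1r.
have := h s; have := h t.
rewrite s0 (le_trans s0 st) (le_trans st tT) tT => /(_ erefl) h1 /(_ erefl) h2.
by apply: filterS2 h1 h2 => w; rewrite /incr => -> ->; ring.
Qed.

Lemma incrN s t u : 0 <= s -> s <= t -> t <= T ->
  {ae Pr, forall w, incr s t (- u) w = - incr s t u w}.
Proof.
move=> s0 st tT; have := incrD u (- u) s0 st tT; have := incr0 s0 st tT.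
rewrite subrr; apply: filterS2 => w -> /eqP.
by rewrite eq_sym addrC addr_eq0 => /eqP.
Qed.

(** Events of F s are the preimages under the identity onto [FT s], which matches
    [wiener_incr_indep] for s < t. For s = t the increment is identically 0. *)
Lemma independent_incr s t u : 0 <= s -> s <= t -> t <= T ->
  independent Pr (id : Omega -> FT s) (incr s t u).
Proof.
move=> s0 st tT A B mA mB.
have FA : F s A by apply/FT_measurable => //; rewrite s0 (le_trans st).
move: st; rewrite le_eqVlt => /orP[/eqP ts|st]; last first.
  exact: (wiener_incr_indep W_wiener).
have [B0|B0] := pselect (B 0).
  have -> : incr s t u @^-1` B = setT.
    by apply/seteqP; split=> // w _ /=; rewrite /incr ts subrr.
  by rewrite setIT probability_setT mule1.
have -> : incr s t u @^-1` B = set0.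
  by apply/seteqP; split=> // w /=; rewrite /incr ts subrr.
by rewrite setI0 measure0 mule0.
Qed.

Let incr_law s t u (mi : measurable_fun setT (incr s t u : Omega -> measurableTypeR R)) :
  0 <= s -> s < t -> t <= T -> u != 0 ->
  forall C, measurable C ->
  distribution Pr (@mfun_Sub _ _ Omega (measurableTypeR R) _ (mem_set mi)) C =
    normal_prob 0 (Num.sqrt (t - s) * `|u|) C.
Proof. by move=> s0 st tT u0 C mC; exact: (wiener_incr_law W_wiener). Qed.

Lemma ge0_integral_incr s t u (f : R -> \bar R) : 0 <= s -> s < t -> t <= T -> u != 0 ->
  measurable_fun setT f -> (forall x, (0 <= f x)%E) ->
  (\int[Pr]_w f (incr s t u w) =
   \int[normal_prob 0 (Num.sqrt (t - s) * `|u|)]_x f x)%E.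
Proof.
move=> s0 st tT u0 mf f0; have mi := measurable_incr u s0 (ltW st) tT.
pose X := @mfun_Sub _ _ Omega (measurableTypeR R) (incr s t u) (mem_set mi).
rewrite -(@ge0_integral_distribution _ _ _ _ _ Pr X f)//.
by apply: eq_measure_integral => A mA _; exact: incr_law.
Qed.

Lemma Rintegral_incr s t u (f : R -> R) : 0 <= s -> s < t -> t <= T -> u != 0 ->
  measurable_fun setT f -> Pr.-integrable setT (EFin \o (f \o incr s t u)) ->
  \int[Pr]_w f (incr s t u w) = \int[normal_prob 0 (Num.sqrt (t - s) * `|u|)]_x f x.
Proof.
move=> s0 st tT u0 mf fi; have mi := measurable_incr u s0 (ltW st) tT.
rewrite /Rintegral; congr fine.
pose X := @mfun_Sub _ _ Omega (measurableTypeR R) (incr s t u) (mem_set mi).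
transitivity (\int[distribution Pr X]_x (f x)%:E)%E.
  by rewrite integral_distribution//; exact/measurable_EFinP.
by apply: eq_measure_integral => A mA _; exact: incr_law.
Qed.

(** The normal law of an increment is given for s < t and u != 0. The remaining cases have variance
    0 and are handled through this almost sure equality. *)
Let incr_degenerate s t u : 0 <= s -> s <= t -> t <= T -> (s == t) || (u == 0) ->
  {ae Pr, forall w, incr s t u w = 0}.
Proof.
move=> s0 st tT /orP[/eqP ->|/eqP ->]; last exact: incr0.
by apply: aeW => w; rewrite /incr subrr.
Qed.

Let sd_gt0 s t u : s < t -> u != 0 -> 0 < Num.sqrt (t - s) * `|u|.
Proof. by move=> st u0; rewrite mulr_gt0 ?normr_gt0// sqrtr_gt0 subr_gt0. Qed.

Let sd_sqr s t u : s <= t -> (Num.sqrt (t - s) * `|u|) ^+ 2 = (t - s) * `|u| ^+ 2.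
Proof. by move=> st; rewrite exprMn sqr_sqrtr// subr_ge0. Qed.

Lemma incr_sqr s t u : 0 <= s -> s <= t -> t <= T ->
  Pr.-integrable setT (EFin \o (fun w => incr s t u w ^+ 2)) /\
  \int[Pr]_w (incr s t u w ^+ 2) = (t - s) * `|u| ^+ 2.
Proof.
move=> s0 st tT; have mi := measurable_incr u s0 st tT.
have mi2 : measurable_fun setT (fun w => incr s t u w ^+ 2) by exact: measurable_funX.
have [deg|] := boolP ((s == t) || (u == 0)).
  have h : {ae Pr, forall w, cst 0 w = incr s t u w ^+ 2}.
    by have := incr_degenerate s0 st tT deg; apply: filterS => w ->; rewrite expr0n.
  split; first by apply: ae_eq_integrable h _ => //; exact: integrable0.
  rewrite -(ae_eq_Rintegral _ _ h)//= Rintegral_cst// mul0r.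
  by case/orP: deg => /eqP ->; rewrite ?subrr ?mul0r// normr0 expr0n mulr0.
rewrite negb_or => /andP[st' u0]; have {}st' : s < t by rewrite lt_neqAle st'.
have E : (\int[Pr]_w (incr s t u w ^+ 2)%:E = ((t - s) * `|u| ^+ 2)%:E)%E.
  rewrite (ge0_integral_incr (f := fun x => (x ^+ 2)%:E))//.
  - by rewrite integral_normal_sqr ?sd_sqr// sd_gt0.
  - by apply/measurable_EFinP; exact: measurable_funX.
  - by move=> x; rewrite lee_fin sqr_ge0.
split; last by rewrite /Rintegral E.
apply/integrableP; split; first exact/measurable_EFinP.
under eq_integral do rewrite /= ger0_norm ?sqr_ge0//.
by rewrite E ltry.
Qed.

Lemma Rintegral_cos_incr s t u : 0 <= s -> s <= t -> t <= T ->
  \int[Pr]_w cos (incr s t u w) = expR (- ((t - s) * `|u| ^+ 2 / 2)).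
Proof.
move=> s0 st tT; have mi := measurable_incr u s0 st tT.
have mcos : measurable_fun setT (fun x : R => cos x).
  by apply: continuous_measurable_fun; exact: continuous_cos.
have mci : measurable_fun setT (fun w => cos (incr s t u w)) by exact: measurableT_comp.
have [deg|] := boolP ((s == t) || (u == 0)).
  have h : {ae Pr, forall w, cst 1 w = cos (incr s t u w)}.
    by have := incr_degenerate s0 st tT deg; apply: filterS => w ->; rewrite cos0.
  rewrite -(ae_eq_Rintegral _ _ h)//= Rintegral_cst// [X in fine X]probability_setT mul1r.
  rewrite (_ : _ / 2 = 0) ?oppr0 ?expR0//.
  by case/orP: deg => /eqP ->; rewrite ?subrr ?mul0r// normr0 expr0n mulr0 mul0r.
rewrite negb_or => /andP[st' u0]; have {}st' : s < t by rewrite lt_neqAle st'.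
rewrite (Rintegral_incr (f := cos))//.
  have := integral_normal_cos (sd_gt0 st' u0) 1.
  by under eq_Rintegral do rewrite mul1r; move=> ->; rewrite sd_sqr// expr1n mulr1.
apply: (@bounded_integrable _ _ _ _ _ 1) => // w.
by rewrite /= ler_norml cos_geN1 cos_le1.
Qed.

(* Both [u] and [- u] give centred normal increments with the same variance. *)
Lemma Rintegral_odd_incr s t u (g : R -> R) : 0 <= s -> s <= t -> t <= T ->
  measurable_fun setT g -> (forall x, g (- x) = - g x) ->
  Pr.-integrable setT (EFin \o (g \o incr s t u)) ->
  \int[Pr]_w g (incr s t u w) = 0.
Proof.
move=> s0 st tT mg gN gi; have mi v := measurable_incr v s0 st tT.
have mgi v : measurable_fun setT (fun w => g (incr s t v w)) by exact: measurableT_comp.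
have g0 : g 0 = 0 by have := gN 0; rewrite oppr0 => h; lra.
have [deg|] := boolP ((s == t) || (u == 0)).
  have h : {ae Pr, forall w, cst 0 w = g (incr s t u w)}.
    by have := incr_degenerate s0 st tT deg; apply: filterS => w ->; rewrite g0.
  by rewrite -(ae_eq_Rintegral _ _ h)//= Rintegral_cst// mul0r.
rewrite negb_or => /andP[st' u0]; have {}st' : s < t by rewrite lt_neqAle st'.
have h : {ae Pr, forall w, - g (incr s t u w) = g (incr s t (- u) w)}.
  by have := incrN u s0 st tT; apply: filterS => w ->; rewrite gN.
have giN : Pr.-integrable setT (EFin \o (fun w => - g (incr s t u w))).
  exact: (integrableN gi).
have giN' : Pr.-integrable setT (EFin \o (g \o incr s t (- u))).
  by apply: ae_eq_integrable h giN => //; exact: measurableT_comp.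
have E1 := Rintegral_incr s0 st' tT u0 mg gi.
have uN0 : - u != 0 by rewrite oppr_eq0.
have E2 := Rintegral_incr s0 st' tT uN0 mg giN'.
have E3 : \int[Pr]_w g (incr s t (- u) w) = - \int[Pr]_w g (incr s t u w).
  rewrite -(ae_eq_Rintegral _ _ h)//; last exact: measurableT_comp.
  rewrite -mulN1r -RintegralZl//; by under [RHS]eq_Rintegral do rewrite mulN1r.
move: E2; rewrite normrN -E1 E3 => E4; lra.
Qed.

(** A factor known at time s splits off by independence; this does the work of conditional
    expectations. *)
Lemma RintegralM_incr s t u X (g : R -> R) : 0 <= s -> s <= t -> t <= T ->
  measurable_fun [set: FT s] X -> measurable_fun setT g ->
  Pr.-integrable setT (EFin \o X) -> Pr.-integrable setT (EFin \o (g \o incr s t u)) ->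
  Pr.-integrable setT (EFin \o (fun w => X w * g (incr s t u w))) /\
  \int[Pr]_w (X w * g (incr s t u w)) = (\int[Pr]_w X w) * \int[Pr]_w g (incr s t u w).
Proof.
move=> s0 st tT mX mg iX ig; have ind := independent_incr u s0 st tT.
have sT : 0 <= s <= T by rewrite s0 (le_trans st).
have mid : measurable_fun setT (id : Omega -> FT s).
  move=> _ A mA; rewrite setTI; apply: (filtration_sub F_basis sT).
  exact/FT_measurable.
have mi := measurable_incr u s0 st tT.
split; first exact: (integrableM_indep mid mi ind mX mg iX ig).
exact: (RintegralM_indep mid mi ind mX mg iX ig).
Qed.

End WienerIncrements.

(** * The Ito isometry *)

Section ItoIsometry.
Context {d} {Omega : measurableType d} {R : realType} (Pr : probability Omega R).
Variables (T : R) (F : R -> set (set Omega)).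
Hypothesis F_basis : stochastic_basis Pr T F.
Context {H : hilbertType R}.
Variable W : R -> H -> Omega -> R.
Hypothesis W_wiener : cylindrical_wiener Pr T F W.
Implicit Types (s t : R) (u v : H) (X : Omega -> R) (A : set Omega).

Local Notation FT s := (g_sigma_algebraType (F s)).
Local Notation dW := (incr W).
Local Notation prob A := (fine (Pr A)).

Lemma incr_id s t u : 0 <= s -> s <= t -> t <= T ->
  Pr.-integrable setT (EFin \o dW s t u).
Proof.
move=> s0 st tT; apply: integrable_sqr.
  exact: (measurable_incr F_basis W_wiener u s0 st tT).
by have [] := incr_sqr F_basis W_wiener u s0 st tT.
Qed.

Lemma incr_orthogonal s t u X : 0 <= s -> s <= t -> t <= T ->
  measurable_fun [set: FT s] X -> Pr.-integrable setT (EFin \o X) ->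
  Pr.-integrable setT (EFin \o (fun w => X w * dW s t u w)) /\
  \int[Pr]_w (X w * dW s t u w) = 0.
Proof.
move=> s0 st tT mX iX.
have [i ->] := RintegralM_incr F_basis W_wiener s0 st tT mX
  (@measurable_id _ _ setT) iX (incr_id u s0 st tT).
split=> //; rewrite [X in _ * X](_ : _ = 0) ?mulr0//.
by apply: (Rintegral_odd_incr F_basis W_wiener s0 st tT (g := id) (u := u)) => //; exact: incr_id.
Qed.

Let indic_sqr s t u A : 0 <= s -> s <= t -> t <= T -> F s A ->
  Pr.-integrable setT (EFin \o (fun w => \1_A w * dW s t u w ^+ 2)) /\
  \int[Pr]_w (\1_A w * dW s t u w ^+ 2) = prob A * (t - s) * `|u| ^+ 2.
Proof.
move=> s0 st tT FA; have sT : 0 <= s <= T by rewrite s0 (le_trans st).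
have mA := filtration_sub F_basis sT FA.
have mFA : measurable_fun [set: FT s] (\1_A : Omega -> R).
  by apply: (FT_measurable_indic F_basis s0) => //; exact: le_trans tT.
have [i2 E2] := incr_sqr F_basis W_wiener u s0 st tT.
have [] := RintegralM_incr F_basis W_wiener s0 st tT mFA
  (@measurable_funX _ _ _ _ _ 2 (@measurable_id _ _ setT)) (integrable_indic Pr mA) i2.
move=> i ->; split=> //; rewrite E2 mulrA; congr (_ * _ * _).
by rewrite /Rintegral integral_indic// setIT.
Qed.

(** Polarisation of [indic_sqr]. As [W] is linear in its direction only almost surely, the polarised
    expression [Y] is merely almost everywhere equal to the product. *)
Let indic_mul s t u v A : 0 <= s -> s <= t -> t <= T -> F s A ->
  Pr.-integrable setT (EFin \o (fun w => \1_A w * dW s t u w * dW s t v w)) /\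
  \int[Pr]_w (\1_A w * dW s t u w * dW s t v w) = prob A * (t - s) * inner u v.
Proof.
move=> s0 st tT FA; have sT : 0 <= s <= T by rewrite s0 (le_trans st).
have mA := filtration_sub F_basis sT FA.
have mi z := measurable_incr F_basis W_wiener z s0 st tT.
have mI : measurable_fun setT (\1_A : Omega -> R) by exact: measurable_indic.
have [iuv Euv] := indic_sqr (u + v) s0 st tT FA.
have [iu Eu] := indic_sqr u s0 st tT FA.
have [iv Ev] := indic_sqr v s0 st tT FA.
pose Y w := 2^-1 * (\1_A w * dW s t (u + v) w ^+ 2 - \1_A w * dW s t u w ^+ 2
   - \1_A w * dW s t v w ^+ 2).
have iY1 := integrableB measurableT iuv iu.
have iY2 := integrableB measurableT iY1 iv.
have iY : Pr.-integrable setT (EFin \o Y) by exact: (integrableZl measurableT 2^-1 iY2).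
have EY : \int[Pr]_w Y w = prob A * (t - s) * inner u v.
  rewrite RintegralZl// RintegralB// RintegralB// Euv Eu Ev norm_sqrD.
  by field.
have h : {ae Pr, forall w, Y w = \1_A w * dW s t u w * dW s t v w}.
  by have := incrD W_wiener u v s0 st tT; apply: filterS => w; rewrite /Y => ->; field.
have mm : measurable_fun setT (fun w => \1_A w * dW s t u w * dW s t v w).
  by apply: measurable_funM => //; exact: measurable_funM.
have mY : measurable_fun setT Y.
  apply: measurable_funM => //; apply: measurable_funB.
    by apply: measurable_funB; apply: measurable_funM => //; exact: measurable_funX.
  by apply: measurable_funM => //; exact: measurable_funX.
split; first exact: ae_eq_integrable mY mm h iY.
by rewrite -EY; apply/esym; exact: ae_eq_Rintegral.
Qed.

Let incr_split s r t u w : dW s t u w = dW s r u w + dW r t u w.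
Proof. by rewrite /incr; ring. Qed.

(** After time t the increment in direction v is orthogonal to whatever is known at time t, so only
    the common interval contributes. *)
Let pair_same s t t' u v A : 0 <= s -> s <= t -> t <= t' -> t' <= T -> F s A ->
  Pr.-integrable setT (EFin \o (fun w => \1_A w * dW s t u w * dW s t' v w)) /\
  \int[Pr]_w (\1_A w * dW s t u w * dW s t' v w) = prob A * (t - s) * inner u v.
Proof.
move=> s0 st tt' tT FA.
have tT' := le_trans tt' tT.
have [i1 E1] := indic_mul u v s0 st tT' FA.
have mX : measurable_fun [set: FT t] (fun w => \1_A w * dW s t u w).
  apply: measurable_funM.
    exact: (FT_measurable_indic F_basis s0).
  exact: (FT_measurable_incr F_basis W_wiener).
have iX : Pr.-integrable setT (EFin \o (fun w => \1_A w * dW s t u w)).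
  have sT : 0 <= s <= T by rewrite s0 (le_trans st).
  have mA := filtration_sub F_basis sT FA.
  apply: integrableM_sqr.
  - exact: measurable_indic.
  - exact: (measurable_incr F_basis W_wiener).
  - apply: (@bounded_integrable _ _ _ _ _ 1).
      by apply: measurable_funX; exact: measurable_indic.
    by move=> w; rewrite indicE; case: (_ \in _); rewrite /= ?expr1n ?expr0n ?normr1 ?normr0.
  - by have [] := incr_sqr F_basis W_wiener u s0 st tT'.
have [i2 E2] := incr_orthogonal v (le_trans s0 st) tt' tT mX iX.
have e w : \1_A w * dW s t u w * dW s t' v w =
   \1_A w * dW s t u w * dW s t v w + \1_A w * dW s t u w * dW t t' v w.
  by rewrite (incr_split s t t'); ring.
split.
  by under eq_fun do rewrite e; exact: (integrableD measurableT i1 i2).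
under eq_Rintegral do rewrite e.
by rewrite RintegralD// E1 E2 addr0.
Qed.

Definition step_int (e : @rank_one_step d Omega R H) w : R :=
  \1_(ev e) w * dW (lo e) (hi e) (vin e) w.

Definition overlap (e f : @rank_one_step d Omega R H) : R :=
  Num.max 0 (Num.min (hi e) (hi f) - Num.max (lo e) (lo f)).

(** Both events are known at the later left endpoint l'. The part of the earlier step before l' is
    therefore orthogonal to the later step, and two increments starting at l' remain, which is the
    case of [pair_same]. *)
Lemma step_int_mul e f : admissible_step F T e -> admissible_step F T f ->
  Pr.-integrable setT (EFin \o (fun w => step_int e w * step_int f w)) /\
  \int[Pr]_w (step_int e w * step_int f w) =
    prob (ev e `&` ev f) * overlap e f * inner (vin e) (vin f).
Proof.
wlog lef : e f / lo e <= lo f.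
  move=> hw ae af; have [|/ltW] := leP (lo e) (lo f); first by move=> /hw; exact.
  move=> /hw /(_ af ae) [i E].
  have c w : step_int e w * step_int f w = step_int f w * step_int e w by rewrite mulrC.
  split; first by under eq_fun do rewrite c.
  under eq_Rintegral do rewrite c.
  by rewrite E setIC innerC /overlap (minC (hi f)) (maxC (lo f)).
case: e lef => l h A u c; case: f => l' h' A' u' c' /= ll' [/= l0 lh hT FA] [/= l'0 lh' hT' FA'].
rewrite /step_int /overlap /= (max_idPr ll').
have l'T : 0 <= l' <= T by rewrite l'0 (le_trans lh').
have FAA : F l' (A `&` A').
  have h2 : F l' A by apply: (filtration_nondecr F_basis l0 ll') => //; case/andP: l'T.
  rewrite -(FT_measurable F_basis _ l'T); apply: measurableI; exact/(FT_measurable F_basis _ l'T).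
have e1 w : \1_A w * dW l h u w * (\1_A' w * dW l' h' u' w) =
   \1_(A `&` A') w * dW l h u w * dW l' h' u' w.
  by rewrite indicI /=; ring.
under eq_fun do rewrite e1.
have mIF r : l' <= r -> r <= T -> measurable_fun [set: FT r] (\1_(A `&` A') : Omega -> R).
  by move=> l'r rT; exact: (FT_measurable_indic F_basis l'0).
have mAA : measurable (A `&` A') by exact: (filtration_sub F_basis l'T).
have iX r : l <= r -> r <= T ->
    Pr.-integrable setT (EFin \o (fun w => \1_(A `&` A') w * dW l r u w)).
  move=> lr rT; apply: integrableM_sqr.
  - exact: measurable_indic.
  - exact: (measurable_incr F_basis W_wiener).
  - apply: (@bounded_integrable _ _ _ _ _ 1).
      by apply: measurable_funX; exact: measurable_indic.
    by move=> w; rewrite indicE; case: (_ \in _); rewrite /= ?expr1n ?expr0n ?normr1 ?normr0.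
  - by have [] := incr_sqr F_basis W_wiener u l0 lr rT.
have [hl'|l'h] := leP h l'.
  have mX : measurable_fun [set: FT l'] (fun w => \1_(A `&` A') w * dW l h u w).
    apply: measurable_funM; first by apply: mIF => //; case/andP: l'T.
    by apply: (FT_measurable_incr F_basis W_wiener) => //; case/andP: l'T.
  have [i ->] := incr_orthogonal u' l'0 lh' hT' mX (iX h lh hT).
  split=> //; rewrite (max_idPl _) ?mulr0 ?mul0r// subr_le0.
  by rewrite ge_min hl'.
have l'T' : l' <= T by case/andP: l'T.
have mX : measurable_fun [set: FT l'] (fun w => \1_(A `&` A') w * dW l l' u w).
  apply: measurable_funM; first exact: mIF.
  exact: (FT_measurable_incr F_basis W_wiener).
have [i1 E1] := incr_orthogonal u' l'0 lh' hT' mX (iX l' ll' l'T').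
have [i2 E2] : Pr.-integrable setT
    (EFin \o (fun w => \1_(A `&` A') w * dW l' h u w * dW l' h' u' w)) /\
  \int[Pr]_w (\1_(A `&` A') w * dW l' h u w * dW l' h' u' w) =
    prob (A `&` A') * (Num.min h h' - l') * inner u u'.
  have [hh'|/ltW hh'] := leP h h'.
    by have := pair_same u u' l'0 (ltW l'h) hh' hT' FAA.
  have [i E] := pair_same u' u l'0 lh' hh' hT FAA.
  have e2 w : \1_(A `&` A') w * dW l' h u w * dW l' h' u' w =
      \1_(A `&` A') w * dW l' h' u' w * dW l' h u w by ring.
  split; first by under eq_fun do rewrite e2.
  by under eq_Rintegral do rewrite e2; rewrite E innerC.
have e3 w : \1_(A `&` A') w * dW l h u w * dW l' h' u' w =
    \1_(A `&` A') w * dW l l' u w * dW l' h' u' w +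
    \1_(A `&` A') w * dW l' h u w * dW l' h' u' w.
  by rewrite (incr_split l l' h); ring.
split; first by under eq_fun do rewrite e3; exact: (integrableD measurableT i1 i2).
under eq_Rintegral do rewrite e3.
rewrite RintegralD// E1 E2 add0r; congr (_ * _ * _); apply/esym/max_idPr.
by rewrite subr_ge0 le_min lh' (ltW l'h).
Qed.

(** The second moment is expanded into an explicit double sum, to be matched with the squared norm
    of the integrand, which [field_isometry] expands in the same way. *)
Lemma ito_isometry (I : finType) (c : I -> R) (e : I -> rank_one_step) :
  (forall i, admissible_step F T (e i)) ->
  (\int[Pr]_w ((\sum_i c i * step_int (e i) w) ^+ 2)%:E =
   (\sum_i \sum_j c i * c j * (prob (ev (e i) `&` ev (e j)) * overlap (e i) (e j) *
      inner (vin (e i)) (vin (e j))))%:E)%E.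
Proof.
move=> ae.
pose f (p : I * I) w := c p.1 * c p.2 * (step_int (e p.1) w * step_int (e p.2) w).
have fi p : Pr.-integrable setT (EFin \o f p).
  have [i _] := step_int_mul (ae p.1) (ae p.2).
  exact: (integrableZl measurableT (c p.1 * c p.2) i).
have E w : (\sum_i c i * step_int (e i) w) ^+ 2 = \sum_p f p w.
  rewrite expr2 big_distrlr /= pair_big /=; apply: eq_bigr => p _.
  by rewrite /f; ring.
have [si Es] := Rintegral_sum (mu := Pr) (index_enum (I * I)%type) measurableT fi.
under eq_integral do rewrite E.
rewrite -[LHS]fineK; last exact: (integrable_fin_num measurableT si).
congr EFin; rewrite [LHS]Es pair_big /=; apply: eq_bigr => p _.
have [i E2] := step_int_mul (ae p.1) (ae p.2).
by rewrite RintegralZl// E2.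
Qed.

End ItoIsometry.

(** * Random fields with values in H and their norms over time and Omega *)

Section Fields.
Context {d} {Omega : measurableType d} {R : realType} (Pr : probability Omega R).
Context {H : hilbertType R} (I : finType).
Implicit Types (a : I -> R -> R) (A : I -> set Omega) (v : I -> H).

(** The adjoint of an elementary integrand, applied to u, has this form: the adjoint of <vin, .>
    vout sends u to <u, vout> vin. The time factors are arbitrary functions, so that exponentials
    and indicators of intervals can be mixed. *)
Definition rfield a A v (s : R) (w : Omega) : H :=
  \sum_i (a i s * \1_(A i) w) *: v i.

Lemma rfield_sqr a A v s w : `|rfield a A v s w| ^+ 2 =
  \sum_i \sum_j (a i s * a j s) * (\1_(A i `&` A j) w * inner (v i) (v j)).
Proof.
rewrite -inner_normE /rfield inner_suml; apply: eq_bigr => i _.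
rewrite inner_sumr; apply: eq_bigr => j _.
by rewrite innerZl innerZr indicI /=; ring.
Qed.

Lemma measurable_rfield_sqr a A v : (forall i, measurable_fun setT (a i)) ->
  (forall i, measurable (A i)) ->
  measurable_fun setT (fun z : Omega * R => `|rfield a A v z.2 z.1| ^+ 2).
Proof.
move=> ma mA; under eq_fun do rewrite rfield_sqr.
apply: measurable_sum => i; apply: measurable_sum => j.
have mij : measurable_fun setT (fun s => a i s * a j s) by exact: measurable_funM.
apply: measurable_funM; first exact: (measurableT_comp mij measurable_snd).
apply: measurable_funM => //.
apply: (@measurableT_comp _ _ _ _ _ _ (\1_(A i `&` A j) : Omega -> R) _ fst) => //.
by apply: measurable_indic; exact: measurableI.
Qed.

End Fields.

Section FieldIsometry.
Context {d} {Omega : measurableType d} {R : realType} (Pr : probability Omega R).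
Variables (T : R) (F : R -> set (set Omega)).
Hypothesis F_basis : stochastic_basis Pr T F.
Context {H : hilbertType R}.
Local Notation leb := (@lebesgue_measure R).

Definition step_time (c : R) (e : @rank_one_step d Omega R H) (s : R) : R :=
  c * \1_([set` `]lo e, hi e]] : set R) s.

Lemma measurable_step_time c e : measurable_fun setT (step_time c e).
Proof. by apply: measurable_funM => //; exact: measurable_indic. Qed.

Lemma step_time_mul c e c' f : admissible_step F T e -> admissible_step F T f ->
  leb.-integrable `]0, T[ (EFin \o (fun s => step_time c e s * step_time c' f s)) /\
  \int[leb]_(s in `]0, T[) (step_time c e s * step_time c' f s) = c * c' * overlap e f.
Proof.
case: e => l h A u x [/= l0 lh hT _]; case: f => l' h' A' u' x' [/= l'0 lh' hT' _].
rewrite /step_time /overlap /=.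
set S := [set` `]l, h]] `&` [set` `]l', h']] : set R.
have mS : measurable S by exact: measurableI.
have E s : c * \1_[set` `]l, h]] s * (c' * \1_[set` `]l', h']] s) = (c * c') * \1_S s :> R.
  by rewrite /S indicI /=; ring.
have i1 : leb.-integrable `]0, T] (EFin \o (\1_S : R -> R)).
  apply/integrableP; split.
    by apply/measurable_EFinP; apply: measurable_funTS; exact: measurable_indic.
  under eq_integral do rewrite /= ger0_norm//.
  rewrite integral_indic//= (le_lt_trans (measureIl _ _ _))//=.
  by rewrite (le_lt_trans (measureIl _ _ _))//= lebesgue_measure_itv /=; case: ifP => _; rewrite ?ltry// -EFinB ltry.
have i2 : leb.-integrable `]0, T] (EFin \o (fun s => c * c' * \1_S s)).
  exact: (integrableZl _ (c * c') i1).
have E1 : \int[leb]_(s in `]0, T]) \1_S s = Num.max 0 (Num.min h h' - Num.max l l') :> R.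
  rewrite /Rintegral integral_indic//.
  pose a : R := Num.max l l'; pose b : R := Num.min h h'.
  rewrite setIC; have -> : `]0, T]%classic `&` S = `]a, b]%classic.
    apply/seteqP; split=> s /=; rewrite /S /= !in_itv /= /a /b gt_max le_min.
      by move=> [_ [/andP[-> ->] /andP[-> ->]]].
    move=> /andP[/andP[ls l's] /andP[sh sh']].
    by rewrite ls l's sh sh' (le_lt_trans l0 ls) (le_trans sh hT).
  rewrite /= lebesgue_measure_itv /= lte_fin -EFinB -/a -/b.
  by case: ltP => hl; [apply/esym/max_idPr; rewrite subr_ge0 ltW|apply/esym/max_idPl; rewrite subr_le0].
have sub : (`]0, T[%classic : set R) `<=` `]0, T]%classic.
  by move=> s /=; rewrite !in_itv /= => /andP[-> /ltW].
have i3 : leb.-integrable `]0, T[ (EFin \o (fun s => c * c' * \1_S s)).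
  by apply: (integrableS _ _ _ i2) => //; exact: measurable_itv.
rewrite (_ : (fun s => _) = (fun s => c * c' * \1_S s)); last exact/funext.
split=> //; rewrite Rintegral_itv_bndo_bndc//.
by rewrite RintegralZl// E1.
Qed.

(** The side of the Ito isometry that lives on the integrand: overlaps of intervals arise as time
    integrals of products of indicators, and give the double sum of [ito_isometry]. *)
Lemma field_isometry (I : finType) (c : I -> R) (e : I -> rank_one_step) :
  (forall i, admissible_step F T (e i)) ->
  (\int[Pr]_w \int[leb]_(s in `]0%R, T[)
      (`|rfield (fun i => step_time (c i) (e i)) (fun i => ev (e i))
               (fun i => vin (e i)) s w| ^+ 2)%:E =
   (\sum_i \sum_j c i * c j * (fine (Pr (ev (e i) `&` ev (e j))) *
      overlap (e i) (e j) * inner (vin (e i)) (vin (e j))))%:E)%E.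
Proof.
move=> ae.
pose k i j := c i * c j * overlap (e i) (e j) * inner (vin (e i)) (vin (e j)).
have mev i : measurable (ev (e i)).
  have [l0 lh hT FA] := ae i; apply: (filtration_sub F_basis _ FA).
  by rewrite l0 (le_trans lh).
have inner_int w : (\int[leb]_(s in `]0%R, T[)
    (`|rfield (fun i => step_time (c i) (e i)) (fun i => ev (e i))
               (fun i => vin (e i)) s w| ^+ 2)%:E =
    (\sum_(p : I * I) k p.1 p.2 * \1_(ev (e p.1) `&` ev (e p.2)) w)%:E)%E.
  pose f (p : I * I) s := (\1_(ev (e p.1) `&` ev (e p.2)) w *
     inner (vin (e p.1)) (vin (e p.2))) *
     (step_time (c p.1) (e p.1) s * step_time (c p.2) (e p.2) s).
  have fi p : leb.-integrable `]0, T[ (EFin \o f p).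
    have [i _] := step_time_mul (c p.1) (c p.2) (ae p.1) (ae p.2).
    exact: (integrableZl _ (\1_(ev (e p.1) `&` ev (e p.2)) w *
      inner (vin (e p.1)) (vin (e p.2))) i).
  have [si Es] := Rintegral_sum (mu := leb) (D := `]0, T[) (index_enum (I * I)%type)
    (measurable_itv _) fi.
  under eq_integral.
    move=> s _; rewrite rfield_sqr pair_big /= (eq_bigr (f ^~ s)).
      over.
    by move=> p _; rewrite /f mulrC.
  rewrite -[LHS]fineK; last exact: (integrable_fin_num _ si).
  congr EFin; rewrite [LHS]Es; apply: eq_bigr => p _.
  have [i E2] := step_time_mul (c p.1) (c p.2) (ae p.1) (ae p.2).
  by rewrite RintegralZl// E2 /k; ring.
under eq_integral do rewrite inner_int.
pose g (p : I * I) w := k p.1 p.2 * \1_(ev (e p.1) `&` ev (e p.2)) w.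
have mI p : measurable (ev (e p.1) `&` ev (e p.2)) by exact: measurableI.
have gi p : Pr.-integrable setT (EFin \o g p).
  exact: (integrableZl measurableT (k p.1 p.2) (integrable_indic Pr (mI p))).
have [si Es] := Rintegral_sum (mu := Pr) (index_enum (I * I)%type) measurableT gi.
rewrite -[LHS]fineK; last exact: (integrable_fin_num measurableT si).
congr EFin; rewrite [LHS]Es pair_big /=; apply: eq_bigr => p _.
rewrite RintegralZl//; last exact: integrable_indic.
by rewrite /Rintegral integral_indic// setIT /k; ring.
Qed.

End FieldIsometry.

(** * Orthonormal bases and Hilbert-Schmidt norms *)

(** The integral of a nonnegative function is a supremum over simple functions below it, hence
    monotone without any measurability. This matters for [hs_sqnorm] of the approximation error,
    whose measurability in time and outcome is unknown. *)
Lemma le_integral_patch {d} {T : measurableType d} {R : realType}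
    (mu : {measure set T -> \bar R}) (D1 D2 : set T) (f1 f2 : T -> \bar R) :
  (forall x, D1 x -> (0 <= f1 x)%E) -> (forall x, D2 x -> (0 <= f2 x)%E) ->
  D1 `<=` D2 -> (forall x, D1 x -> (f1 x <= f2 x)%E) ->
  (\int[mu]_(x in D1) f1 x <= \int[mu]_(x in D2) f2 x)%E.
Proof.
move=> f10 f20 D12 f12.
have p0 (D : set T) f : (forall x, D x -> (0 <= f x)%E) -> forall x, (0 <= (f \_ D) x)%E.
  by move=> f0 x; rewrite patchE; case: ifPn => //; rewrite inE => /f0.
rewrite integral_mkcond [leRHS]integral_mkcond !ge0_integralTE; [|exact: p0..].
apply: le_ereal_sup => _ [h /= hf <-]; exists h => //= x.
rewrite (le_trans (hf x))// !patchE; case: ifPn => [|_]; rewrite ?inE.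
  by move=> D1x; rewrite mem_set ?f12//; exact: D12.
by case: ifPn => //; rewrite inE => /f20.
Qed.

Section OrthonormalBasis.
Context {R : realType} {H : hilbertType R}.
Variable HB : set H.
Hypothesis HB_basis : orthonormal_basis HB.
Implicit Types (u v x : H) (A : set H).

Lemma basis_inner u v : HB u -> HB v -> inner u v = (u == v)%:R.
Proof. by move=> Hu Hv; apply: HB_basis.1; rewrite inE. Qed.

Lemma basis_partial_sum_dist x A : fsets HB A ->
  `|x - \sum_(b \in A) inner b x *: b| ^+ 2 =
  `|x| ^+ 2 - \sum_(b \in A) inner b x ^+ 2.
Proof.
move=> [finA AHB]; rewrite !fsbig_finite//.
have bb b1 b2 : A b1 -> A b2 -> inner b1 b2 = (b1 == b2)%:R.
  by move=> /AHB h1 /AHB h2; exact: basis_inner.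
set S := \sum_(b <- _) _; set Q := \sum_(b <- _) _.
have xS : inner x S = Q.
  by rewrite inner_sumr; apply: eq_bigr => b _; rewrite innerZr innerC expr2.
have SS : inner S S = Q.
  rewrite inner_suml /Q !big_seq; apply: eq_bigr => b bA.
  have Ab : A b by move: bA; rewrite in_fset_set// inE.
  rewrite innerZl inner_sumr (big_rem b)//= innerZr (bb b b)//.
  rewrite eqxx mulr1 big_seq big1 ?addr0// => b' b'A.
  have b'b : b' != b.
    by move: b'A; rewrite mem_rem_uniq ?finmap.fset_uniq// inE => /andP[].
  have Ab' : A b' by move: (mem_rem b'A); rewrite in_fset_set// inE.
  by rewrite innerZr (bb b b')// eq_sym (negbTE b'b) mulr0.
by rewrite norm_sqrB xS -[`|S| ^+ 2]inner_normE SS; ring.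
Qed.

Lemma parseval_approx x (e : R) : 0 < e ->
  exists2 A, fsets HB A & `|x| ^+ 2 <= \sum_(b \in A) inner b x ^+ 2 + e.
Proof.
move=> e0; have s0 : 0 < Num.sqrt e by rewrite sqrtr_gt0.
have [A fA /(_ A fA (@subset_refl _ A)) h] := HB_basis.2 x _ s0.
exists A => //; rewrite -lerBlDl -(basis_partial_sum_dist x fA).
by rewrite -[leRHS]sqr_sqrtr ?(ltW e0)// lerXn2r ?nnegrE ?sqrtr_ge0// ltW.
Qed.

(* <x, b> = <u, C b> on the basis says that x = C^* u. *)
Lemma hs_sqnorm_ge (u x : H) (C : H -> H) :
  (forall b, HB b -> inner b x = inner u (C b)) ->
  ((`|x| ^+ 2 / (`|u| ^+ 2 + 1))%:E <= hs_sqnorm HB C)%E.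
Proof.
(* The added 1 keeps the quotient meaningful when u = 0. *)
move=> xC; set c := _ + 1.
have c0 : 0 < c by rewrite ltr_wpDl// sqr_ge0.
apply/lee_addgt0Pr => e e0.
have [A fA] := parseval_approx x (mulr_gt0 e0 c0); have [finA AHB] := fA.
rewrite fsbig_finite// => h.
apply: (@le_trans _ _ ((\sum_(b <- finmap.enum_fset (fset_set A)) `|C b| ^+ 2)%:E + e%:E)%E).
  rewrite -EFinD lee_fin ler_pdivrMr// mulrDl (le_trans h)// lerD2r mulr_suml.
  rewrite !big_seq; apply: ler_sum => b; rewrite in_fset_set// inE => Ab.
  rewrite xC; last exact: AHB.
  rewrite -[leLHS]real_normK ?num_real// (@le_trans _ _ ((`|u| * `|C b|) ^+ 2))//.
    by rewrite lerXn2r ?nnegrE ?mulr_ge0// CauchySchwarz_inner.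
  by rewrite exprMn mulrC ler_wpM2l ?sqr_ge0// lerDl.
apply: leeD => //; rewrite -sumEFin -fsbig_finite//.
by apply: ereal_sup_ubound; exists A.
Qed.

End OrthonormalBasis.

(** * Ito integrals of deterministic integrands *)

Section ItoApproximation.
Context {d} {Omega : measurableType d} {R : realType} (Pr : probability Omega R).
Variables (T : R) (F : R -> set (set Omega)).
Hypothesis T_gt0 : 0 < T.
Hypothesis F_basis : stochastic_basis Pr T F.
Context {H : hilbertType R}.
Variable W : R -> H -> Omega -> R.
Hypothesis W_wiener : cylindrical_wiener Pr T F W.
Variable HB : set H.
Hypothesis HB_basis : orthonormal_basis HB.
Variables (Phi : R -> Omega -> H -> H) (Y : Omega -> H).
Hypothesis mY : forall u, measurable_fun setT (fun w => inner u (Y w)).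
Hypothesis Y_ito : is_ito_integral Pr F HB W T Phi Y.
Local Notation leb := (@lebesgue_measure R).
Local Notation step := (@rank_one_step d Omega R H).

Lemma rfield_split (I J : finType) (a : I -> R -> R) (A : I -> set Omega) (v : I -> H)
    (a' : J -> R -> R) (A' : J -> set Omega) (v' : J -> H) s w :
  rfield (sum_rect _ a a') (sum_rect _ A A') (sum_rect _ v v') s w =
  rfield a A v s w + rfield a' A' v' s w.
Proof. by rewrite /rfield big_sumType. Qed.

Lemma integral_rfield_sqr (I : finType) (a : I -> R -> R) (A : I -> set Omega) (v : I -> H) :
  (forall i, measurable_fun setT (a i)) -> (forall i, measurable (A i)) ->
  [/\ forall w, measurable_fun setT (fun s => (`|rfield a A v s w| ^+ 2)%:E) &
    measurable_fun setT (fun w => (\int[leb]_(s in `]0%R, T[) (`|rfield a A v s w| ^+ 2)%:E)%E)].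
Proof.
move=> ma mA; have mh := measurable_rfield_sqr v ma mA.
split=> [w|].
  apply/measurable_EFinP.
  exact: (measurableT_comp mh (@measurable_pair1 _ _ _ _ w)).
pose f (z : Omega * R) := ((`|rfield a A v z.2 z.1| ^+ 2)%:E * (\1_`]0, T[%classic z.2)%:E)%E.
have mf : measurable_fun setT f.
  apply: emeasurable_funM; first exact/measurable_EFinP.
  apply/measurable_EFinP.
  apply: (@measurableT_comp _ _ _ _ _ _ (\1_`]0, T[%classic : R -> R) _ snd) => //.
have f0 z : (0 <= f z)%E by rewrite /f -EFinM lee_fin mulr_ge0 ?sqr_ge0.
have := @measurable_fun_fubini_tonelli_F _ _ _ _ R leb f mf f0.
congr (measurable_fun _ _); apply/funext => w.
by rewrite /fubini_F [RHS]integral_mkcond epatch_indic.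
Qed.

(* The integrand is tested against a vector [u]; [c], [e] describe a
   deterministic step function close to Phi^* u. *)
Lemma ito_approx (u : H) (J K : finType) (a : J -> R -> R) (v : J -> H)
    (c : K -> R) (e : K -> step) (C : R) :
  (forall j, measurable_fun setT (a j)) ->
  (forall s w b, 0 < s < T -> HB b ->
     inner u (Phi s w b) = inner b (\sum_j a j s *: v j)) ->
  (forall k, admissible_step F T (e k)) -> (forall k, ev (e k) = setT) ->
  (forall s, 0 < s < T ->
     `|\sum_j a j s *: v j - \sum_k step_time (c k) (e k) s *: vin (e k)| ^+ 2 <= C) ->
  (\int[Pr]_w ((inner u (Y w) - \sum_k c k * step_int W (e k) w) ^+ 2)%:E <=
    (4 * T * C)%:E)%E.
Proof.
move=> ma PhiE adm evT CP; have [L [Ladm Lhs LY]] := Y_ito.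
pose cu : R := `|u| ^+ 2 + 1; have cu0 : 0 < cu by rewrite ltr_wpDl// sqr_ge0.
pose h n := (\int[Pr]_w \int[leb]_(s in [set` `[0%R, T]])
         hs_sqnorm HB (fun v => elementary_val (L n) s w v - Phi s w v)%R)%E.
pose y n := (\int[Pr]_w (`|Y w - elementary_int W (L n) w| ^+ 2)%:E)%E.
have mev (f : step) : admissible_step F T f -> measurable (ev f).
  move=> [l0 lh hT FA]; apply: (filtration_sub F_basis _ FA).
  by rewrite l0 (le_trans lh).
have mstep (f : step) : admissible_step F T f -> measurable_fun setT (step_int W f).
  move=> af; have [l0 lh hT FA] := af; apply: measurable_funM.
    exact: (measurable_indic (mev _ af)).
  exact: (measurable_incr F_basis W_wiener).
(* For fixed n the error is bounded by the two quantities that [is_ito_integral] sends to 0. The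
   constants come from two uses of |x + y|^2 <= 2 |x|^2 + 2 |y|^2, and the limit in n leaves 4 T
   C. *)
suff key n : (\int[Pr]_w ((inner u (Y w) - \sum_k c k * step_int W (e k) w) ^+ 2)%:E <=
    (2 * cu)%:E * y n + (4 * cu)%:E * h n + (4 * T * C)%:E)%E.
  have lim : ((2 * cu)%:E * y n + (4 * cu)%:E * h n + (4 * T * C)%:E)%E @[n --> \oo] -->
      (4 * T * C)%:E.
    rewrite -[X in _ --> X]add0e; apply: cvgeD => //; last exact: cvg_cst.
    rewrite -[X in _ --> X]add0e; apply: cvgeD => //.
      by rewrite -[X in _ --> X](mule0 (2 * cu)%:E); apply: cvgeZl.
    by rewrite -[X in _ --> X](mule0 (4 * cu)%:E); apply: cvgeZl.
  by apply: (cvge_ge _ lim); apply: nearW => n; exact: key.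
pose I := 'I_(size (L n)); pose f (i : I) : step := tnth (in_tuple (L n)) i.
have fadm i : admissible_step F T (f i) 
  by apply: (Ladm n i); exact: (iffLR (tnth_onth _ (in_tuple (L n)) i) erefl).
pose cL i := inner u (vout (f i)).
pose X w := \sum_i cL i * step_int W (f i) w.
have mX : measurable_fun setT X.
  by apply: measurable_sum => i; apply: measurable_funM => //; exact: mstep.
pose Z w := \sum_k c k * step_int W (e k) w.
have mZ : measurable_fun setT Z.
  by apply: measurable_sum => i; apply: measurable_funM => //; exact: mstep.
have XE w : inner u (elementary_int W (L n) w) = X w.
  rewrite /elementary_int inner_sumr big_tnth; apply: eq_bigr => i _.
  by rewrite innerZr mulrC.
pose aG i := step_time (cL i) (f i).
pose G s w := rfield aG (fun i => ev (f i)) (fun i => vin (f i)) s w.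
(* G is the adjoint of the elementary integrand applied to u. *)
have GE s w b : inner u (elementary_val (L n) s w b) = inner b (G s w).
  rewrite /elementary_val /G /rfield !inner_sumr big_tnth; apply: eq_bigr => i _.
  by rewrite !innerZr /aG /step_time /cL -/(f i) (innerC b); ring.
pose Psi s := \sum_j a j s *: v j.
(* G - Psi, and G minus the step function, as fields over a sum type. *)
pose a1 := sum_rect (fun _ : I + J => R -> R) aG (fun j s => - a j s).
pose A1 := sum_rect (fun _ : I + J => set Omega) (fun i => ev (f i)) (fun j => setT).
pose v1 := sum_rect (fun _ : I + J => H) (fun i => vin (f i)) v.
have D1 s w : rfield a1 A1 v1 s w = G s w - Psi s.
  rewrite rfield_split; congr (_ + _); rewrite /rfield /Psi -sumrN.
  by apply: eq_bigr => j _; rewrite indicT mulr1 scaleNr.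
pose c2 := sum_rect (fun _ : I + K => R) cL (fun k => - c k).
pose e2 := sum_rect (fun _ : I + K => step) f e.
have e2adm i : admissible_step F T (e2 i) by case: i => i /=.
have D2 s w : rfield (fun i => step_time (c2 i) (e2 i)) (fun i => ev (e2 i)) (fun i => vin (e2 i)) s w =
    G s w - \sum_k step_time (c k) (e k) s *: vin (e k).
  rewrite /rfield big_sumType /=; congr (_ + _); rewrite -sumrN.
  by apply: eq_bigr => k _; rewrite evT indicT mulr1 /step_time mulNr scaleNr.
have XZ w : X w - Z w = \sum_i c2 i * step_int W (e2 i) w.
  rewrite big_sumType /=; congr (_ + _); rewrite -sumrN.
  by apply: eq_bigr => k _; rewrite mulNr.
have ma1 i : measurable_fun setT (a1 i).
  case: i => i /=; first exact: measurable_step_time.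
  by apply: measurable_funN; exact: ma.
have mA1 i : measurable (A1 i) by case: i => i //=; exact: mev.
have ma2 i : measurable_fun setT (step_time (c2 i) (e2 i)) by exact: measurable_step_time.
have mA2 i : measurable (ev (e2 i)) by exact: mev.
have [m1s m1w] := integral_rfield_sqr v1 ma1 mA1.
have [m2s m2w] := integral_rfield_sqr (fun i => vin (e2 i)) ma2 mA2.
pose g1 w := (\int[leb]_(s in `]0%R, T[) (`|rfield a1 A1 v1 s w| ^+ 2)%:E)%E.
have g10 w : (0 <= g1 w)%E by apply: integral_ge0 => s _; rewrite lee_fin sqr_ge0.
have m1sD w : measurable_fun `]0, T[ (fun s => (`|rfield a1 A1 v1 s w| ^+ 2)%:E).
  exact: measurable_funTS.
(* By [hs_sqnorm_ge], |G - Psi|^2 / cu is at most the squared Hilbert-Schmidt norm of the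
   approximation error, pointwise on ]0, T[. *)
have bound_h : (\int[Pr]_w g1 w <= cu%:E * h n)%E.
  rewrite -lee_pdivrMl// -ge0_integralZl_EFin ?invr_ge0 ?(ltW cu0)//.
  apply: le_integral_patch => //.
  - by move=> w _; rewrite mule_ge0// lee_fin invr_ge0 ltW.
  - move=> w _; apply: integral_ge0 => s _; apply: esum_ge0 => b _.
    by rewrite lee_fin sqr_ge0.
  move=> w _; rewrite -ge0_integralZl_EFin ?invr_ge0 ?(ltW cu0)//.
  apply: le_integral_patch.
  - by move=> s _; rewrite -EFinM lee_fin mulr_ge0 ?sqr_ge0// invr_ge0 ltW.
  - by move=> s _; apply: esum_ge0 => b _; rewrite lee_fin sqr_ge0.
  - by move=> s /=; rewrite !in_itv /= => /andP[/ltW -> /ltW ->].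
  move=> s /=; rewrite in_itv /= => sT; rewrite D1 -EFinM mulrC.
  apply: (hs_sqnorm_ge HB_basis) => b Hb.
  by rewrite innerBr -GE -(PhiE s w b sT Hb) innerBr.
  exact: m1sD.
have C0 : 0 <= C.
  have TT : 0 < T / 2 < T by apply/andP; split; move: T_gt0; lra.
  exact: le_trans (sqr_ge0 _) (CP _ TT).
(* X - Z is itself an elementary integral, so its second moment is the squared norm of G minus the
   step function; Psi is then inserted between the two. *)
have bound_G : (\int[Pr]_w ((X w - Z w) ^+ 2)%:E <= (2 * cu)%:E * h n + (2 * T * C)%:E)%E.
  under eq_integral do rewrite XZ.
  rewrite (ito_isometry F_basis W_wiener c2 e2adm) -(field_isometry F_basis c2 e2adm).
  apply: (@le_trans _ _ (\int[Pr]_w (2%:E * g1 w + (2 * T * C)%:E))%E).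
    apply: ge0_le_integral => //.
    - by move=> w _; apply: integral_ge0 => s _; rewrite lee_fin sqr_ge0.
    - by apply: emeasurable_funD => //; exact: emeasurable_funM.
    move=> w _.
    apply: (@le_trans _ _ (\int[leb]_(s in `]0%R, T[)
        (2%:E * (`|rfield a1 A1 v1 s w| ^+ 2)%:E + (2 * C)%:E))%E).
      apply: ge0_le_integral => //.
      - by apply: measurable_funTS; exact: m2s.
      - by apply: emeasurable_funD => //; apply: emeasurable_funM => //; exact: m1sD.
      move=> s /=; rewrite in_itv /= => sT; rewrite D1 D2 -EFinM -EFinD lee_fin.
      set S := \sum_k _; have CS := CP s sT; rewrite -/(Psi s) -/S in CS.
      rewrite -(subrK (Psi s) (G s w)) addrK -addrA.
      apply: le_trans (lerD (lexx _) (ler_wpM2l _ CS)) => //.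
      rewrite norm_sqrD -subr_ge0.
      have := sqr_ge0 `|(G s w - Psi s) - (Psi s - S)|; rewrite norm_sqrB; nra.
    rewrite ge0_integralD//.
    - rewrite integral_cst//= lebesgue_measure_itv/= lte_fin T_gt0 sube0 -EFinM.
      rewrite ge0_integralZl_EFin//; last exact: m1sD.
      by rewrite (mulrAC 2 C).
    - by apply: emeasurable_funM => //; exact: m1sD.
    - by move=> s _; rewrite lee_fin mulr_ge0.
  rewrite ge0_integralD//.
  - rewrite integral_cst// [X in (_ * X)%E]probability_setT mule1 leeD2r//.
    by rewrite ge0_integralZl_EFin// EFinM -muleA lee_wpmul2l.
  - by move=> w _; rewrite mule_ge0.
  - exact: emeasurable_funM.
  - by move=> w _; rewrite lee_fin !mulr_ge0// ltW.
have bound_y : (\int[Pr]_w ((inner u (Y w) - X w) ^+ 2)%:E <= cu%:E * y n)%E.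
  rewrite -lee_pdivrMl// -ge0_integralZl_EFin ?invr_ge0 ?(ltW cu0)//.
  - apply: le_integral_patch => //.
    + by move=> w _; rewrite -EFinM lee_fin mulr_ge0 ?sqr_ge0// invr_ge0 ltW.
    move=> w _; rewrite -EFinM lee_fin ler_pdivrMl// -XE -innerBr.
    rewrite -[leLHS]real_normK ?num_real//.
    rewrite (@le_trans _ _ ((`|u| * `|Y w - elementary_int W (L n) w|) ^+ 2))//.
      by rewrite lerXn2r ?nnegrE ?mulr_ge0// CauchySchwarz_inner.
    by rewrite exprMn ler_wpM2r ?sqr_ge0// lerDl.
  - by move=> w _; rewrite lee_fin sqr_ge0.
  - by apply/measurable_EFinP; apply: measurable_funX; exact: measurable_funB.
(* The elementary integral X is inserted between <u, Y> and the deterministic sum Z. *)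
apply: (@le_trans _ _ (\int[Pr]_w (2%:E * ((inner u (Y w) - X w) ^+ 2)%:E +
   2%:E * ((X w - Z w) ^+ 2)%:E))%E).
  apply: ge0_le_integral => //.
  - by move=> w _; rewrite lee_fin sqr_ge0.
  - by apply/measurable_EFinP; apply: measurable_funX; exact: measurable_funB.
  - apply: emeasurable_funD; apply: emeasurable_funM => //; apply/measurable_EFinP;
    apply: measurable_funX; exact: measurable_funB.
  - move=> w _; rewrite -!EFinM -EFinD lee_fin -/(Z w).
    by have := sqr_ge0 ((inner u (Y w) - X w) - (X w - Z w)); nra.
have my : measurable_fun setT (fun w => ((inner u (Y w) - X w) ^+ 2)%:E).
  by apply/measurable_EFinP; apply: measurable_funX; exact: measurable_funB.
have mXZ : measurable_fun setT (fun w => ((X w - Z w) ^+ 2)%:E).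
  by apply/measurable_EFinP; apply: measurable_funX; exact: measurable_funB.
rewrite ge0_integralD//.
- rewrite !ge0_integralZl_EFin//; do ?by move=> w _; rewrite lee_fin sqr_ge0.
  apply: le_trans (leeD (lee_wpmul2l _ bound_y) (lee_wpmul2l _ bound_G)) _ => //.
  have h0 : (0 <= h n)%E.
    apply: integral_ge0 => w _; apply: integral_ge0 => s _; apply: esum_ge0 => b _.
    by rewrite lee_fin sqr_ge0.
  move: (h n) h0 (y n) => hn h0 yn.
  rewrite [X in (_ + X)%E]muleDr ?ge0_adde_def ?inE ?mule_ge0 ?lee_fin ?mulr_ge0 ?(ltW cu0) ?(ltW T_gt0)//.
  by rewrite !muleA -!EFinM addeA !mulrA -natrM.
- by move=> w _; rewrite -EFinM lee_fin mulr_ge0// sqr_ge0.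
- exact: emeasurable_funM.
- by move=> w _; rewrite -EFinM lee_fin mulr_ge0// sqr_ge0.
- exact: emeasurable_funM.
Qed.

End ItoApproximation.

(** * Characteristic functions of Wiener sums and of Ito integrals *)

Lemma cos_lipschitz {R : realType} (x y : R) : `|cos x - cos y| <= `|x - y|.
Proof.
wlog xy : x y / y <= x => [h|].
  by have [/h//|/ltW/h] := leP y x; rewrite distrC (distrC y).
have [|c _ ->] := @MVT_segment R cos (fun x => - sin x) y x xy.
  by apply: continuous_subspaceT; exact: continuous_cos.
rewrite normrM normrN -[leRHS]mul1r ler_wpM2r//.
by rewrite ler_norml sin_geN1 sin_le1.
Qed.

Lemma measurable_cos {R : realType} : measurable_fun setT (@cos R).
Proof. by apply: continuous_measurable_fun; exact: continuous_cos. Qed.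

Lemma measurable_sin {R : realType} : measurable_fun setT (@sin R).
Proof. by apply: continuous_measurable_fun; exact: continuous_sin. Qed.

Section CosineExpectation.
Context {d} {T : measurableType d} {R : realType} (P : probability T R).
Implicit Types X Y : T -> R.

Lemma integrable_cos X : measurable_fun setT X ->
  P.-integrable setT (EFin \o (cos \o X)).
Proof.
move=> mX; apply: (@bounded_integrable _ _ _ _ _ 1) => [|w].
  by apply: measurableT_comp mX; exact: measurable_cos.
by rewrite ler_norml cos_geN1 cos_le1.
Qed.

Lemma integrable_sin X : measurable_fun setT X ->
  P.-integrable setT (EFin \o (sin \o X)).
Proof.
move=> mX; apply: (@bounded_integrable _ _ _ _ _ 1) => [|w].
  by apply: measurableT_comp mX; exact: measurable_sin.
by rewrite ler_norml sin_geN1 sin_le1.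
Qed.

(* AM-GM: [|X - Y| <= (e + (X - Y)^2 / e) / 2] *)
Lemma cos_expectation_dist X Y (e C : R) :
  measurable_fun setT X -> measurable_fun setT Y -> 0 < e ->
  (\int[P]_w ((X w - Y w) ^+ 2)%:E <= C%:E)%E ->
  `|\int[P]_w cos (X w) - \int[P]_w cos (Y w)| <= (e + C / e) / 2.
Proof.
move=> mX mY e0 XYC.
have iX := integrable_cos mX; have iY := integrable_cos mY.
have mXY : measurable_fun setT (fun w => (X w - Y w) ^+ 2).
  by apply: measurable_funX; exact: measurable_funB.
have iXY : P.-integrable setT (EFin \o (fun w => (X w - Y w) ^+ 2)).
  apply/integrableP; split; first exact/measurable_EFinP.
  under eq_integral do rewrite /= ger0_norm ?sqr_ge0//.
  by rewrite (le_lt_trans XYC)// ltry.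
rewrite -RintegralB//.
have iB : P.-integrable setT (EFin \o (fun w => cos (X w) - cos (Y w))).
  exact: (integrableB measurableT iX iY).
apply: le_trans (le_normr_Rintegral _ _) _ => //.
have i2 : P.-integrable setT (EFin \o (fun w => (2 * e)^-1 * (X w - Y w) ^+ 2)).
  exact: (integrableZl measurableT _ iXY).
have i1 : P.-integrable setT (EFin \o cst (e / 2)) by exact: finite_measure_integrable_cst.
have i3 : P.-integrable setT (EFin \o (fun w => e / 2 + (2 * e)^-1 * (X w - Y w) ^+ 2)).
  exact: (integrableD measurableT i1 i2).
apply: (@le_trans _ _ (\int[P]_w (e / 2 + (2 * e)^-1 * (X w - Y w) ^+ 2))).
  apply: le_Rintegral => //; first exact: (integrable_norm iB).
  move=> w _; apply: le_trans (cos_lipschitz _ _) _.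
  rewrite (_ : e / 2 + _ = (e ^+ 2 + (X w - Y w) ^+ 2) / (2 * e)); last first.
    by field; rewrite gt_eqF.
  rewrite ler_pdivlMr ?mulr_gt0//.
  have := sqr_ge0 (`|X w - Y w| - e); rewrite -[X in _ -> _ <= _ + X]real_normK ?num_real//.
  set a := `|_|; nra.
rewrite RintegralD// Rintegral_cst// [X in fine X]probability_setT mulr1 RintegralZl//.
rewrite [leRHS]mulrDl lerD2l invfM (mulrC C) -mulrA [leRHS]mulrC ler_wpM2l ?invr_ge0//.
rewrite ler_wpM2l ?invr_ge0 ?(ltW e0)// /Rintegral -lee_fin fineK//.
exact: integrable_fin_num iXY.
Qed.

End CosineExpectation.

Section WienerSums.
Context {d} {Omega : measurableType d} {R : realType} (Pr : probability Omega R).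
Variables (T : R) (F : R -> set (set Omega)).
Hypothesis F_basis : stochastic_basis Pr T F.
Context {H : hilbertType R}.
Variable W : R -> H -> Omega -> R.
Hypothesis W_wiener : cylindrical_wiener Pr T F W.

(** Induction with cos (S + D) = cos S cos D - sin S sin D: the past S is independent of the new
    increment D, and E sin D = 0 because sin is odd. *)
Lemma Rintegral_cos_sum_incr (t : nat -> R) (u : nat -> H) (n : nat) :
  0 <= t 0%N -> (forall i, t i <= t i.+1) -> t n <= T ->
  \int[Pr]_w cos (\sum_(i < n) incr W (t i) (t i.+1) (u i) w) =
  expR (- (\sum_(i < n) (t i.+1 - t i) * `|u i| ^+ 2) / 2).
Proof.
move=> t0 tS; have tle i j : (i <= j)%N -> t i <= t j.
  by apply: (homo_leq (r := fun x y : R => x <= y)) => // ? ? ?; exact: le_trans.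
have ti i : 0 <= t i by exact: le_trans t0 (tle _ _ (leq0n _)).
elim: n => [_|n IH tnT].
  under eq_Rintegral do rewrite big_ord0 cos0.
  by rewrite big_ord0 Rintegral_cst// [X in fine X]probability_setT oppr0 mul0r expR0 mulr1.
have {}IH := IH (le_trans (tS n) tnT).
pose S w := \sum_(i < n) incr W (t i) (t i.+1) (u i) w.
have mS : measurable_fun [set: g_sigma_algebraType (F (t n))] S.
  apply: measurable_sum => i.
  apply: (FT_measurable_incr F_basis W_wiener) => //; first exact: tle.
  exact: le_trans (tS n) tnT.
have tnT' : 0 <= t n <= T by rewrite ti (le_trans (tS n)).
have mS' := FT_measurable_fun F_basis tnT' mS.
have mi := measurable_incr F_basis W_wiener (u n) (ti n) (tS n) tnT.
have mcS : measurable_fun [set: g_sigma_algebraType (F (t n))] (cos \o S).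
  by apply: (measurableT_comp measurable_cos).
have msS : measurable_fun [set: g_sigma_algebraType (F (t n))] (sin \o S).
  by apply: (measurableT_comp measurable_sin).
have [ic Ec] := RintegralM_incr F_basis W_wiener (ti n) (tS n) tnT mcS measurable_cos
  (integrable_cos Pr mS') (integrable_cos Pr mi).
have [is_ Es] := RintegralM_incr F_basis W_wiener (ti n) (tS n) tnT msS measurable_sin
  (integrable_sin Pr mS') (integrable_sin Pr mi).
under eq_Rintegral do rewrite big_ord_recr /= cosD.
rewrite RintegralB// Ec Es (Rintegral_odd_incr (g := sin) F_basis W_wiener)//; last 3 first.
- exact: measurable_sin.
- exact: sinN.
- exact: integrable_sin.
rewrite mulr0 subr0 IH (Rintegral_cos_incr F_basis W_wiener)// -expRD.
by rewrite big_ord_recr /=; congr expR; lra.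
Qed.

End WienerSums.

(* Each term of the Riemann sum is compared with the increment of
   [expR (- r (T - t)) / r] over the same interval. *)
Lemma riemann_exp_bounds {R : realType} (r T : R) (m : nat) : 0 < r -> 0 < T ->
  let t (i : nat) := i%:R * (T / m.+1%:R) in
  let S := \sum_(i < m.+1) (t i.+1 - t i) * expR (- (r * (T - t i.+1))) in
  let q := (1 - expR (- (r * T))) / r in
  q <= S <= q * (1 + r * T * m.+1%:R^-1).
Proof.
move=> r0 T0; pose t (i : nat) := i%:R * (T / m.+1%:R).
pose S := \sum_(i < m.+1) (t i.+1 - t i) * expR (- (r * (T - t i.+1))).
pose q := (1 - expR (- (r * T))) / r.
rewrite -[is_true _]/(is_true (q <= S <= q * (1 + r * T * m.+1%:R^-1))).
have m0 : 0 < m.+1%:R :> R by rewrite ltr0n.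
pose D := T / m.+1%:R; have D0 : 0 < D by rewrite divr_gt0.
have tD i : t i.+1 - t i = D by rewrite /t -/D -natr1; ring.
pose G (i : nat) := expR (- (r * (T - t i))) / r.
have z0 : 0 <= r * D by rewrite mulr_ge0 ?ltW.
(* With the mesh D, y = 1 - exp (- r D) lies between r D / (1 + r D) and r D; the lower bound is the
   source of the factor 1 + r T / (m + 1). *)
have := expRN_bounds z0; set y := 1 - _ => /andP[y1 y2].
have GE i : G i.+1 - G i = expR (- (r * (T - t i.+1))) * (y / r).
  rewrite /G -mulrBl mulrA; congr (_ / _).
  rewrite [RHS]mulrBr mulr1 -expRD; congr (_ - expR _).
  by rewrite -(tD i); ring.
have qE : q = \sum_(i < m.+1) (G i.+1 - G i).
  rewrite -(big_mkord xpredT (fun i => G i.+1 - G i)) telescope_sumr// /q /G /t mul0r.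
  by rewrite subr0 (mulrC m.+1%:R) divfK ?gt_eqF// subrr mulr0 oppr0 expR0 -mulrBl.
rewrite qE; apply/andP; split.
  apply: ler_sum => i _; rewrite GE tD mulrC ler_wpM2r ?expR_ge0//.
  by rewrite ler_pdivrMr// mulrC.
rewrite mulr_suml; apply: ler_sum => i _; rewrite GE tD (mulrC D) -[leRHS]mulrA.
rewrite ler_wpM2l ?expR_ge0//.
have -> : r * T * m.+1%:R^-1 = r * D by rewrite /D mulrA.
rewrite mulrAC ler_pdivlMr// mulrC; move: y1; rewrite ler_pdivrMr//.
by rewrite ltr_pwDl.
Qed.

Lemma norm_sum_orthonormal {R : realType} {H : hilbertType R} (J : finType)
    (v : J -> H) (c : J -> R) :
  (forall i j, inner (v i) (v j) = (i == j)%:R) ->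
  `|\sum_j c j *: v j| ^+ 2 = \sum_j c j ^+ 2.
Proof.
move=> vv; rewrite -inner_normE inner_suml; apply: eq_bigr => i _.
rewrite innerZl inner_sumr (bigD1 i)//= innerZr vv eqxx mulr1 big1 ?addr0 ?expr2//.
by move=> j ji; rewrite innerZr vv eq_sym (negbTE ji) mulr0.
Qed.

Section ItoCharacteristic.
Context {d} {Omega : measurableType d} {R : realType} (Pr : probability Omega R).
Variables (T : R) (F : R -> set (set Omega)).
Hypothesis T_gt0 : 0 < T.
Hypothesis F_basis : stochastic_basis Pr T F.
Context {H : hilbertType R}.
Variable W : R -> H -> Omega -> R.
Hypothesis W_wiener : cylindrical_wiener Pr T F W.
Variable HB : set H.
Hypothesis HB_basis : orthonormal_basis HB.
Variables (Phi : R -> Omega -> H -> H) (Y : Omega -> H).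
Hypothesis mY : forall u, measurable_fun setT (fun w => inner u (Y w)).
Hypothesis Y_ito : is_ito_integral Pr F HB W T Phi Y.

(** On a mesh of T / (m + 1), the step function with values at right endpoints is uniformly within O
    (1 / m) of the adjoint integrand. Its Wiener sum has an explicit characteristic function, with a
    Riemann sum in the exponent. *)
Lemma ito_char (J : finType) (v : J -> H) (c r : J -> R) (u : H) :
  (forall i j, inner (v i) (v j) = (i == j)%:R) -> (forall j, 0 < r j) ->
  (forall s w b, 0 < s < T -> HB b ->
     inner u (Phi s w b) = inner b (\sum_j (c j * expR (- (r j * (T - s)))) *: v j)) ->
  \int[Pr]_w cos (inner u (Y w)) =
  expR (- (\sum_j c j ^+ 2 * ((1 - expR (- (2 * r j * T))) / (2 * r j))) / 2).
Proof.
move=> vv r0 PhiE.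
pose t m (i : nat) : R := i%:R * (T / m.+1%:R).
have D0 m : 0 < T / m.+1%:R by rewrite divr_gt0// ltr0n.
have tD m i : t m i.+1 - t m i = T / m.+1%:R by rewrite /t -natr1; ring.
have tS m i : t m i <= t m i.+1 by rewrite -subr_ge0 tD ltW.
have t0 m : t m 0%N = 0 by rewrite /t mul0r.
have tT m : t m m.+1 = T by rewrite /t mulrC divfK ?pnatr_eq0.
have tle m i j : (i <= j)%N -> t m i <= t m j.
  by move=> ij; rewrite ler_wpM2r ?(ltW (D0 m))// ler_nat.
pose a j s := c j * expR (- (r j * (T - s))).
pose U m i : H := \sum_j a j (t m i.+1) *: v j.
(* Only [vin] enters the scalar sums: the event is the sure one, and [vout] is filled with 0. *)
pose e m (i : 'I_m.+1) : @rank_one_step d Omega R H :=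
  RankOneStep (t m i) (t m i.+1) setT (U m i) 0.
have ge0 m i : 0 <= t m i by rewrite -(t0 m); exact: tle.
have leT m (i : 'I_m.+1) : t m i.+1 <= T by rewrite -(tT m); exact: tle.
have adm m i : admissible_step F T (e m i).
  split=> //=.
  have tiT : 0 <= t m i <= T by rewrite ge0 (le_trans (tS m i)).
  apply/(FT_measurable F_basis _ tiT).
  exact: (@measurableT _ (g_sigma_algebraType (F (t m i)))).
pose Z m w := \sum_(i < m.+1) incr W (t m i) (t m i.+1) (U m i) w.
have mZ m : measurable_fun setT (Z m).
  by apply: measurable_sum => i; apply: (measurable_incr F_basis W_wiener).
have ma j : measurable_fun setT (a j).
  apply: measurable_funM => //; apply: measurableT_comp => //.
  by apply: measurableT_comp => //; apply: measurable_funM => //; apply: measurable_funB.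
have EZ m : \int[Pr]_w cos (Z m w) =
    expR (- (\sum_(i < m.+1) (t m i.+1 - t m i) * `|U m i| ^+ 2) / 2).
  by rewrite -(Rintegral_cos_sum_incr F_basis W_wiener)// ?t0// tT.
pose q j := (1 - expR (- (2 * r j * T))) / (2 * r j).
pose Q := \sum_j c j ^+ 2 * q j.
pose K := \sum_j (c j * (r j * T)) ^+ 2.
have a_lip j s s' : 0 <= s -> s <= s' -> s' <= T -> `|a j s' - a j s| <= `|c j| * (r j * (s' - s)).
  move=> s0 ss' s'T; rewrite /a -mulrBr normrM ler_wpM2l//.
  have z0 : 0 <= r j * (s' - s) by rewrite mulr_ge0 ?subr_ge0// ltW.
  have /andP[_ h] := expRN_bounds z0.
  have -> : expR (- (r j * (T - s))) = expR (- (r j * (T - s'))) * expR (- (r j * (s' - s))).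
    by rewrite -expRD; congr expR; ring.
  rewrite -[X in `|X - _|]mulr1 -mulrBr normrM ger0_norm ?expR_ge0// ger0_norm; last first.
    by rewrite subr_ge0 expR_le1 oppr_le0.
  rewrite -[leRHS]mul1r ler_pM ?expR_ge0//; last first.
    by rewrite expR_le1 oppr_le0 mulr_ge0 ?subr_ge0// ltW.
  by rewrite subr_ge0 expR_le1 oppr_le0.
have PsiC m s : 0 < s < T -> `|\sum_j a j s *: v j -
    \sum_k step_time 1 (e m k) s *: vin (e m k)| ^+ 2 <= K * m.+1%:R^-1 ^+ 2.
  move=> /andP[s0 sT].
  (* The least i with s <= t_(i+1) is the index of the subinterval ]t_i, t_(i+1)] that contains
     s. *)
  have ex : exists i, s <= t m i.+1 by exists m; rewrite tT ltW.
  case: (ex_minnP ex) => i0 si0 i0min.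
  have i0m : (i0 < m.+1)%N by rewrite ltnS i0min// tT ltW.
  have ti0 : t m i0 < s.
    case: i0 si0 i0min {i0m} => [|i0] _ h; first by rewrite t0.
    by rewrite ltNge; apply/negP => /h; rewrite ltnn.
  have -> : \sum_k step_time 1 (e m k) s *: vin (e m k) = U m i0.
    rewrite (bigD1 (Ordinal i0m))//= {1}/step_time/= mul1r indicE mem_set/= ?in_itv/= ?ti0//.
    rewrite scale1r big1 ?addr0// => k ki0.
    rewrite /step_time/= mul1r indicE (_ : (s \in _) = false) ?scale0r//.
    apply/negbTE/negP; rewrite inE/= in_itv /= => /andP[h1 h2].
    have [lt|gt|E] := ltngtP k i0.
    - have := lt_le_trans ti0 (le_trans h2 (tle m _ _ lt)); by rewrite ltxx.
    - have := lt_le_trans h1 (le_trans si0 (tle m _ _ gt)); by rewrite ltxx.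
    - by move/eqP: ki0; apply; apply/val_inj.
  rewrite /U -sumrB.
  under eq_bigr do rewrite -scalerBl.
  rewrite norm_sum_orthonormal// mulr_suml; apply: ler_sum => j _.
  rewrite -exprMn -[leLHS]real_normK ?num_real// -[leRHS]real_normK ?num_real//.
  rewrite lerXn2r ?nnegrE// distrC.
  have i0T : t m i0.+1 <= T by rewrite -(tT m); exact: tle.
  apply: le_trans (a_lip j s (t m i0.+1) (ltW s0) si0 i0T) _.
  rewrite !normrM -!mulrA ler_wpM2l// (gtr0_norm (r0 j)) ler_wpM2l ?(ltW (r0 j))//.
  by rewrite (gtr0_norm T_gt0) ger0_norm ?invr_ge0// -(tD m i0) lerB// ltW.
(* The mean square error is at most 4 T K / (m + 1)^2, so the choice e = 1 / (m + 1) makes both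
   terms of [cos_expectation_dist] of order 1 / (m + 1). *)
have bound m : `|\int[Pr]_w cos (inner u (Y w)) - \int[Pr]_w cos (Z m w)| <=
     (1 + 4 * T * K) / 2 * m.+1%:R^-1.
  have C0 : (\int[Pr]_w ((inner u (Y w) - Z m w) ^+ 2)%:E <=
      (4 * T * (K * m.+1%:R^-1 ^+ 2))%:E)%E.
    have := ito_approx T_gt0 F_basis W_wiener HB_basis mY Y_ito ma PhiE (adm m)
      (fun _ => erefl) (PsiC m).
    congr (_ <= _)%E; apply: eq_integral => w _; congr (((_ - _) ^+ 2)%:E).
    by apply: eq_bigr => k _; rewrite mul1r /step_int/= indicT mul1r.
  have m0 : 0 < m.+1%:R^-1 :> R by rewrite invr_gt0.
  apply: le_trans (cos_expectation_dist (mY u) (mZ m) m0 C0) _.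
  rewrite le_eqVlt; apply/orP; left; apply/eqP; field.
  by rewrite nat1r pnatr_eq0.
have limZ : \int[Pr]_w cos (Z m w) @[m --> \oo] --> expR (- Q / 2).
  under eq_fun do rewrite EZ; apply: cvg_comp; last exact: continuous_expR.
  apply: cvgM; last exact: cvg_cst.
  apply: cvgN.
  (* Orthonormality splits |U|^2 into one Riemann sum of exp (- 2 r_j (T - s)) for each j. *)
  pose Sm m j := \sum_(i < m.+1) (t m i.+1 - t m i) * expR (- (2 * r j * (T - t m i.+1))).
  have -> : (fun m => \sum_(i < m.+1) (t m i.+1 - t m i) * `|U m i| ^+ 2) =
      (fun m => \sum_j c j ^+ 2 * Sm m j).
    apply/funext => m; under eq_bigr do rewrite norm_sum_orthonormal// mulr_sumr.
    rewrite exchange_big; apply: eq_bigr => j _ /=; rewrite mulr_sumr.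
    apply: eq_bigr => i _; rewrite /a exprMn mulrCA; congr (_ * (_ * _)).
    by rewrite expr2 -expRD; congr expR; ring.
  apply: cvg_big => [|j _]; first exact: add_continuous.
  apply: cvgM; first exact: cvg_cst.
  have r20 : 0 < 2 * r j by rewrite mulr_gt0.
  apply: (@squeeze_cvgr _ _ _ _ (fun=> q j) (fun m => q j * (1 + 2 * r j * T * m.+1%:R^-1))).
  - by apply: nearW => m; exact: riemann_exp_bounds.
  - exact: cvg_cst.
  rewrite -[X in _ --> X]mulr1; apply: cvgM; first exact: cvg_cst.
  rewrite -[X in _ --> X]addr0; apply: cvgD; first exact: cvg_cst.
  rewrite -(mulr0 (2 * r j * T)); apply: cvgM; first exact: cvg_cst.
  exact: cvg_harmonic.
have limZ' : \int[Pr]_w cos (Z m w) @[m --> \oo] --> \int[Pr]_w cos (inner u (Y w)).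
  apply/cvgrPdist_le => eps eps0.
  have : (1 + 4 * T * K) / 2 * m.+1%:R^-1 @[m --> \oo] --> (0 : R).
    rewrite -(mulr0 ((1 + 4 * T * K) / 2)); apply: cvgM; first exact: cvg_cst.
    exact: cvg_harmonic.
  move=> /cvgr0_norm_le /(_ eps eps0); apply: filterS => m; apply: le_trans.
  exact: le_trans (bound m) (ler_norm _).
exact: cvg_unique limZ' limZ.
Qed.

End ItoCharacteristic.

(** * Gaussian integrals of quadratic exponentials *)

Lemma Rintegral_fubini_bounded {d1 d2} {T1 : measurableType d1} {T2 : measurableType d2}
    {R : realType} (P1 : probability T1 R) (P2 : probability T2 R) (f : T1 * T2 -> R) (c : R) :
  measurable_fun setT f -> (forall z, `|f z| <= c) ->
  \int[P1]_x (\int[P2]_y f (x, y)) = \int[P2]_y (\int[P1]_x f (x, y)).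
Proof.
move=> mf fc; have fi : (P1 \x P2)%E.-integrable setT (EFin \o f).
  exact: (@bounded_integrable _ _ _ (P1 \x P2)%E _ c).
have f1 x : P2.-integrable setT (EFin \o (fun y => f (x, y))).
  by apply: (@bounded_integrable _ _ _ P2 _ c) => //; exact: measurableT_comp.
have f2 y : P1.-integrable setT (EFin \o (fun x => f (x, y))).
  by apply: (@bounded_integrable _ _ _ P1 _ c) => //; exact: measurableT_comp.
rewrite /Rintegral; congr fine.
transitivity (\int[P1]_x \int[P2]_y (EFin \o f) (x, y))%E.
  by apply: eq_integral => x _; rewrite fineK//; exact: integrable_fin_num (f1 x).
rewrite (Fubini fi); apply: eq_integral => y _.
by rewrite fineK//; exact: integrable_fin_num (f2 y).
Qed.

Section GaussianFunctional.
Context {d} {T : measurableType d} {R : realType} (P : probability T R).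
Variables (Y : nat -> T -> R) (q : nat -> R) (n : nat).
Hypothesis mY : forall k, measurable_fun setT (Y k).
Hypothesis q_ge0 : forall k, 0 <= q k.
Hypothesis charY : forall th : nat -> R,
  \int[P]_w cos (\sum_(0 <= k < n) th k * Y k w) =
  expR (- (\sum_(0 <= k < n) th k ^+ 2 * q k) / 2).

(* One Gaussian factor [expR (- Y j ^ 2)] at a time is replaced by the average of
   [cos (sqrt 2 g Y j)] over a standard normal variable [g]. *)
Let partial_gauss (j : nat) : (j <= n)%N -> forall th : nat -> R,
  \int[P]_w (expR (- \sum_(0 <= k < j) Y k w ^+ 2) *
             cos (\sum_(j <= k < n) th k * Y k w)) =
  \prod_(0 <= k < j) (Num.sqrt (1 + 2 * q k))^-1 *
  expR (- (\sum_(j <= k < n) th k ^+ 2 * q k) / 2).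
Proof.
elim: j => [_ th|j IH jn th].
  under eq_Rintegral do rewrite big_nil oppr0 expR0 mul1r.
  by rewrite charY big_nil mul1r.
pose gam := normal_prob (0 : R) 1.
pose E w := expR (- \sum_(0 <= k < j) Y k w ^+ 2).
pose S w := \sum_(j.+1 <= k < n) th k * Y k w.
pose r := \sum_(j.+1 <= k < n) th k ^+ 2 * q k.
have mE : measurable_fun setT E.
  apply: measurableT_comp => //; apply: measurableT_comp => //.
  by apply: measurable_sum => k; exact: measurable_funX.
have mS : measurable_fun setT S.
  by apply: measurable_sum => k; exact: measurable_funM.
have E1 w : 0 <= E w <= 1.
  by rewrite expR_ge0 expR_le1 oppr_le0 sumr_ge0// => k _; exact: sqr_ge0.
pose f (z : T * R) := E z.1 * (cos (Num.sqrt 2 * Y j z.1 * z.2) * cos (S z.1)).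
have cos1 (x : R) : `|cos x| <= 1 by rewrite ler_norml cos_geN1 cos_le1.
have fle z : `|f z| <= 1.
  have /andP[e0 e1] := E1 z.1; rewrite !normrM (ger0_norm e0).
  by rewrite mulr_ile1 ?mulr_ge0// mulr_ile1.
have mf : measurable_fun setT f.
  apply: measurable_funM; first exact: measurableT_comp.
  apply: measurable_funM; apply: (measurableT_comp measurable_cos).
    apply: measurable_funM => //; apply: measurable_funM => //.
    exact: measurableT_comp.
  exact: measurableT_comp.
have cosE w : expR (- Y j w ^+ 2) = \int[gam]_g cos (Num.sqrt 2 * Y j w * g).
  rewrite integral_normal_cos//; congr expR.
  by rewrite exprMn sqr_sqrtr//; field.
(* The coefficient g is put into slot j, so that the induction hypothesis also covers Y j. *)
pose th' (g : R) k := if k == j then g else th k.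
have sum_th' g w : \sum_(j <= k < n) th' g k * Y k w = g * Y j w + S w.
  rewrite big_ltn// /th' eqxx; congr (_ + _); apply: eq_big_nat => k /andP[jk _].
  by rewrite gtn_eqF.
have sum_q g : \sum_(j <= k < n) th' g k ^+ 2 * q k = g ^+ 2 * q j + r.
  rewrite big_ltn// /th' eqxx; congr (_ + _); apply: eq_big_nat => k /andP[jk _].
  by rewrite gtn_eqF.
pose C := \prod_(0 <= k < j) (Num.sqrt (1 + 2 * q k))^-1.
(* For fixed g, the product of cosines is half the sum of cos (a Y_j + S) and cos (- a Y_j + S) with
   a = sqrt 2 g. The induction hypothesis gives both the same mean, as it depends on a^2 only. *)
have inner g : \int[P]_w f (w, g) = C * expR (- r / 2) * expR (- q j * g ^+ 2).
  have iE (h : T -> R) : measurable_fun setT h ->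
      P.-integrable setT (EFin \o (fun w => E w * cos (h w))).
    move=> mh; apply: (@bounded_integrable _ _ _ _ _ 1) => [|w].
      by apply: measurable_funM => //; exact: (measurableT_comp measurable_cos).
    have /andP[e0 e1] := E1 w; rewrite normrM (ger0_norm e0) mulr_ile1//.
  pose a := Num.sqrt 2 * g.
  transitivity (\int[P]_w (2^-1 * (E w * cos (a * Y j w + S w) + E w * cos (- a * Y j w + S w)))).
    apply: eq_Rintegral => w _; rewrite /f/= mulNr !cosD cosN sinN.
    rewrite (_ : Num.sqrt 2 * Y j w * g = a * Y j w); last by rewrite /a; ring.
    by field.
  have ip b : P.-integrable setT (EFin \o (fun w => E w * cos (b * Y j w + S w))).
    by apply: iE; apply: measurable_funD => //; exact: measurable_funM.
  rewrite RintegralZl//; last exact: (integrableD measurableT (ip a) (ip (- a))).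
  rewrite RintegralD//.
  have J b : \int[P]_w (E w * cos (b * Y j w + S w)) = C * expR (- (b ^+ 2 * q j + r) / 2).
    rewrite -(sum_q b) -IH ?(ltnW jn)//.
    by under [RHS]eq_Rintegral do rewrite sum_th'.
  rewrite !J sqrrN /a exprMn sqr_sqrtr// -mulrA -expRD.
  rewrite (_ : - (2 * g ^+ 2 * q j + r) / 2 = - r / 2 + - q j * g ^+ 2); last by field.
  by field.
transitivity (\int[P]_w \int[gam]_g f (w, g)).
  apply: eq_Rintegral => w _; rewrite big_nat_recr//= opprD expRD -mulrA -/(E w) cosE -/(S w).
  have ic : gam.-integrable setT (EFin \o (fun g => cos (Num.sqrt 2 * Y j w * g))).
    by apply: (integrable_cos gam); exact: measurable_funM.
  rewrite mulrA mulrAC -RintegralZl//.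
  by apply: eq_Rintegral => g _; rewrite /f/=; ring.
(* After the exchange, averaging exp (- q_j g^2) over g produces the new factor (1 + 2
   q_j)^(-1/2). *)
rewrite (@Rintegral_fubini_bounded _ _ _ _ _ _ _ _ 1)//.
under eq_Rintegral do rewrite inner.
rewrite RintegralZl//; last first.
  apply: (bounded_integrable_normal 1 (c := 1)) => [|x].
    by apply: measurableT_comp => //; apply: measurable_funM => //; exact: measurable_funX.
  by rewrite ger0_norm ?expR_ge0// expR_le1 mulNr oppr_le0 mulr_ge0 ?sqr_ge0.
rewrite /Rintegral integral_normal_expR_sqr//= expr1n mulr1 big_nat_recr//= -/C -/r.
by rewrite mulrAC.
Qed.

Lemma integral_gaussian_sqr :
  \int[P]_w expR (- \sum_(0 <= k < n) Y k w ^+ 2) =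
  \prod_(0 <= k < n) (Num.sqrt (1 + 2 * q k))^-1.
Proof.
have := partial_gauss (leqnn n) (fun=> 0).
rewrite [X in _ * expR (- X / 2)]big_geq// oppr0 mul0r expR0 mulr1 => <-.
by apply: eq_Rintegral => w _; rewrite [X in cos X]big_geq// cos0 mulr1.
Qed.

End GaussianFunctional.

(** * Unconditional sums *)

Section UnconditionalSums.
Context {R : realType} {V : normedModType R} {I : choiceType}.
Implicit Types (S : set I) (f : I -> V).

Lemma usums_to_unique S f (v v' : V) : usums_to S f v -> usums_to S f v' -> v = v'.
Proof.
move=> fv fv'; apply/eqP; rewrite -subr_eq0 -normr_eq0; apply/negP => /negP n0.
have e0 : 0 < `|v - v'| / 2 by rewrite divr_gt0// lt_def n0/=.
have [A fA hA] := fv _ e0; have [A' fA' hA'] := fv' _ e0.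
have fAA' : fsets S (A `|` A').
  move: fA fA' => [fA AS] [fA' A'S]; split; first by rewrite finite_setU.
  by move=> x [/AS|/A'S].
have h := hA _ fAA' (@subsetUl _ _ _); have h' := hA' _ fAA' (@subsetUr _ _ _).
rewrite distrC in h'; have := ler_normD (v - \sum_(i \in A `|` A') f i) (\sum_(i \in A `|` A') f i - v').
by rewrite addrA subrK => /le_lt_trans /(_ (ltrD h h')); rewrite -splitr ltxx.
Qed.

Lemma usum_eq S f (v : V) : usums_to S f v -> usum S f = v.
Proof. by move=> fv; apply: xget_unique => // v' fv'; exact: usums_to_unique fv' fv. Qed.

Lemma usums_to_series S f (v : V) (c : nat -> I) : set_bij setT S c ->
  usums_to S f v -> \sum_(0 <= k < M) f (c k) @[M --> \oo] --> v.
Proof.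
move=> [cS cinj csurj] fv; apply/cvgrPdist_lt => e e0; have [A [finA AS] hA] := fv e e0.
(* By the index M0 all elements of the finite set A have been enumerated. *)
have [M0 M0P] : exists M0, forall x, x \in finmap.enum_fset (fset_set A) -> 
    exists2 k, (k < M0)%N & c k = x.
  have : forall x, x \in finmap.enum_fset (fset_set A) -> S x.
    by move=> x; rewrite in_fset_set// inE => /AS.
  elim: (finmap.enum_fset _) => [|x s IHs] sS; first by exists 0%N.
  have [|M hM] := IHs; first by move=> y ys; apply: sS; rewrite inE ys orbT.
  have [k _ kx] : (c @` setT) x by apply: csurj; apply: sS; rewrite mem_head.
  exists (maxn M k.+1) => y; rewrite inE => /orP[/eqP ->|/hM[k' k'M <-]].
    by exists k; rewrite // leq_maxr.
  by exists k'; rewrite // leq_max k'M.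
exists M0 => // M /= M0M.
have inj : set_inj `I_M c by move=> x y _ _; apply: cinj; rewrite inE.
rewrite big_mkord (fsbig_ord _ M (fun k => f (c k))) -(fsbig_image _ _ f inj).
apply: hA.
  split; first exact: (finite_image _ (finite_II M)).
  by move=> _ [k _ <-]; exact: cS.
move=> x Ax; have [|k kM0 <-] := M0P x; first by rewrite in_fset_set// inE.
by exists k => //=; exact: leq_trans M0M.
Qed.

Lemma usums_to_single S f (i : I) : S i -> (forall j, S j -> j != i -> f j = 0) ->
  usums_to S f (f i).
Proof.
move=> Si f0 e e0; exists [set i].
  by split; [exact: finite_set1|move=> _ ->].
move=> B [finB BS] iB; rewrite (fsbigD1 i)//=; last exact: iB.
rewrite fsbig1 ?addr0 ?subrr ?normr0// => j [Bj ji].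
by apply: f0; [exact: BS|apply/eqP].
Qed.

End UnconditionalSums.

Lemma parseval_series {R : realType} {H : hilbertType R} (HB : set H) (c : nat -> H) (v : H) :
  orthonormal_basis HB -> set_bij setT HB c ->
  \sum_(0 <= k < M) inner (c k) v ^+ 2 @[M --> \oo] --> `|v| ^+ 2.
Proof.
move=> basis bij; have [cS cinj _] := bij.
have lim := usums_to_series bij (basis.2 v).
have cc i j : inner (c i) (c j) = (i == j)%:R.
  rewrite (basis_inner basis); [|exact: cS..]; congr (nat_of_bool _)%:R.
  by apply/eqP/eqP => [/cinj|->//]; apply; rewrite inE.
have : `|\sum_(0 <= k < M) inner (c k) v *: c k| ^+ 2 @[M --> \oo] --> `|v| ^+ 2.
  by apply: cvgM; apply: cvg_norm.
apply: cvg_trans; apply: near_eq_cvg; apply: nearW => M.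
by rewrite !big_mkord norm_sum_orthonormal.
Qed.

(** * Predictable processes *)

Section PredictableSection.
Context {d} {Omega : measurableType d} {R : realType} (Pr : probability Omega R).
Variables (T : R) (F : R -> set (set Omega)).
Hypothesis T_gt0 : 0 < T.
Hypothesis F_basis : stochastic_basis Pr T F.
Context {H : normedModType R}.

(** The sets with measurable section at time T form a sigma-algebra that contains the generating
    rectangles. *)
Lemma predictable_measurable_section (X : R -> Omega -> H) (U : set H) :
  predictable T F X -> open U -> measurable (X T @^-1` U).
Proof.
move=> Xpred oU; pose Q (A : set (R * Omega)) := measurable [set w | A (T, w)].
pose D := [set` `[0, T]] `*` [set: Omega].
have TD w : D (T, w) by split=> //=; rewrite in_itv /= lexx ltW.
have QE : <<s D, predictable_rects T F >> `<=` Q.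
  apply: smallest_sub.
    split; first exact: measurable0.
    - move=> A QA; rewrite /Q (_ : [set _ | _] = ~` [set w | A (T, w)]).
        exact: measurableC.
      by apply/seteqP; split => [w [_ h]|w h]//; split.
    - move=> A QA; rewrite /Q (_ : [set _ | _] = \bigcup_k [set w | A k (T, w)]).
        exact: bigcupT_measurable.
      by apply/seteqP; split => [w [k _ h]|w [k _ h]]; exists k.
  move=> A [[s [t [B [s0 st tT FB ->]]]]|[B _ ->]]; rewrite /Q.
    have [h|h] := boolP (T \in `]s, t]).
      rewrite (_ : [set _ | _] = B); last by apply/seteqP; split => [w []|w Bw]//; split.
      by apply: (filtration_sub F_basis _ FB); rewrite s0 (le_trans st).
    rewrite (_ : [set _ | _] = set0); first exact: measurable0.
    by apply/seteqP; split => [w [] /=|//]; rewrite (negbTE h).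
  (* Rectangles over time 0 have an empty section because T > 0. *)
  rewrite (_ : [set _ | _] = set0); first exact: measurable0.
  by apply/seteqP; split => [w [] /= T0|//]; move: T_gt0; rewrite T0 ltxx.
have := QE _ (Xpred U oU); rewrite /Q; congr measurable.
by apply/seteqP; split => [w []|w]//= h; split => //; exact: TD.
Qed.

Lemma predictable_measurable_fun (X : R -> Omega -> H) (g : H -> R) :
  predictable T F X -> continuous g -> measurable_fun setT (g \o X T).
Proof.
move=> Xpred /continuousP cg; apply: (measurability _ (RGenOpens.measurableE R)).
move=> _ [_ [a [b ->] <-]]; rewrite setTI comp_preimage.
by apply: predictable_measurable_section => //; apply: cg; exact: interval_open.
Qed.

End PredictableSection.

Lemma integral_gauss_basis {d} {Omega : measurableType d} {R : realType}
    (Pr : probability Omega R) {H : hilbertType R} (HB : set H) (c : nat -> H)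
    (Y : Omega -> H) :
  orthonormal_basis HB -> set_bij setT HB c ->
  (forall u, measurable_fun setT (fun w => inner u (Y w))) ->
  measurable_fun setT (fun w => `|Y w|) ->
  \int[Pr]_w expR (- \sum_(0 <= k < M) inner (c k) (Y w) ^+ 2) @[M --> \oo] -->
  \int[Pr]_w expR (- `|Y w| ^+ 2).
Proof.
move=> basis bij mY mN; apply: fine_cvg; rewrite fineK; last first.
  apply: (@integrable_fin_num _ _ _ Pr setT) => //.
  apply: (@bounded_integrable _ _ _ Pr _ 1) => [|w].
    by do 2 apply: measurableT_comp => //; exact: measurable_funX.
  by rewrite ger0_norm ?expR_ge0// expR_le1 oppr_le0 sqr_ge0.
apply: (@dominated_cvg _ _ _ Pr _ measurableT _ _ (cst 1%E)) => //.
- move=> M; apply/measurable_EFinP; apply: measurableT_comp => //.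
  apply: measurableT_comp => //; apply: measurable_sum => k; exact: measurable_funX.
- move=> w _; apply: cvg_EFin; first exact: nearW.
  apply: (@cvg_comp _ _ _ _ expR); last exact: continuous_expR.
  exact: (cvgN (@parseval_series _ _ _ _ (Y w) basis bij)).
- exact: finite_measure_integrable_cst.
- move=> M w _; rewrite lee_fin ger0_norm ?expR_ge0// expR_le1 oppr_le0.
  by apply: sumr_ge0 => k _; exact: sqr_ge0.
Qed.

Lemma usums_to0 {R : realType} {V : normedModType R} {I : choiceType} (S : set I) (f : I -> V) :
  (forall i, S i -> f i = 0) -> usums_to S f 0.
Proof.
move=> f0 e e0; exists set0 => [|B [_ BS] _].
  by split; [exact: finite_set0|exact: sub0set].
by rewrite fsbig1 ?subrr ?normr0// => i /BS /f0.
Qed.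

(** * Diagonal operators on the interpolation spaces *)

Lemma linear_fun0 {R : pzRingType} {U V : lmodType R} (f : U -> V) : linear f -> f 0 = 0.
Proof.
by move=> /(_ 1 0 0); rewrite !scale1r addr0 => /eqP; rewrite eq_sym -subr_eq0 addrK => /eqP.
Qed.

Lemma linear_funZ {R : pzRingType} {U V : lmodType R} (f : U -> V) a x :
  linear f -> f (a *: x) = a *: f x.
Proof. by move=> lf; have := lf a x 0; rewrite (linear_fun0 lf) !addr0. Qed.

Section SpectralData.
Context {R : realType} {H : hilbertType R}.
Variable HB : set H.
Hypothesis HB_basis : orthonormal_basis HB.
Variables (lam : H -> R) (E : lmodType R) (iota : H -> E).
Variables (Hr : R -> hilbertType R) (emb : forall r, Hr r -> E).
Hypothesis Hr_interp : interpolation_family HB lam iota emb.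

Lemma view_emb r (x : Hr r) e : emb x = e -> view emb r e = x.
Proof.
move=> xe; apply: xget_unique => // y /= ye; apply: (emb_inj Hr_interp).
by rewrite ye.
Qed.

Lemma iotaZ (a : R) v : iota (a *: v) = a *: iota v.
Proof. exact: (linear_funZ _ _ (iota_linear Hr_interp)). Qed.

Lemma embZ r (a : R) (x : Hr r) : emb (a *: x) = a *: emb x.
Proof. exact: (linear_funZ _ _ (emb_linear Hr_interp (r := r))). Qed.

(** On a multiple of a basis vector all terms but one vanish. With general [I] and [f] this serves
    the projections, the semigroup and the fractional powers alike. *)
Lemma basis_diag_usum (I : set H) (f : H -> R) (a : R) (b : H) : I `<=` HB -> HB b ->
  usums_to I (fun b' : H => (f b' * inner b' (a *: b)) *: b') ((\1_I b * f b * a) *: b).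
Proof.
move=> IHB Hb; have bb b' : HB b' -> inner b' (a *: b) = a * (b' == b)%:R.
  by move=> Hb'; rewrite innerZr (basis_inner HB_basis).
have [Ib|nIb] := pselect (I b).
  rewrite indicE mem_set// mul1r.
  have -> : f b * a = f b * inner b (a *: b) by rewrite bb// eqxx mulr1.
  apply: (usums_to_single (f := fun b' : H => (f b' * inner b' (a *: b)) *: b')) => // b' Ib' b'b.
  by rewrite bb ?(negbTE b'b) ?mulr0 ?scale0r//; exact: IHB.
rewrite indicE memNset// !mul0r scale0r; apply: usums_to0 => b' Ib'.
have b'b : b' != b by apply: contra_not_neq nIb => <-.
by rewrite bb ?(negbTE b'b) ?mulr0 ?scale0r//; exact: IHB.
Qed.

Lemma frac_dom_basis r b : HB b -> frac_dom HB lam r b.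
Proof.
move=> Hb; pose f b' := ((`| `|lam b'| `^ r * inner b' b| ^+ 2)%:E : \bar R)%E.
apply: (@le_lt_trans _ _ (f b)); last by rewrite ltry.
apply: ge_ereal_sup => _ [A [finA AHB] <-].
have f0 b' : HB b' -> b' != b -> f b' = 0%E.
  by move=> Hb' b'b; rewrite /f (basis_inner HB_basis)// (negbTE b'b) mulr0 normr0 expr0n.
have [Ab|nAb] := pselect (A b).
  rewrite (fsbigD1 b)//= fsbig1 ?adde0// => b' [Ab' b'b].
  by apply: f0; [exact: AHB|apply/eqP].
rewrite fsbig1 ?lee_fin ?sqr_ge0// => b' Ab'; apply: f0; first exact: AHB.
by apply: contra_not_neq nAb => <-.
Qed.

Lemma range_emb_basis r b : HB b -> range (@emb r) (iota b).
Proof.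
move=> Hb; have [r0|r0] := leP 0 r; last by apply: (interp_lt0 Hr_interp) => //; exists b.
rewrite (interp_ge0 Hr_interp)//; exists b => //; exact: frac_dom_basis.
Qed.

Lemma emb_view r b : HB b -> emb (view emb r (iota b)) = iota b.
Proof. by move=> Hb; have [x _ xb] := range_emb_basis r Hb; rewrite (view_emb xb). Qed.

Variables (P : set H -> Hr (- 1) -> Hr (- 1)) (P_proj : spectral_projections HB iota emb P).
Variables (expA : R -> Hr (- 1) -> H) (expA_ext : smoothing_semigroup HB lam iota emb expA).
Variables (r : R) (mu : H -> R) (B : H -> Hr r).
Hypothesis B_diag : forall v : H, usums_to HB
     (fun b : H => (mu b * inner b v) *: view emb r (iota b)) (B v).

Lemma emb_diag_basis b : HB b -> emb (B b) = iota (mu b *: b).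
Proof.
move=> Hb; have Bb := B_diag b.
pose f b' := (mu b' * inner b' b) *: view emb r (iota b').
have Bb' : usums_to HB f (f b).
  apply: usums_to_single => // b' Hb' b'b.
  by rewrite /f (basis_inner HB_basis)// (negbTE b'b) mulr0 scale0r.
rewrite (usums_to_unique Bb Bb') /f (basis_inner HB_basis)// eqxx mulr1.
by rewrite embZ emb_view// iotaZ.
Qed.

(** The operators on Hr (- 1) are specified only on vectors coming from H. The image of a basis
    vector under [B] is a multiple of it, hence such a vector, and remains one after the
    projection. *)
Lemma mild_integrand_basis (I : set H) (t : R) b : I `<=` HB -> HB b -> 0 < t ->
  expA t (P I (view emb (- 1) (emb (B b)))) =
  (\1_I b * mu b * expR (t * lam b)) *: b.
Proof.
move=> IHB Hb t0; rewrite emb_diag_basis//.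
have [_ PE] := P_proj IHB; have := PE (mu b *: b).
have := basis_diag_usum (fun=> 1) (mu b) IHB Hb; rewrite mulr1.
under [X in usums_to _ X]eq_fun do rewrite mul1r.
move=> /usum_eq -> /view_emb <-; have [_ ->//] := expA_ext t0.
apply: usum_eq; have := basis_diag_usum (fun b => expR (t * lam b)) (\1_I b * mu b) (@subset_refl _ HB) Hb.
by rewrite [\1_HB b]indicE mem_set// mul1r [expR _ * _]mulrC.
Qed.

End SpectralData.

(** * The Gaussian functional of the mild solution *)

Section MildSolution.
Context {R : realType} {H : hilbertType R}.
Variable T : R.
Hypothesis T_gt0 : 0 < T.
Context {d : measure_display} {Omega : measurableType d} (Pr : probability Omega R).
Variable F : R -> set (set Omega).
Hypothesis F_basis : stochastic_basis Pr T F.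
Variable W : R -> H -> Omega -> R.
Hypothesis W_wiener : cylindrical_wiener Pr T F W.
Variable HB : set H.
Hypothesis HB_basis : orthonormal_basis HB.
Variables (c : nat -> H) (g r : H -> R).
Hypothesis c_bij : set_bij setT HB c.
Hypothesis r_gt0 : forall b, HB b -> 0 < r b.
Variables (Phi : R -> Omega -> H -> H) (Y : Omega -> H).
Hypothesis PhiE : forall s w b, 0 < s < T -> HB b ->
  Phi s w b = (g b * expR (- (r b * (T - s)))) *: b.
Hypothesis mY : forall u, measurable_fun setT (fun w => inner u (Y w)).
Hypothesis mN : measurable_fun setT (fun w => `|Y w|).
Hypothesis Y_ito : is_ito_integral Pr F HB W T Phi Y.

Lemma mild_gauss_product :
  \prod_(0 <= k < M)
     (Num.sqrt (1 + g (c k) ^+ 2 * (1 - expR (- (2 * r (c k) * T))) / r (c k)))^-1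
   @[M --> \oo] --> \int[Pr]_w expR (- `|Y w| ^+ 2).
Proof.
have [cS cinj csurj] := c_bij.
have cc i j : inner (c i) (c j) = (i == j)%:R.
  rewrite (basis_inner HB_basis); [|exact: cS..]; congr (nat_of_bool _)%:R.
  by apply/eqP/eqP => [/cinj|->//]; apply; rewrite inE.
have rc k : 0 < r (c k) by apply: r_gt0; exact: cS.
(* The variance of <c k, Y>; twice this number is the term added to 1 in the product. *)
pose q k := g (c k) ^+ 2 * ((1 - expR (- (2 * r (c k) * T))) / (2 * r (c k))).
have q0 k : 0 <= q k.
  rewrite mulr_ge0 ?sqr_ge0// divr_ge0//; last by rewrite mulr_ge0// ltW.
  by rewrite subr_ge0 expR_le1 oppr_le0 !mulr_ge0// ltW.
have := integral_gauss_basis (Pr := Pr) HB_basis c_bij mY mN.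
apply: cvg_trans; apply: near_eq_cvg; apply: nearW => M.
rewrite (integral_gaussian_sqr (q := q)).
- apply: eq_bigr => k _; congr (Num.sqrt (1 + _))^-1; rewrite /q.
  by field; rewrite gt_eqF.
- by move=> k; exact: mY.
- exact: q0.
move=> th; pose u := \sum_(k < M) th k *: c k.
transitivity (\int[Pr]_w cos (inner u (Y w))).
  apply: eq_Rintegral => w _; rewrite inner_suml big_mkord; congr cos.
  by apply: eq_bigr => k _; rewrite innerZl.
rewrite (@ito_char _ _ _ _ T F T_gt0 F_basis _ W W_wiener HB HB_basis Phi Y mY Y_ito
  'I_M (fun k => c k) (fun k => th k * g (c k)) (fun k => r (c k)) u).
- congr expR; congr (- _ / 2); rewrite big_mkord; apply: eq_bigr => k _.
  by rewrite /q exprMn mulrA.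
- by move=> i j; rewrite cc.
- by move=> j; exact: rc.
move=> s w b sT Hb; rewrite PhiE// innerZr inner_suml inner_sumr mulr_sumr.
apply: eq_bigr => k _; rewrite innerZl innerZr (innerC b) (basis_inner HB_basis)//; last exact: cS.
by have [->|_] := eqVneq (c k) b; rewrite ?mulr0 ?mulr1//; ring.
Qed.

End MildSolution.

(** * Comparison of Gaussian products with tails of power series *)

Section ProductComparison.
Context {R : realType}.
Implicit Types (a p : nat -> R) (k y : R).

Lemma prodr_ge1D_sum a (m n : nat) : (forall i, 0 <= a i) ->
  1 + \sum_(m <= i < n) a i <= \prod_(m <= i < n) (1 + a i).
Proof.
move=> a0; elim: n => [|n IH]; first by rewrite !big_geq// addr0.
have [mn|nm] := leqP m n; last by rewrite !big_geq// addr0.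
rewrite !big_nat_recr//= (le_trans _ (ler_wpM2r _ IH))//; last by rewrite addr_ge0.
have S0 : 0 <= \sum_(m <= i < n) a i by exact: sumr_ge0.
by have := mulr_ge0 S0 (a0 n); lra.
Qed.

Lemma sum_powR_ge k x (m n : nat) : 0 < k -> 0 < x -> (m <= n)%N ->
  ((x * m.+1%:R) `^ (- k) - (x * n.+1%:R) `^ (- k)) / (x * k) <=
  \sum_(m <= i < n) (x * i.+1%:R) `^ (- (k + 1)).
Proof.
move=> k0 x0 mn; rewrite ler_pdivrMr ?mulr_gt0//.
pose f (i : nat) := - (x * i.+1%:R) `^ (- k).
have -> : (x * m.+1%:R) `^ (- k) - (x * n.+1%:R) `^ (- k) = \sum_(m <= i < n) (f i.+1 - f i).
  by rewrite telescope_sumr// /f opprK addrC.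
rewrite mulr_suml; apply: ler_sum => i _; rewrite /f opprK addrC.
have xi (j : nat) : 0 < x * j.+1%:R by rewrite mulr_gt0// ltr0n.
apply: le_trans (powR_diff_le k0 (xi i) (xi i.+1)) _.
rewrite (_ : x * i.+2%:R - x * i.+1%:R = x); last by rewrite -(natr1 i.+1); ring.
by rewrite le_eqVlt; apply/orP; left; apply/eqP; ring.
Qed.

Lemma cvg_powR_neg k x : 0 < k -> 0 < x -> (x * n.+1%:R) `^ (- k) @[n --> \oo] --> (0 : R).
Proof.
move=> k0 x0; have xn (n : nat) : 0 < x * n.+1%:R by rewrite mulr_gt0// ltr0n.
have -> : (fun n => (x * n.+1%:R) `^ (- k)) = (fun n => (x * n.+1%:R)^-1 `^ k).
  apply/funext => n; rewrite !powR_expR_ln ?invr_gt0//.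
  by rewrite lnV ?posrE// mulrN mulNr.
apply: (@cvg_comp _ _ _ (fun n => (x * n.+1%:R)^-1) (fun t => t `^ k) _ (0^'+)).
  have lim0 : (x * n.+1%:R)^-1 @[n --> \oo] --> (0 : R).
    rewrite (_ : (fun n => _) = (fun n => x^-1 * n.+1%:R^-1)); last first.
      by apply/funext => n; rewrite invfM.
    rewrite -[X in _ --> X](mulr0 x^-1); apply: cvgM; first exact: cvg_cst.
    exact: cvg_harmonic.
  move=> U hU; have := lim0 _ hU; rewrite /nbhs /=; apply: filterS => n /=; apply.
  by rewrite invr_gt0.
exact: powR_cvg0.
Qed.

(* With [p n = \prod_(i < n) (1 + a i)^(-1/2)], [p N / p M] is at least the square
   root of [1 + \sum_(N <= i < M) a i]. *)
Lemma gauss_product_gap a k y (L : R) (N : nat) : (forall i, 0 <= a i) -> 0 < k -> 0 <= y ->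
  (forall i, y * (pi * i.+1%:R) `^ (- (k + 1)) <= a i) ->
  \prod_(0 <= i < M) (Num.sqrt (1 + a i))^-1 @[M --> \oo] --> L ->
  L * Num.sqrt (1 + y / (pi * k) * (pi * N.+1%:R) `^ (- k)) <=
  \prod_(0 <= i < N) (Num.sqrt (1 + a i))^-1.
Proof.
move=> a0 k0 y0 ya pL; set pN := \prod_(0 <= i < N) _.
have a1 i : 0 < 1 + a i by rewrite ltr_pwDl.
(* The telescoped sum stopped at M; the power of M in it tends to 0, which leaves the stated
   term. *)
pose z M := 1 + y / (pi * k) * ((pi * N.+1%:R) `^ (- k) - (pi * M.+1%:R) `^ (- k)).
have lim : \prod_(0 <= i < M) (Num.sqrt (1 + a i))^-1 * Num.sqrt (z M) @[M --> \oo] -->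
    L * Num.sqrt (1 + y / (pi * k) * (pi * N.+1%:R) `^ (- k)).
  apply: cvgM => //; apply: (@cvg_comp _ _ _ _ Num.sqrt); last exact: sqrt_continuous.
  apply: cvgD; first exact: cvg_cst.
  apply: cvgM; first exact: cvg_cst.
  rewrite -[X in _ --> X]subr0; apply: cvgB; first exact: cvg_cst.
  by apply: cvg_powR_neg => //; exact: pi_gt0.
rewrite -(cvg_lim _ lim)//; apply: limr_le; first exact: cvgP lim.
exists N => // M /= NM; rewrite (big_cat_nat (n := N))//= -/pN.
rewrite -mulrA -[leRHS]mulr1 ler_wpM2l//.
  by apply: prodr_ge0 => i _; rewrite invr_ge0 sqrtr_ge0.
have E : \prod_(N <= i < M) (Num.sqrt (1 + a i))^-1 = (Num.sqrt (\prod_(N <= i < M) (1 + a i)))^-1.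
  elim: M NM => [|M IH] NM; first by rewrite !big_geq ?sqrtr1 ?invr1.
  have [NM'|h] := leqP N M; last by rewrite !big_geq ?sqrtr1 ?invr1.
  by rewrite !big_nat_recr//= IH// sqrtrM ?invfM// prodr_ge0// => i _; rewrite ltW.
have P0 : 0 < \prod_(N <= i < M) (1 + a i) by apply: prodr_gt0.
rewrite E mulrC ler_pdivrMr ?sqrtr_gt0// mul1r ler_wsqrtr//.
apply: le_trans (prodr_ge1D_sum N M a0); rewrite lerD2l.
rewrite -mulrA (mulrC _^-1).
apply: (@le_trans _ _ (y * \sum_(N <= i < M) (pi * i.+1%:R) `^ (- (k + 1)))).
  by rewrite ler_wpM2l//; apply: sum_powR_ge => //; exact: pi_gt0.
by rewrite mulr_sumr; apply: ler_sum => i _.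
Qed.

End ProductComparison.

(** * Diagonal Hilbert-Schmidt operators *)

Section DiagonalHilbertSchmidt.
Context {R : realType} {H : hilbertType R}.
Variable HB : set H.
Hypothesis HB_basis : orthonormal_basis HB.
Variables (lam : H -> R) (E : lmodType R) (iota : H -> E).
Variables (Hr : R -> hilbertType R) (emb : forall r, Hr r -> E).
Hypothesis Hr_interp : interpolation_family HB lam iota emb.
Variable c : nat -> H.
Hypothesis c_bij : set_bij setT HB c.

Lemma bessel (v : H) M : \sum_(0 <= k < M) inner (c k) v ^+ 2 <= `|v| ^+ 2.
Proof.
have lim := @parseval_series _ _ _ _ v HB_basis c_bij.
rewrite -(cvg_lim _ lim)//; apply: nondecreasing_cvgn_le; last exact: cvgP lim.
apply/nondecreasing_seqP => n; rewrite big_nat_recr//= lerDl sqr_ge0//.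
Qed.

Lemma norm_view_basis r b : HB b -> `|view emb r (iota b)| = `|lam b| `^ r.
Proof.
move=> Hb; rewrite (interp_norm Hr_interp (emb_view HB_basis Hr_interp r Hb)).
have := basis_diag_usum HB_basis (fun b => `|lam b| `^ r) 1 (@subset_refl _ HB) Hb.
rewrite indicE mem_set// mul1r mulr1 scale1r => /usum_eq.
rewrite /frac_pow /diag_op => ->; rewrite normrZ ger0_norm ?powR_ge0//.
have -> : `|b| = 1; last by rewrite mulr1.
apply/eqP; rewrite -(@pexpr_eq1 _ _ 2)//; apply/eqP.
by rewrite -inner_normE (basis_inner HB_basis)// eqxx.
Qed.

Lemma embB r (x y : Hr r) : emb (x - y) = emb x - emb y.
Proof.
have := emb_linear Hr_interp (- 1) y x.
by rewrite !scaleN1r [- y + x]addrC [- _ + _]addrC.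
Qed.

Lemma emb_sum r (I : Type) (s : seq I) (f : I -> Hr r) :
  emb (\sum_(i <- s) f i) = \sum_(i <- s) emb (f i).
Proof.
elim: s => [|i s IH]; first by rewrite !big_nil -(subrr (0 : Hr r)) embB subrr.
rewrite !big_cons -IH; have := emb_linear Hr_interp 1 (f i) (\sum_(j <- s) f j).
by rewrite !scale1r.
Qed.

(** Convergence in the smaller space passes to the larger one through the bounded inclusion, and the
    limits have the same image in [E]. *)
Lemma incl_cvg r s (S : nat -> Hr s) (x : Hr s) (S' : nat -> Hr r) : r <= s ->
  S @ \oo --> x -> (forall n, emb (S' n) = emb (S n)) ->
  exists2 x' : Hr r, emb x' = emb x & S' @ \oo --> x'.
Proof.
move=> rs Sx S'S; have [C hC] := interp_incl Hr_interp rs.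
have [x' x'x _] := hC x; exists x' => //.
apply/cvgrPdist_le => e e0.
have C1 : 0 < `|C| + 1 by rewrite ltr_wpDl.
move/cvgrPdist_le : Sx => /(_ _ (divr_gt0 e0 C1)); apply: filterS => n.
rewrite ler_pdivlMr// => h.
have [y yx yC] := hC (x - S n).
have -> : x' - S' n = y by apply: (emb_inj Hr_interp); rewrite yx !embB x'x S'S.
rewrite (le_trans yC)// (le_trans _ h)// mulrC ler_wpM2l//.
by rewrite (le_trans (ler_norm C))// lerDl.
Qed.

Variables (r : R) (mu : H -> R) (B : H -> Hr r).
Hypothesis B_linear : linear B.
Hypothesis B_diag : forall v : H, usums_to HB
     (fun b : H => (mu b * inner b v) *: view emb r (iota b)) (B v).
Variables (s K : R).
Hypothesis K_ub : forall M, \sum_(0 <= k < M) (mu (c k) * `|lam (c k)| `^ s) ^+ 2 <= K.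

Let K_ge0 : 0 <= K. Proof. by have := K_ub 0; rewrite big_nil. Qed.

(* Cauchy-Schwarz, in the form [2 |a b| <= e a^2 + b^2 / e], makes the series
   defining [B v] absolutely convergent in [Hr s]. *)
Let diag_range (v : H) (e : R) : 0 < e ->
  exists2 x : Hr s, emb x = emb (B v) & `|x| <= (e * K + `|v| ^+ 2 / e) / 2.
Proof.
move=> e0; pose u k : Hr s := (mu (c k) * inner (c k) v) *: view emb s (iota (c k)).
have [cS _ _] := c_bij.
pose L := (e * K + `|v| ^+ 2 / e) / 2.
have uL M : \sum_(0 <= k < M) `|u k| <= L.
  apply: (@le_trans _ _ (\sum_(0 <= k < M)
      (e * (mu (c k) * `|lam (c k)| `^ s) ^+ 2 + inner (c k) v ^+ 2 / e) / 2)).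
    apply: ler_sum => k _; rewrite /u normrZ norm_view_basis//; last exact: cS.
    set p := `|_| `^ s; have p0 : 0 <= p by exact: powR_ge0.
    rewrite ler_pdivlMr// -[X in X + _](mulfK (lt0r_neq0 e0)) -mulrDl ler_pdivlMr//.
    rewrite normrM -[inner _ _ ^+ 2]real_normK ?num_real//.
    rewrite exprMn -[mu _ ^+ 2]real_normK ?num_real//.
    have := sqr_ge0 (e * (`|mu (c k)| * p) - `|inner (c k) v|); nra.
  rewrite -mulr_suml ler_wpM2r// big_split/= -mulr_sumr -mulr_suml lerD//.
    by rewrite ler_wpM2l ?(ltW e0).
  by rewrite ler_wpM2r ?invr_ge0 ?(ltW e0)// bessel.
have cu : cvgn [normed series u].
  rewrite -[X in cvgn X]/(fun M => \sum_(0 <= k < M) `|u k|).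
  apply: nondecreasing_is_cvgn.
    by apply/nondecreasing_seqP => n; rewrite big_nat_recr//= lerDl.
  by exists L => _ [n _ <-]; exact: uL.
have Sx : series u @ \oo --> limn (series u) by exact: normed_cvg cu.
set x := limn _ in Sx.
have xL : `|x| <= L.
  have lim : `|series u n| @[n --> \oo] --> `|x| by exact: cvg_norm.
  rewrite -(cvg_lim _ lim)//; apply: limr_le; first exact: cvgP lim.
  by apply: nearW => n; exact: le_trans (ler_norm_sum _ _ _) (uL n).
exists x => //.
pose T M := \sum_(0 <= k < M) (mu (c k) * inner (c k) v) *: view emb r (iota (c k)).
have TB : T @ \oo --> B v by exact: usums_to_series c_bij (B_diag v).
have ST n : emb (T n) = emb (series u n).
  rewrite /series/= !emb_sum; apply: eq_bigr => k _.
  by rewrite !(embZ Hr_interp) !(emb_view HB_basis Hr_interp)//; exact: cS.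
(* The same partial sums tend to x in [Hr s] and to B v in [Hr r]. Both limits can be compared in
   the larger of the two spaces, whichever it is. *)
have [rs|/ltW sr] := leP r s.
  have [x' <- Tx'] := incl_cvg rs Sx ST.
  by congr emb; exact: cvg_unique Tx' TB.
have [x' <- Sx'] := incl_cvg sr TB (fun n => esym (ST n)).
by congr emb; exact: cvg_unique Sx Sx'.
Qed.

Lemma in_HS_diag : in_HS HB emb s B.
Proof.
pose C v := view emb s (emb (B v)).
have CB v : emb (C v) = emb (B v).
  by have [x xB _] := diag_range v ltr01; rewrite /C (view_emb Hr_interp xB).
have linC : linear C.
  move=> a u v; apply: (emb_inj Hr_interp).
  by rewrite (emb_linear Hr_interp) !CB -(emb_linear Hr_interp) B_linear.
have B0 := linear_fun0 B_linear.
have C_le v : `|C v| <= (K + 1) / 2 * `|v|.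
  have [->|v0] := eqVneq v 0.
    rewrite (_ : C 0 = 0) ?normr0 ?mulr0//.
    apply: (emb_inj Hr_interp); rewrite CB B0 -(subrr (0 : Hr r)) -(subrr (0 : Hr s)).
    by rewrite !embB !subrr.
  (* The choice e = |v| balances the two terms of [diag_range] and gives the operator bound (K + 1)
     / 2. *)
  have n0 : 0 < `|v| by rewrite normr_gt0.
  have [x xB xle] := diag_range v n0; rewrite /C (view_emb Hr_interp xB) (le_trans xle)//.
  by rewrite expr2 mulfK ?gt_eqF// le_eqVlt; apply/orP; left; apply/eqP; field.
exists C; split=> //; split.
  split=> // v; apply/cvgrPdist_le => e e0.
  have K1 : 0 < (K + 1) / 2 by rewrite divr_gt0// ltr_wpDl.
  have : \forall w \near v, `|v - w| <= e / ((K + 1) / 2).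
    by apply: cvgr_dist_le; [exact: cvg_id|rewrite divr_gt0].
  apply: filterS => w; rewrite ler_pdivlMr// mulrC; apply: le_trans.
  have -> : C v - C w = C (v - w).
    by have := linC (- 1) w v; rewrite !scaleN1r [- w + v]addrC [- _ + _]addrC.
  exact: C_le.
rewrite /hs_sqnorm (reindex_esum setT HB c)// -nneseries_esumT; last first.
  by move=> k; rewrite lee_fin sqr_ge0.
apply: (@le_lt_trans _ _ K%:E); last exact: ltry.
have [cS _ _] := c_bij.
have CE k : C (c k) = mu (c k) *: view emb s (iota (c k)).
  apply: (emb_inj Hr_interp); rewrite CB (embZ Hr_interp) (emb_view HB_basis Hr_interp)//; last exact: cS.
  by rewrite (emb_diag_basis HB_basis Hr_interp B_diag) ?(iotaZ Hr_interp)//; exact: cS.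
apply: lime_le.
  by apply: is_cvg_nneseries => k _ _; rewrite lee_fin sqr_ge0.
apply: nearW => n; rewrite sumEFin lee_fin (le_trans _ (K_ub n))//.
apply: ler_sum => k _; rewrite CE normrZ norm_view_basis//; last exact: cS.
by rewrite !exprMn real_normK ?num_real.
Qed.

End DiagonalHilbertSchmidt.

(** The induction closes with the remainder (x (M + 1))^(-k) subtracted on the right. The term of
    index 0 stands apart because each term is compared with the interval to its left, which would
    start at 0. *)
Lemma sum_powR_le {R : realType} (k x : R) (M : nat) : 0 < k -> 0 < x ->
  \sum_(0 <= i < M) (x * i.+1%:R) `^ (- (k + 1)) <= x `^ (- (k + 1)) + x `^ (- k) / (x * k).
Proof.
move=> k0 x0; have xk : 0 < x * k by rewrite mulr_gt0.
suff : \sum_(0 <= i < M.+1) (x * i.+1%:R) `^ (- (k + 1)) <=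
    x `^ (- (k + 1)) + (x `^ (- k) - (x * M.+1%:R) `^ (- k)) / (x * k).
  rewrite big_nat_recr//= => h; apply: le_trans (le_trans _ h) _.
    by rewrite lerDl powR_ge0.
  by rewrite lerD2l ler_wpM2r ?invr_ge0 ?(ltW xk)// gerBl powR_ge0.
elim: M => [|M IH]; first by rewrite big_nat1 mulr1 subrr mul0r addr0.
rewrite big_nat_recr//=; apply: le_trans (lerD IH (lexx _)) _.
have xi (j : nat) : 0 < x * j.+1%:R by rewrite mulr_gt0// ltr0n.
have := powR_diff_ge k0 (xi M) (xi M.+1).
rewrite (_ : x * M.+2%:R - x * M.+1%:R = x); last by rewrite -(natr1 M.+1); ring.
rewrite -addrA lerD2l -lerBrDl -mulrBl ler_pdivlMr//.
lra.
Qed.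

(** * The case of eigenvalues - pi^2 n^2 *)

Unset Implicit Arguments.

Theorem corollary7p5
  (R : realType)
  (H : hilbertType R) (H_separable : separable H)
  (T : R) (T_gt0 : 0 < T)
  (d : measure_display) (Omega : measurableType d)
  (Pr : probability Omega R)
  (F : R -> set (set Omega)) (F_basis : stochastic_basis Pr T F)
  (W : R -> H -> Omega -> R) (W_wiener : cylindrical_wiener Pr T F W)
  (HB : set H) (HB_neq0 : HB !=set0) (HB_basis : orthonormal_basis HB)
  (lam : H -> R) (lam_sup : (ereal_sup [set (lam b)%:E | b in HB] < 0)%E)
  (E : lmodType R) (iota : H -> E)
  (Hr : R -> hilbertType R) (emb : forall r, Hr r -> E)
  (Hr_interp : interpolation_family HB lam iota emb)
  (P : set H -> Hr (- 1) -> Hr (- 1))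
  (P_proj : spectral_projections HB iota emb P)
  (expA : R -> Hr (- 1) -> H)
  (expA_ext : smoothing_semigroup HB lam iota emb expA)
  (beta : R) (beta_range : 0 <= beta < 1 / 2)
  (mu : H -> R)
  (mu_sum : (\esum_(b in HB)
     ((`|mu b| ^+ 2 * `|lam b| `^ (- 2 * beta))%:E) < +oo)%E)
  (B : H -> Hr (- beta)) (B_HS : hilbert_schmidt HB B)
  (B_diag : forall v : H, usums_to HB
     (fun b : H => (mu b * inner b v) *: view emb (- beta) (iota b)) (B v))
  (X : set H -> R -> Omega -> H)
  (X_predictable : forall I, I `<=` HB -> predictable T F (X I))
  (X_moments : forall I, I `<=` HB -> forall p : R, 0 < p ->
     (ereal_sup [set \int[Pr]_w (`|X I t w| `^ p)%:E | t in [set` `[0%R, T]]]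
       < +oo)%E)
  (X_mild : forall I, I `<=` HB -> forall t, 0 <= t <= T ->
     is_ito_integral Pr F HB W t
       (fun s _ v => expA (t - s) (P I (view emb (- 1) (emb _ (B v)))))
       (X I t))
  (b : nat -> H) (b_bij : set_bij [set n | (1 <= n)%N] HB b)
  (I : set H) (I_sub : I `<=` HB)
  (N : nat) (N_ge1 : (1 <= N)%N)
  (delta : R) (delta_lt : delta < 1 / 4)
  (lam_b : forall n, (1 <= n)%N -> lam (b n) = - (pi ^+ 2 * n%:R ^+ 2))
  (mu_b : forall n, (1 <= n)%N -> mu (b n) = `|lam (b n)| `^ delta)
  (phi : H -> R) (phiE : forall v, phi v = expR (- `|v| ^+ 2)) :
  let bN := [set b n | n in [set n | (1 <= n <= N)%N]] in
  let Ephi J := fine ('E_Pr[fun w => phi (X J T w)]) in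
  [/\ Cnb 4 phi,
      forall r, r < - (1 / 2) * (1 / 2 + 2 * delta) -> in_HS HB emb r B &
      Ephi bN - Ephi HB >=
        (Ephi HB * 2 `^ (4 * delta - 5) * (1 - expR (- T)) /
          (2 - 4 * delta + 2 `^ (7 * delta - 7) * (1 - 4 * delta) `^ (- (1 / 3)))
            `^ (3 / 2))
        * `|lam (b N)| `^ (- (1 - (1 / 2 + 2 * delta)))].
Proof.
(* The index shift lets sums and products start at 0. The exponent [kap] is twice 1 - (1/2 + 2
   delta), because |lam| = (pi n)^2. *)
pose c k := b k.+1; pose kap := 1 - 4 * delta; pose y := 1 - expR (- T).
have [bHB binj bsurj] := b_bij.
have cHB k : HB (c k) by exact: bHB.
have c_bij : set_bij setT HB c.
  split; first by move=> k _; exact: cHB.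
    by move=> k k' _ _ /binj; rewrite !inE /= => /(_ erefl erefl) [].
  by move=> x /bsurj [[//|n] _ <-]; exists n.
have kap0 : 0 < kap by rewrite /kap; lra.
have pin (k : nat) : 0 < pi * k.+1%:R :> R by rewrite mulr_gt0 ?pi_gt0// ltr0n.
have lamc k : lam (c k) = - (pi * k.+1%:R) ^+ 2 by rewrite lam_b// exprMn.
have lamcN k : `|lam (c k)| = (pi * k.+1%:R) ^+ 2.
  by rewrite lamc normrN ger0_norm ?sqr_ge0.
have powc k (a : R) : ((pi * k.+1%:R) ^+ 2) `^ a = (pi * k.+1%:R) `^ (2 * a).
  by rewrite powRrM powR_mulrn ?(ltW (pin k)).
have powD k (a1 a2 : R) : (pi * k.+1%:R) `^ a1 * (pi * k.+1%:R) `^ a2 =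
    (pi * k.+1%:R) `^ (a1 + a2) :> R.
  by rewrite powRD//; apply/implyP => _; rewrite gt_eqF.
have muc k : mu (c k) = (pi * k.+1%:R) `^ (2 * delta).
  by rewrite mu_b// -/(c k) lamcN powc.
have HBc x : HB x -> exists k, x = c k.
  by move=> /bsurj [[//|n] _ <-]; exists n.
have rHB x : HB x -> 0 < - lam x.
  by move=> /HBc [k ->]; rewrite lamc opprK exprn_gt0.
have y0 : 0 <= y <= 1.
  by rewrite /y subr_ge0 expR_le1 oppr_le0 (ltW T_gt0) lerBlDr lerDl expR_ge0.
(* Twice the variance of the coordinate if c k lies in J, and 0 otherwise: a coordinate that is
   projected away contributes the factor 1. *)
pose a (J : set H) k : R := \1_J (c k) * (mu (c k) ^+ 2 * (1 - expR (- (2 * - lam (c k) * T))) / - lam (c k)).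
have a_ge0 J k : 0 <= a J k.
  rewrite mulr_ge0// divr_ge0 ?(ltW (rHB _ (cHB k)))// mulr_ge0 ?sqr_ge0// subr_ge0.
  by rewrite expR_le1 oppr_le0 !mulr_ge0 ?(ltW T_gt0)// ltW// rHB.
have EphiE J : J `<=` HB -> 
    fine ('E_Pr[fun w => phi (X J T w)]) = \int[Pr]_w expR (- `|X J T w| ^+ 2).
  by move=> JHB; rewrite unlock /Rintegral; congr fine; apply: eq_integral => w _; rewrite phiE.
have lim J : J `<=` HB -> \prod_(0 <= k < M) (Num.sqrt (1 + a J k))^-1 @[M --> \oo] -->
    \int[Pr]_w expR (- `|X J T w| ^+ 2).
  move=> JHB; have Xp := X_predictable J JHB.
  have TT : 0 <= T <= T by rewrite (ltW T_gt0) lexx.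
  have PhiE s (w : Omega) x : 0 < s < T -> HB x ->
      expA (T - s) (P J (view emb (- 1) (emb _ (B x)))) =
      (\1_J x * mu x * expR (- (- lam x * (T - s)))) *: x.
    move=> /andP[_ sT] Hx.
    rewrite (mild_integrand_basis HB_basis Hr_interp P_proj expA_ext B_diag)// ?subr_gt0//.
    by rewrite mulNr opprK mulrC [lam x * _]mulrC [expR _ * _]mulrC.
  have mY u : measurable_fun setT (fun w => inner u (X J T w)).
    exact: (predictable_measurable_fun T_gt0 F_basis Xp (@inner_continuous _ _ u)).
  have mN : measurable_fun setT (fun w => `|X J T w|).
    exact: (predictable_measurable_fun T_gt0 F_basis Xp (@norm_continuous _ H)).
  have := mild_gauss_product T_gt0 F_basis W_wiener HB_basis c_bij
    rHB PhiE mY mN (X_mild J JHB T TT).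
  apply: cvg_trans; apply: near_eq_cvg; apply: nearW => M.
  apply: eq_bigr => k _; congr (Num.sqrt (1 + _))^-1.
  by rewrite /a exprMn indicE; case: (_ \in _); rewrite ?expr1n ?expr0n ?mul0r ?mul1r.
move=> bN Ephi; split.
- rewrite (_ : phi = fun x => expR (- `|x| ^+ 2)); first exact: Cnb_gauss.
  exact/funext.
- move=> r hr; have [[Blin _] _] := B_HS.
  (* Here mu^2 |lam|^(2 r) = (pi n)^(4 delta + 4 r) = (pi n)^(-(k + 1)), and k > 0 is exactly the
     condition on r. *)
  pose k := - (4 * delta + 4 * r) - 1.
  have k0 : 0 < k by rewrite /k; lra.
  apply: (in_HS_diag HB_basis Hr_interp c_bij Blin B_diag) => M.
  apply: le_trans (sum_powR_le M k0 (pi_gt0 R)); apply: ler_sum => i _.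
  rewrite muc lamcN powc powD.
  rewrite -powR_mulrn ?powR_ge0// -powRrM le_eqVlt; apply/orP; left; apply/eqP.
  by congr (_ `^ _); rewrite /k; field.
have bNHB : bN `<=` HB by move=> _ [n /andP[n1 _] <-]; exact: bHB.
have in_bN k : \1_bN (c k) = (k < N)%N%:R :> R.
  rewrite indicE; congr (nat_of_bool _)%:R; apply/idP/idP.
    rewrite inE => -[n /andP[n1 nN]] /binj; rewrite !inE/= => /(_ n1 erefl) nk.
    by rewrite -nk.
  by move=> kN; rewrite inE; exists k.+1.
have in_HB k : \1_HB (c k) = 1 :> R by rewrite indicE mem_set.
(* The partial products for bN are constant from N on, so their limit is a finite product. *)
have EN : Ephi bN = \prod_(0 <= k < N) (Num.sqrt (1 + a HB k))^-1.
  rewrite /Ephi EphiE//; apply: (cvg_unique _ (lim bN bNHB)) => //.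
  apply: cvg_near_cst; exists N => // M /= NM.
  rewrite (big_cat_nat (n := N))//= [X in _ * X]big_nat_cond [X in _ * X]big1; last first.
    move=> k /andP[/andP[Nk _] _].
    by rewrite /a in_bN ltnNge Nk mul0r addr0 sqrtr1 invr1.
  rewrite mulr1; apply: eq_big_nat => k /andP[_ kN].
  by rewrite /a in_bN in_HB kN.
(* mu^2 / |lam| = (pi n)^(4 delta - 2), and 2 pi^2 n^2 >= 1 gives exp (- 2 pi^2 n^2 T) <= exp (- T):
   this is the origin of 1 - exp (- T). *)
have ya k : y * (pi * k.+1%:R) `^ (- (kap + 1)) <= a HB k.
  rewrite /a in_HB mul1r muc lamc opprK.
  have -> : (pi * k.+1%:R) `^ (- (kap + 1)) =
     ((pi * k.+1%:R) `^ (2 * delta)) ^+ 2 / (pi * k.+1%:R) ^+ 2.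
    rewrite -!powR_mulrn ?powR_ge0 ?(ltW (pin k))// -powRrM -powRN powD.
    by congr (_ `^ _); rewrite /kap; ring.
  rewrite mulrA ler_wpM2r ?invr_ge0 ?sqr_ge0// mulrC ler_wpM2l ?sqr_ge0//.
  rewrite /y lerB// ler_expR lerN2.
  have pk1 : 1 <= (pi * k.+1%:R) ^+ 2 :> R.
    have pi2 := pi_ge2 R; rewrite exprn_ege1// mulr_ege1 ?ler1n//; lra.
  by rewrite -[leLHS]mul1r ler_wpM2r ?(ltW T_gt0)//; lra.
have y00 : 0 <= y by case/andP: y0.
have := gauss_product_gap N (a_ge0 HB) kap0 y00 ya (lim HB (@subset_refl _ HB)).
rewrite -EphiE// -/(Ephi HB) -EN => gap.
have L0 : 0 <= Ephi HB by rewrite /Ephi EphiE//; apply: Rintegral_ge0 => w _; exact: expR_ge0.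
(* The square root in [gap] is at least 1 plus the stated coefficient; the 1 accounts for the
   subtracted expectation over HB. *)
have := ler_wpM2l L0 (final_estimate kap0 y0 N_ge1) => /le_trans /(_ gap) {gap}.
rewrite mulrDr mulr1 -lerBrDl; apply: le_trans.
have bNc : b N = c N.-1 by rewrite /c prednK.
rewrite bNc lamcN powc prednK// -/y.
rewrite (_ : 2 * - (1 - (1 / 2 + 2 * delta)) = - kap); last by rewrite /kap; field.
rewrite (_ : 4 * delta - 5 = - kap - 4); last by rewrite /kap; ring.
rewrite (_ : 7 * delta - 7 = - 21 / 4 - 7 / 4 * kap); last by rewrite /kap; field.
rewrite -/kap (_ : 2 - 4 * delta = 1 + kap); last by rewrite /kap; ring.
by rewrite !mulrA.
Qed.
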